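(* (i) For $\mathbf\Theta\in H(\mathrm{div}\,\mathbf{div},\mathcal T)$ it holds $$\mathbf\Theta\in H(\mathrm{div}\,\mathbf{div},\Omega)\quad\Longleftrightarrow\quad\langle\mathrm{tr}^{\mathrm{Ggrad}}(z),\mathbf\Theta\rangle_{\mathcal S}=0\quad\forall z\in H^2_0(\Omega).$$ (ii) For every $\boldsymbol q=(\boldsymbol q_T)_{T\in\mathcal T}\in\mathbf H^{-3/2,-1/2}(\mathcal S)$, $$\sum_{T\in\mathcal T}\|\boldsymbol q_T\|_{\mathrm{dDiv},\partial T}^2=\|\boldsymbol q\|_{\mathrm{dDiv},\mathcal S}^2 .$$
   Context: Let $d\in\{2,3\}$ and let $\Omega\subset\mathbb R^d$ be a bounded simply connected Lipschitz domain. $\mathcal T$ is a (finite) mesh of $\Omega$ consisting of pairwise non-intersecting open Lipschitz elements $T$ whose closures cover $\overline\Omega$; $\mathcal S=\{\partial T: T\in\mathcal T\}$. $\mathrm{div}$ is the divergence of vector fields, $\mathbf{div}$ the row-wise divergence of tensors, $\boldsymbol\varepsilon$ the symmetric gradient, so $\boldsymbol\varepsilon\nabla z$ is the Hessian of $z$. $(\cdot,\cdot)_T,\|\cdot\|_T$ are the $L_2(T)$ inner product and norm; without index they refer to $\Omega$. $\mathbb L_2^s(\Omega)$: symmetric $d\times d$ tensor functions with $L_2(\Omega)$ components. $H^2(T)$ is the closure of the smooth functions on $\overline T$ w.r.t. $\|z\|_{2,T}^2=\|z\|_T^2+\|\boldsymbol\varepsilon\nabla z\|_T^2$; $H(\mathrm{div}\,\mathbf{div},T)$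 is the closure of the smooth symmetric tensors on $\overline T$ w.r.t. $\|\mathbf\Theta\|_{\mathrm{div}\,\mathbf{div},T}^2=\|\mathbf\Theta\|_T^2+\|\mathrm{div}\,\mathbf{div}\,\mathbf\Theta\|_T^2$. $H(\mathrm{div}\,\mathbf{div},\mathcal T)=\{\mathbf\Theta\in\mathbb L_2^s(\Omega):\mathbf\Theta|_T\in H(\mathrm{div}\,\mathbf{div},T)\ \forall T\in\mathcal T\}$. $H^2_0(\Omega)$ is the closure of $C_c^\infty(\Omega)$ w.r.t. $\|z\|_2^2=\|z\|^2+\|\boldsymbol\varepsilon\nabla z\|^2$, and $H(\mathrm{div}\,\mathbf{div},\Omega)$ the closure of the smooth symmetric tensors on $\overline\Omega$ w.r.t. $\|\mathbf\Theta\|_{\mathrm{div}\,\mathbf{div}}^2=\|\mathbf\Theta\|^2+\|\mathrm{div}\,\mathbf{div}\,\mathbf\Theta\|^2$. Traces: $\mathrm{tr}^{\mathrm{dDiv}}_T:H(\mathrm{div}\,\mathbf{div},T)\to H^2(T)'$ and $\mathrm{tr}^{\mathrm{Ggrad}}_T:H^2(T)\to H(\mathrm{div}\,\mathbf{div},T)'$ are defined by $$\langle\mathrm{tr}^{\mathrm{dDiv}}_T(\mathbf\Theta),z\rangle_{\partial T}=\langle\mathrm{tr}^{\mathrm{Ggrad}}_T(z),\mathbf\Theta\rangle_{\partial T}=(\mathrm{div}\,\mathbf{div}\,\mathbf\Theta,z)_T-(\mathbf\Theta,\boldsymbol\varepsilon\nabla z)_T .$$ For $z\in H^2_0(\Omega)$,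 $\mathbf\Theta\in H(\mathrm{div}\,\mathbf{div},\mathcal T)$: $\mathrm{tr}^{\mathrm{Ggrad}}(z)=(\mathrm{tr}^{\mathrm{Ggrad}}_T(z))_T$ and $\langle\mathrm{tr}^{\mathrm{Ggrad}}(z),\mathbf\Theta\rangle_{\mathcal S}=\sum_{T}\langle\mathrm{tr}^{\mathrm{Ggrad}}_T(z),\mathbf\Theta\rangle_{\partial T}$. For $\mathbf\Theta\in H(\mathrm{div}\,\mathbf{div},\Omega)$: $\mathrm{tr}^{\mathrm{dDiv}}(\mathbf\Theta)=(\mathrm{tr}^{\mathrm{dDiv}}_T(\mathbf\Theta))_T$; $\mathbf H^{-3/2,-1/2}(\mathcal S)=\mathrm{tr}^{\mathrm{dDiv}}(H(\mathrm{div}\,\mathbf{div},\Omega))$ and $\mathbf H^{-3/2,-1/2}(\partial T)=\mathrm{tr}^{\mathrm{dDiv}}_T(H(\mathrm{div}\,\mathbf{div},T))$. Minimum energy extension norms: $$\|\boldsymbol q\|_{\mathrm{dDiv},\mathcal S}=\inf\{\|\mathbf\Theta\|_{\mathrm{div}\,\mathbf{div}}:\mathbf\Theta\in H(\mathrm{div}\,\mathbf{div},\Omega),\ \mathrm{tr}^{\mathrm{dDiv}}(\mathbf\Theta)=\boldsymbol q\},$$ $$\|\boldsymbol q_T\|_{\mathrm{dDiv},\partial T}=\inf\{\|\mathbf\Theta\|_{\mathrm{div}\,\mathbf{div},T}:\mathbf\Theta\in H(\mathrm{div}\,\mathbf{div},T),\ \mathrm{tr}^{\mathrm{dDiv}}_T(\mathbf\Theta)=\boldsymbol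 q_T\}.$$ *)

(* Defs.v *)
From HB Require Import structures.
From mathcomp Require Import all_boot all_order all_algebra.
From mathcomp Require Import all_classical all_reals all_analysis.

Set Implicit Arguments.
Unset Strict Implicit.
Unset Printing Implicit Defensive.
Import Order.TTheory GRing.Theory Num.Theory.
Import numFieldNormedType.Exports.

Local Open Scope classical_set_scope.
Local Open Scope ring_scope.

Definition rV_display : measure_display. Proof. exact: default_measure_display. Qed.

Section measurable_rV.
Context {R : realType} {n : nat}.

Let coor (i : 'I_n) (v : 'rV[R]_n) : measurableTypeR R := v ord0 i.

Let rV_set0 : g_sigma_preimage coor set0.
Proof. exact: sigma_algebra0. Qed.

Let rV_setC A : g_sigma_preimage coor A -> g_sigma_preimage coor (~` A).
Proof. exact: sigma_algebraC. Qed.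

Let rV_bigcup (F : (set _)^nat) : (forall i, g_sigma_preimage coor (F i)) ->
  g_sigma_preimage coor (\bigcup_i (F i)).
Proof. exact: sigma_algebra_bigcup. Qed.

(* The sigma-algebra generated by the coordinates, i.e. the Borel one. *)
HB.instance Definition _ := @isMeasurable.Build rV_display
  'rV[R]_n (g_sigma_preimage coor) rV_set0 rV_setC rV_bigcup.

Lemma measurable_coor (i : 'I_n) :
  measurable_fun [set: 'rV[R]_n] (fun v : 'rV[R]_n => v ord0 i : R).
Proof.
move=> _ Y mY; rewrite setTI; apply: sub_sigma_algebra => /=.
rewrite -bigcup_seq/=; exists i => /=; first by rewrite mem_index_enum.
by exists Y => //; rewrite setTI.
Qed.

Lemma measurable_fun_rV d (U : measurableType d) (f : U -> 'rV[R]_n) :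
  (forall i, measurable_fun [set: U] (fun u => f u ord0 i : R)) ->
  measurable_fun [set: U] f.
Proof.
move=> mf.
suff h : @measurable _ 'rV[R]_n `<=` [set A | measurable (f @^-1` A)].
  by move=> _ A mA; rewrite setTI; exact: h.
apply: smallest_sub.
  split=> [|A /= mA|F /= mF].
  - by rewrite /= preimage_set0.
  - by rewrite setTD preimage_setC; exact: measurableC.
  - by rewrite preimage_bigcup; exact: bigcup_measurable.
move=> A; rewrite -bigcup_seq => -[i /= _ [B mB <-]].
by rewrite /= setTI -[X in measurable X]setTI; exact: mf.
Qed.

End measurable_rV.

Section lebesgue_rV.
Context {R : realType}.

Definition rV_cons n (p : measurableTypeR R * 'rV[R]_n) : 'rV[R]_n.+1 :=
  row_mx (p.1)%:M p.2.

Definition rV_uncons n (v : 'rV[R]_n.+1) : measurableTypeR R * 'rV[R]_n :=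
  (v ord0 ord0, \row_j v ord0 (lift ord0 j)).

Lemma rV_consK n : cancel (@rV_cons n) (@rV_uncons n).
Proof.
move=> [x v]; rewrite /rV_uncons /rV_cons /=; congr pair.
  rewrite (_ : ord0 = lshift n (ord0 : 'I_1)); last exact: val_inj.
  by rewrite (@row_mxEl _ 1 1 n) mxE.
apply/rowP => j; rewrite mxE.
rewrite (_ : lift ord0 j = rshift 1 j); last exact: val_inj.
by rewrite (@row_mxEr _ 1 1 n).
Qed.

Lemma measurable_rV_cons n : measurable_fun setT (@rV_cons n).
Proof.
apply: measurable_fun_rV => i; rewrite /rV_cons.
case: (splitP (i : 'I_(1 + n))) => [k ik|k ik].
  rewrite (_ : (fun _ => _) = fst); first exact: measurable_fst.
  apply/funext => -[x v] /=; rewrite (_ : i = lshift n k); last exact: val_inj.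
  by rewrite (@row_mxEl _ 1 1 n) mxE !ord1.
rewrite (_ : (fun _ => _) = (fun v : 'rV[R]_n => v ord0 k : R) \o snd).
  exact: measurableT_comp (measurable_coor k) measurable_snd.
apply/funext => -[x v] /=; rewrite (_ : i = rshift 1 k); last exact: val_inj.
by rewrite (@row_mxEr _ 1 1 n).
Qed.

Lemma measurable_rV_uncons n : measurable_fun setT (@rV_uncons n).
Proof.
apply/measurable_fun_pairP; split; first exact: measurable_coor.
apply: measurable_fun_rV => i.
rewrite (_ : (fun _ => _) = fun v : 'rV[R]_n.+1 => v ord0 (lift ord0 i)).
  exact: measurable_coor.
by apply/funext => v; rewrite /= mxE.
Qed.

Section step.
Variables (n : nat) (m : {sigma_finite_measure set 'rV[R]_n -> \bar R}).

Definition lebesgue_cons : set 'rV[R]_n.+1 -> \bar R :=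
  pushforward (lebesgue_measure \x m)%E (@rV_cons n).

Let lc0 : lebesgue_cons set0 = 0%E.
Proof. by rewrite /lebesgue_cons /pushforward preimage_set0 measure0. Qed.

Let lc_ge0 A : (0 <= lebesgue_cons A)%E.
Proof. by rewrite /lebesgue_cons /pushforward; exact: measure_ge0. Qed.

Let lc_sigma_additive : semi_sigma_additive lebesgue_cons.
Proof.
move=> F mF tF mUF.
exact: (@measure_semi_sigma_additive _ _ _
  (measure_function_pushforward__canonical__measure_function_Measure
     (lebesgue_measure \x m)%E (@measurable_rV_cons n)) F mF tF mUF).
Qed.

HB.instance Definition _ :=
  isMeasure.Build _ _ _ lebesgue_cons lc0 lc_ge0 lc_sigma_additive.

Let lc_sigma_finite : sigma_finite setT lebesgue_cons.
Proof.
have /sigma_finiteP[F [TF ndF Foo]] :=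
  sigma_finiteT (@lebesgue_measure R : {sigma_finite_measure set _ -> \bar R}).
have /sigma_finiteP[G [TG ndG Goo]] := sigma_finiteT m.
exists (fun i => @rV_uncons n @^-1` (F i `*` G i)).
  rewrite -preimage_bigcup -[LHS](preimage_setT (@rV_uncons n)); congr preimage.
  rewrite -setXTT TF TG predeqE => -[x y]; split.
    move=> [/= [i _ Fix] [k _ Gky]]; exists (maxn i k) => //; split.
    - by move: x Fix; exact/subsetPset/ndF/leq_maxl.
    - by move: y Gky; exact/subsetPset/ndG/leq_maxr.
  by move=> [i _ []/= ? ?]; split; exists i.
move=> i; have [mF oF] := Foo i; have [mG oG] := Goo i; split.
  rewrite -[X in measurable X]setTI; apply: measurable_rV_uncons => //.
  exact: measurableX.
rewrite /lebesgue_cons /pushforward -comp_preimage.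
rewrite (_ : _ \o _ = id); last by apply/funext => p /=; rewrite rV_consK.
by rewrite preimage_id product_measure1E// lte_mul_pinfty// ge0_fin_numE.
Qed.

HB.instance Definition _ :=
  Measure_isSigmaFinite.Build _ _ _ lebesgue_cons lc_sigma_finite.

Definition lebesgue_step : {sigma_finite_measure set 'rV[R]_n.+1 -> \bar R} :=
  lebesgue_cons.

End step.

Fixpoint lebesgue_rV n : {sigma_finite_measure set 'rV[R]_n -> \bar R} :=
  match n with
  | 0 => \d_(0 : 'rV[R]_0)
  | n'.+1 => lebesgue_step (lebesgue_rV n')
  end.

Lemma lebesgue_rV_box n (A : 'I_n -> set R) : (forall i, measurable (A i)) ->
  lebesgue_rV n [set v : 'rV[R]_n | forall i, A i (v ord0 i)] =
  (\big[mule/1]_(i < n) lebesgue_measure (A i))%E.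
Proof.
elim: n A => [|n IH] A mA.
  by rewrite big_ord0 /= diracE (_ : mkset _ = setT) ?in_setT//;
    apply/seteqP; split=> v //= _ -[].
rewrite /= /lebesgue_cons /pushforward.
set B := [set v : 'rV[R]_n | forall i, A (lift ord0 i) (v ord0 i)].
have mB : measurable B.
  rewrite (_ : B = \big[setI/setT]_(i < n)
      [set v : 'rV[R]_n | A (lift ord0 i) (v ord0 i)]).
    apply: bigsetI_measurable => i _; rewrite -[X in measurable X]setTI.
    exact: (measurable_coor i).
  apply/seteqP; split => v /=.
    by move=> h; rewrite -bigcap_seq => i _ /=.
  by rewrite -bigcap_seq => h i; apply: (h i); rewrite /= mem_index_enum.
have E0 (p : measurableTypeR R * 'rV[R]_n) : rV_cons p ord0 ord0 = p.1.
  by case: p => x v; have [] := rV_consK (x, v).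
have E1 (p : measurableTypeR R * 'rV[R]_n) i :
    rV_cons p ord0 (lift ord0 i) = p.2 ord0 i.
  case: p => x v.
  have /(congr1 snd) /rowP/(_ i) := rV_consK (x, v).
  by rewrite /= mxE.
suff -> : @rV_cons n @^-1`
    [set v : 'rV[R]_n.+1 | forall i, A i (v ord0 i)] = A ord0 `*` B.
  rewrite product_measure1E//; last exact: mA.
  by rewrite big_ord_recl; congr (_ * _)%E; exact: IH.
apply/seteqP; split => p /=.
  by move=> h; split=> [|i]; [rewrite -E0|rewrite -E1]; exact: h.
by move=> [h0 h1] i; case: (unliftP ord0 i) => [j|] ->; rewrite ?E0 ?E1.
Qed.
End lebesgue_rV.

Section domains.
Context {R : realType} {d : nat}.
Local Notation I01 := (`[0 : R, 1 : R]%classic : set R).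
Implicit Types A : set 'rV[R]_d.

Definition is_domain A := [/\ A !=set0, open A & connected A].

Definition path_in A (g : R -> 'rV[R]_d) :=
  {within I01, continuous g} /\ forall t, I01 t -> A (g t).

Definition simply_connected A :=
  (forall x y, A x -> A y -> exists2 g, path_in A g & g 0 = x /\ g 1 = y) /\
  (forall g, path_in A g -> g 0 = g 1 -> exists H : R * R -> 'rV[R]_d,
    [/\ {within I01 `*` I01, continuous H},
        forall s t, I01 s -> I01 t -> A (H (s, t)),
        forall s, I01 s -> H (s, 0) = g s /\ H (s, 1) = g 0 &
        forall t, I01 t -> H (0, t) = g 0 /\ H (1, t) = g 0]).

(* Near each boundary point, after the orthogonal change of coordinates
   y |-> y *m Q, the set is the strict subgraph of a Lipschitz function g of
   the coordinates other than the k-th. *)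
Definition lipschitz_boundary A :=
  forall x, closure A x -> ~ A x ->
  exists (U : set 'rV[R]_d) (Q : 'M[R]_d) (k : 'I_d) (g : 'rV[R]_d.-1 -> R)
    (L : R),
    [/\ open U /\ U x, Q *m Q^T = 1%:M, L.-lipschitz g &
        forall y, U y ->
          A y <-> (y *m Q) 0 k < g (col' k (y *m Q))].

Record mesh (I : finType) (Omega : set 'rV[R]_d) (T : I -> set 'rV[R]_d) :
    Prop := Mesh {
  mesh_nonempty : forall i, T i !=set0;
  mesh_open : forall i, open (T i);
  mesh_lipschitz : forall i, lipschitz_boundary (T i);
  mesh_sub : forall i, T i `<=` Omega;
  mesh_disjoint : trivIset [set: I] T;
  mesh_cover : \bigcup_(i in [set: I]) closure (T i) = closure Omega }.

End domains.

Section classical_operators.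
Context {R : realType} {d : nat}.
Local Notation pt := 'rV[R]_d.

Definition partial (i : 'I_d) (f : pt -> R) : pt -> R := 'D_(delta_mx 0 i) f.

Definition vdiv (v : pt -> 'rV[R]_d) : pt -> R :=
  fun x => \sum_(i < d) partial i (fun y => v y 0 i) x.

Definition tdiv (Theta : pt -> 'M[R]_d) : pt -> 'rV[R]_d :=
  fun x => \row_i vdiv (fun y => row i (Theta y)) x.

Definition grad (z : pt -> R) : pt -> 'rV[R]_d :=
  fun x => \row_i partial i z x.

Definition symgrad (v : pt -> 'rV[R]_d) : pt -> 'M[R]_d :=
  fun x => \matrix_(i, j)
    (2^-1 * (partial j (fun y => v y 0 i) x + partial i (fun y => v y 0 j) x)).

(* All iterated partial derivatives exist and are differentiable, that is,
   f is infinitely differentiable on the whole space. *)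
Definition smooth (f : pt -> R) :=
  forall (s : seq 'I_d) (x : pt), differentiable (foldr partial f s) x.

(* Smooth functions and symmetric tensors on the closure of a set are the
   restrictions of elements of the following two sets. *)
Definition smooth_fun : set (pt -> R) := [set f | smooth f].

Definition smooth_sym : set (pt -> 'M[R]_d) :=
  [set Theta : pt -> 'M[R]_d | (forall i j, smooth (fun x => Theta x i j)) /\
    forall x, (Theta x)^T = Theta x].

Definition compactly_supported (V : zmodType) (A : set pt) (f : pt -> V) :=
  exists K : set pt, [/\ compact K, K `<=` A & forall x, ~ K x -> f x = 0].

Definition test_fun (A : set pt) : set (pt -> R) :=
  smooth_fun `&` [set f | compactly_supported A f].

Definition test_sym (A : set pt) : set (pt -> 'M[R]_d) :=
  smooth_sym `&` [set Theta : pt -> 'M[R]_d | compactly_supported A Theta].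

End classical_operators.

(* Elements of the function spaces are represented by total functions, of which
   only the almost-everywhere class on the given set matters. *)
Section spaces.
Context {R : realType} {d : nat}.
Local Notation pt := 'rV[R]_d.
Local Notation leb := (@lebesgue_rV R d).
Implicit Types A : set pt.

Definition L2 A : set (pt -> R) := [set f : pt -> R | f \_ A \in Lfun leb 2%:E].

Definition L2s A : set (pt -> 'M[R]_d) :=
  [set Theta : pt -> 'M[R]_d | (forall i j, L2 A (fun x => Theta x i j)) /\
    forall x, A x -> (Theta x)^T = Theta x].

Definition ip A (f g : pt -> R) : R := \int[leb]_(x in A) (f x * g x).

Definition ipM A (Theta Psi : pt -> 'M[R]_d) : R :=
  \int[leb]_(x in A) (\sum_(i < d) \sum_(j < d) Theta x i j * Psi x i j).

(* Distributional div div; only meant for symmetric Theta, since the test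
   tensor symgrad (grad phi) is symmetric. *)
Definition is_divdiv A (Theta : pt -> 'M[R]_d) (w : pt -> R) :=
  L2 A w /\
  forall phi, test_fun A phi -> ip A w phi = ipM A Theta (symgrad (grad phi)).

(* Distributional symgrad grad, tested against symmetric tensors because H is
   itself symmetric. *)
Definition is_hess A (z : pt -> R) (H : pt -> 'M[R]_d) :=
  L2s A H /\
  forall Phi, test_sym A Phi -> ipM A H Phi = ip A z (vdiv (tdiv Phi)).

(* Both operators pick a representative, unique up to null sets when A is open;
   they are arbitrary outside of the spaces H2_ambient A and Hdivdiv_ambient A. *)
Definition divdiv A (Theta : pt -> 'M[R]_d) : pt -> R :=
  get [set w | is_divdiv A Theta w].

Definition hess A (z : pt -> R) : pt -> 'M[R]_d :=
  get [set H | is_hess A z H].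

Definition norm_H2 A (z : pt -> R) : R :=
  Num.sqrt (ip A z z + ipM A (hess A z) (hess A z)).

Definition norm_divdiv A (Theta : pt -> 'M[R]_d) : R :=
  Num.sqrt (ipM A Theta Theta + ip A (divdiv A Theta) (divdiv A Theta)).

(* Closure of S with respect to the norm N in the ambient space X. For a bounded
   set A, the ambient spaces below, consisting of the L2 objects whose
   distributional derivative is in L2, are complete (modulo null sets) and
   contain the smooth objects, so that these closures are the completions. *)
Definition norm_closure (V : zmodType) (X : set V) (N : V -> R) (S : set V) :
    set V :=
  [set f | X f /\ forall e, 0 < e -> exists2 g, S g & N (f - g) < e].

Definition H2_ambient A : set (pt -> R) :=
  [set z : pt -> R | L2 A z /\ exists H, is_hess A z H].

Definition Hdivdiv_ambient A : set (pt -> 'M[R]_d) :=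
  [set Theta : pt -> 'M[R]_d | L2s A Theta /\ exists w, is_divdiv A Theta w].

Definition H2 A : set (pt -> R) :=
  norm_closure (H2_ambient A) (norm_H2 A) smooth_fun.

Definition H20 A : set (pt -> R) :=
  norm_closure (H2_ambient A) (norm_H2 A) (test_fun A).

Definition Hdivdiv A : set (pt -> 'M[R]_d) :=
  norm_closure (Hdivdiv_ambient A) (norm_divdiv A) smooth_sym.

Definition bracket A (Theta : pt -> 'M[R]_d) (z : pt -> R) : R :=
  ip A (divdiv A Theta) z - ipM A Theta (hess A z).

(* Functionals on H2 A and on Hdivdiv A are real functions on these sets, seen
   as types. *)
Definition tr_dDiv A (Theta : pt -> 'M[R]_d) : H2 A -> R :=
  fun z => bracket A Theta (set_val z).

Definition tr_Ggrad A (z : pt -> R) : Hdivdiv A -> R :=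
  fun Theta => bracket A (set_val Theta) z.

Arguments tr_dDiv A Theta _ : clear implicits.
Arguments tr_Ggrad A z _ : clear implicits.

Definition norm_dDiv_loc A (q : H2 A -> R) : R :=
  inf (norm_divdiv A @`
    [set Theta : pt -> 'M[R]_d | Hdivdiv A Theta /\ tr_dDiv A Theta = q]).

Section skeleton.
Variables (I : finType) (Omega : set pt) (T : I -> set pt).

Definition Hdivdiv_mesh : set (pt -> 'M[R]_d) :=
  [set Theta : pt -> 'M[R]_d |
    L2s Omega Theta /\ forall i, Hdivdiv (T i) Theta].

Lemma Hdivdiv_meshP (Theta : Hdivdiv_mesh) i : set_val Theta \in Hdivdiv (T i).
Proof. by have [_ h] := set_valP Theta; exact/mem_set. Qed.

Definition Hdivdiv_restr (Theta : Hdivdiv_mesh) i : Hdivdiv (T i) :=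
  SigSub (Hdivdiv_meshP Theta i).

Definition tr_Ggrad_mesh (z : pt -> R) : forall i, Hdivdiv (T i) -> R :=
  fun i => tr_Ggrad (T i) z.

Definition pairing_mesh (q : forall i, Hdivdiv (T i) -> R)
    (Theta : Hdivdiv_mesh) : R :=
  \sum_i q i (Hdivdiv_restr Theta i).

Definition tr_dDiv_mesh (Theta : pt -> 'M[R]_d) : forall i, H2 (T i) -> R :=
  fun i => tr_dDiv (T i) Theta.

(* The space H^{-3/2,-1/2} of the skeleton. *)
Definition Htrace_mesh : set (forall i, H2 (T i) -> R) :=
  tr_dDiv_mesh @` Hdivdiv Omega.

Definition norm_dDiv_mesh (q : forall i, H2 (T i) -> R) : R :=
  inf (norm_divdiv Omega @`
    [set Theta : pt -> 'M[R]_d | Hdivdiv Omega Theta /\ tr_dDiv_mesh Theta = q]).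

End skeleton.
End spaces.

Arguments tr_dDiv {R d} A Theta _.
Arguments tr_Ggrad {R d} A z _.
Arguments tr_dDiv_mesh {R d I} T Theta i _.
Arguments tr_Ggrad_mesh {R d I} T z i _.
Arguments Htrace_mesh {R d I} Omega T _.
Arguments norm_dDiv_mesh {R d I} Omega T q.

(* Main.v *)
Require Import Defs.
From HB Require Import structures.
From mathcomp Require Import all_boot all_order all_algebra.
From mathcomp Require Import all_classical all_reals all_analysis.
From mathcomp Require Import measurable_realfun ring lra.
Set Implicit Arguments.
Unset Strict Implicit.
Unset Printing Implicit Defensive.
Import Order.TTheory GRing.Theory Num.Theory.
Import numFieldNormedType.Exports.
Local Open Scope classical_set_scope.
Local Open Scope ring_scope.

(** For a tensor Theta that lies in H(div div) of each element, the double
    divergences on the elements glue to a function w on Omega. Summed over the mesh,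
    the brackets of Theta with z equal the difference of the integrals over Omega of
    w z and of the contraction of Theta with the Hessian of z, because the elements
    fill Omega up to their boundaries and Lipschitz boundaries are null sets
    ([boundary_null], [bracket_mesh]). If Theta lies in H(div div) of Omega, this
    vanishes for test functions z, hence for their limits in H^2_0
    ([bracket_H20]). Conversely, if it vanishes for all test functions, then w is the
    weak double divergence of Theta on Omega ([Hdivdiv_mesh_iff]), and it remains to
    approximate Theta by smooth tensors.

    This density ([smooth_sym_dense]) is the analytic core. If it failed, the
    orthogonal projection onto the closure of the smooth tensors in the graph norm
    would leave a nonzero residual (v, E). Orthogonality to all tensors that are
    smooth up to the boundary makes E minus the weak Hessian of v on the whole space,
    after extension by zero. Inside Omega, v is the weak double divergence of E, that is,
    the defect

      (v, phi) - (E, Hessian of phi)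

    vanishes for all test functions phi. Inserting the mollification of v for phi
    would yield the squared norm of (v, E) in the limit, but this function is not
    supported in Omega. It is therefore cut into pieces by smooth cutoffs; each
    piece is translated into Omega along a direction that the Lipschitz graph
    provides ([inward_direction]), and the error is small because translations are
    continuous on L2 ([translation_continuous]) while the second derivatives of the
    pieces stay bounded ([smoothing_bounds]). Hence v and E vanish
    ([biorthogonal_eq0]).

    The second part rests on the additivity of the squared norms over the mesh.
    A tensor with trace q restricts to the elements, where it competes for the local
    minima. Conversely, arbitrary local competitors glue to a tensor whose brackets
    are those of a tensor in H(div div) of Omega with trace q; by the first part, the
    glued tensor lies in H(div div) of Omega. Therefore the minimization decouples
    ([inf_sum_sq]). *)

(** * Orthogonal projections *)

(** The minimum of the quadratic is attained at t = - b / c; if c vanishes, a nonzero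
    b would make the affine function negative somewhere. *)
Lemma discriminant_le (R : realType) (a b c : R) : 0 <= c ->
  (forall t, 0 <= a + 2 * t * b + t ^+ 2 * c) -> b ^+ 2 <= a * c.
Proof.
rewrite le_eqVlt => /predU1P[<-|c0] key.
  suff -> : b = 0 by rewrite expr0n mulr0.
  apply/eqP/negP => /negP b0.
  have := key (- (a + 1) / (2 * b)).
  have -> : a + 2 * (- (a + 1) / (2 * b)) * b + (- (a + 1) / (2 * b)) ^+ 2 * 0 = -1.
    by field.
  by rewrite leNgt oppr_lt0 ltr01.
have := key (- b / c).
have -> : a + 2 * (- b / c) * b + (- b / c) ^+ 2 * c = (a * c - b ^+ 2) / c.
  by field; rewrite gt_eqF.
by rewrite pmulr_lge0 ?invr_gt0// subr_ge0.
Qed.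

Section orthogonal_projection.
Context (R : realType) (V : lmodType R) (X S : set V) (b : V -> V -> R).
Hypothesis X_lin : forall a u v, X u -> X v -> X (a *: u + v).
Hypothesis b_lin : forall a u v w, X u -> X v -> X w ->
  b (a *: u + v) w = a * b u w + b v w.
Hypothesis b_sym : forall u v, X u -> X v -> b u v = b v u.
Hypothesis b_ge0 : forall u, X u -> 0 <= b u u.
Hypothesis X_complete : forall u : nat -> V, (forall n, X (u n)) ->
  (forall e : R, 0 < e -> exists N, forall m n, (N <= m)%N -> (N <= n)%N ->
     b (u m - u n) (u m - u n) < e) ->
  exists2 l, X l & forall e : R, 0 < e -> exists N, forall n, (N <= n)%N ->
     b (u n - l) (u n - l) < e.
Hypothesis SX : S `<=` X.
Hypothesis S0 : S 0.
Hypothesis S_lin : forall a u v, S u -> S v -> S (a *: u + v).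

Lemma b_sqD a u v : X u -> X v ->
  b (a *: u + v) (a *: u + v) = b v v + 2 * a * b u v + a ^+ 2 * b u u.
Proof.
move=> Xu Xv; have Xw := X_lin a Xu Xv.
rewrite b_lin// (b_sym Xu Xw) (b_sym Xv Xw) !b_lin// (b_sym Xv Xu); ring.
Qed.

Lemma b_CauchySchwarz u v : X u -> X v -> b u v ^+ 2 <= b u u * b v v.
Proof.
move=> Xu Xv; apply: discriminant_le (b_ge0 Xv) _ => t.
by have := b_ge0 (X_lin t Xv Xu); rewrite b_sqD// (b_sym Xv Xu).
Qed.

(** The nearest point of the closure of a subspace, as the limit of a
    minimizing sequence, which the parallelogram identity makes Cauchy. *)
Lemma orthogonal_projection x : X x -> exists p, [/\ X p,
  forall e : R, 0 < e -> exists2 s, S s & b (s - p) (s - p) < e &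
  forall s, S s -> b (x - p) s = 0].
Proof.
move=> Xx.
have XB u v : X u -> X v -> X (u - v).
  by move=> Xu Xv; rewrite addrC -scaleN1r; exact: X_lin.
have X0 := SX S0.
have XZ a u : X u -> X (a *: u) by move=> Xu; rewrite -[_ *: _]addr0; exact: X_lin.
have SZ a u : S u -> S (a *: u) by move=> Su; rewrite -[_ *: _]addr0; exact: S_lin.
pose E := [set b (x - s) (x - s) | s in S].
have E0 : E (b (x - 0) (x - 0)) by exists 0.
have lbE : lbound E 0 by move=> _ [s Ss <-]; apply: b_ge0; apply: XB => //; exact: SX.
have hE : has_inf E by split; [exists (b (x - 0) (x - 0))|exists 0].
have dle s : S s -> inf E <= b (x - s) (x - s).
  by move=> Ss; apply: (ge_inf hE.2); exists s.
have /choice[u uP] : forall n : nat, exists s, S s /\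
    b (x - s) (x - s) < inf E + n.+1%:R^-1.
  move=> n; have n0 : (0 : R) < n.+1%:R^-1 by rewrite invr_gt0.
  have [_ [s Ss <-] h] := inf_adherent n0 hE.
  by exists s.
have Su n := (uP n).1; have ub n := (uP n).2; have Xu n := SX (Su n).
have nlt (N n : nat) : (N <= n)%N -> (n.+1%:R^-1 : R) <= N.+1%:R^-1.
  by move=> Nn; rewrite lef_pV2 ?posrE// ler_nat.
have small (e : R) : 0 < e -> exists N : nat, N.+1%:R^-1 < e.
  move=> e0; have [N] := ltr_add_invr e0; rewrite add0r => h; by exists N.
have [p Xp up] : exists2 l, X l & forall e : R, 0 < e -> exists N, forall n, (N <= n)%N ->
     b (u n - l) (u n - l) < e.
  apply: X_complete => // e e0.
  have [N Ne] := small (e / 4) (divr_gt0 e0 (ltr0n _ 4)).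
  exists N => m n Nm Nn.
  pose y := x - u m; pose z := x - u n.
  have Xy : X y by exact: XB. have Xz : X z by exact: XB.
  (* the parallelogram identity for x - u m and x - u n, whose mean is the
     difference of x and a point of S *)
  have h1 := b_sqD (-1) Xy Xz.
  have h2 := b_sqD 1 Xy Xz.
  have e1 : -1 *: y + z = u m - u n by rewrite /y /z scaleN1r opprB addrA subrK.
  have e2 : 1 *: y + z = 2 *: (x - 2^-1 *: (u m + u n)).
    rewrite scale1r scalerBr scalerA divff ?pnatr_eq0// scale1r scaler_nat mulr2n.
    by rewrite /y /z opprD addrACA.
  have Sw : S (2^-1 *: (u m + u n)).
    by apply: (SZ); rewrite -[u m]scale1r; exact: S_lin.
  have Xw := XB _ _ Xx (SX Sw).
  have h3 := dle _ Sw.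
  have h4 : b (2 *: (x - 2^-1 *: (u m + u n))) (2 *: (x - 2^-1 *: (u m + u n)))
     = 4 * b (x - 2^-1 *: (u m + u n)) (x - 2^-1 *: (u m + u n)).
    have := b_lin 1 X0 X0 X0; have := b_lin 1 X0 X0 Xw.
    rewrite scaler0 addr0 !mul1r => h5 h6.
    have := b_sqD 2 Xw X0; rewrite !addr0 (b_sym Xw X0) => ->; lra.
  move: h1 h2 h4; rewrite e1 e2 => -> h2 h4.
  have := ub m; have := ub n; have := nlt _ _ Nm; have := nlt _ _ Nn.
  move: h2; rewrite h4 -/y -/z; move: h3 Ne.
  set A := inf E; set B := b (x - _ *: _) _.
  move: (N.+1%:R^-1) (n.+1%:R^-1) (m.+1%:R^-1) => rN rn rm.
  rewrite expr1n sqrrN expr1n !mul1r => hB hN heq hn hm hz hy; lra.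
exists p; split=> //.
  by move=> e e0; have [N h] := up e e0; exists (u N) => //; exact: h.
move=> s Ss; have Xs := SX Ss.
(* moving u n in the direction s gains at most n.+1^-1 *)
have orth n : b (x - u n) s ^+ 2 <= n.+1%:R^-1 * b s s.
  apply: discriminant_le; first exact: b_ge0.
  move=> t; have Xxu := XB _ _ Xx (Xu n).
  have := b_sqD t Xs Xxu; have := dle _ (S_lin (- t) Ss (Su n)).
  have -> : x - (- t *: s + u n) = t *: s + (x - u n).
    by rewrite opprD scaleNr opprK addrCA.
  rewrite (b_sym Xs Xxu); have := ub n.
  move: (n.+1%:R^-1) => r h1 h2 h3; lra.
have split n : b (x - p) s = b (x - u n) s + b (u n - p) s.
  have -> : x - p = 1 *: (x - u n) + (u n - p) by rewrite scale1r addrA subrK.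
  by rewrite b_lin ?mul1r//; exact: XB.
suff: b (x - p) s ^+ 2 <= 0.
  by rewrite le_eqVlt ltNge sqr_ge0 orbF sqrf_eq0 => /eqP.
apply/ler_addgt0Pl => e e0; rewrite addr0.
have c0 := b_ge0 Xs.
have f0 : 0 < e / (4 * (b s s + 1)) by rewrite divr_gt0// mulr_gt0// ltr_wpDl.
have [N1 h1] := small _ f0; have [N2 h2] := up _ f0.
pose n := maxn N1 N2.
have k1 : n.+1%:R^-1 <= e / (4 * (b s s + 1)).
  by apply: ltW; apply: le_lt_trans h1; apply: nlt; exact: leq_maxl.
have k2 := ltW (h2 n (leq_maxr _ _)).
have k3 := b_CauchySchwarz (XB _ _ (Xu n) Xp) Xs.
have k4 : e / (4 * (b s s + 1)) * b s s <= e / 4.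
  rewrite invfM mulrA -mulrA ler_piMr ?divr_ge0 ?(ltW e0)//.
  by rewrite mulrC ler_pdivrMr ?ltr_wpDl// mul1r lerDl.
have k5 := le_trans (orth n) (le_trans (ler_wpM2r c0 k1) k4).
have k6 := le_trans k3 (le_trans (ler_wpM2r c0 k2) k4).
rewrite (split n); move: k5 k6; set y := b _ _; set z := b _ _ => k5 k6.
have := sqr_ge0 (y - z); nra.
Qed.

End orthogonal_projection.

(** * Square-integrable functions *)

Section square_integrable.
Context d (T : measurableType d) (R : realType) (mu : {measure set T -> \bar R}).
Local Notation L2 := (Lfun mu 2%:E).
Implicit Types f g h : T -> R.

Definition L2dot f g : R := \int[mu]_x (f x * g x).

Lemma Lfun2P f : f \in L2 <->
  measurable_fun setT f /\ mu.-integrable setT (EFin \o (fun x => f x ^+ 2)).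
Proof.
split=> [fL|[mf f2]].
  split; last exact: Lfun2_integrable_sqr.
  by move: fL; rewrite inE => /andP[/[!inE]].
rewrite inE; apply/andP; split; rewrite inE//= /finite_norm unlock poweR_lty//.
have /integrableP[_] := f2; apply: le_lt_trans.
apply: ge0_le_integral => //=.

- apply/measurable_EFinP.
  by apply: (@measurableT_comp _ _ _ _ _ _ (@powR R ^~ 2)) => //; exact: measurableT_comp.
- by apply/measurable_EFinP; apply: measurableT_comp => //; exact: measurable_funX.
- by move=> x _; rewrite lee_fin normrX powR_mulrn.
Qed.

Lemma Lfun2_measurable f : f \in L2 -> measurable_fun setT f.
Proof. by move=> /Lfun2P[]. Qed.

Lemma Lfun2D f g : f \in L2 -> g \in L2 -> (fun x => f x + g x) \in L2.
Proof. by move=> fL gL; rewrite (_ : (fun x => _) = f + g)// rpredD// lee1n. Qed.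

Lemma Lfun2Z (a : R) f : f \in L2 -> (fun x => a * f x) \in L2.
Proof.
move=> fL; rewrite (_ : (fun x => _) = a \o* f); last by apply/funext => x/=; rewrite mulrC.
by apply: Lfun_scale => //; rewrite ler1n.
Qed.

Lemma Lfun2N f : f \in L2 -> (fun x => - f x) \in L2.
Proof.
by move=> fL; rewrite (_ : (fun x => _) = (fun x => -1 * f x)) ?Lfun2Z//; apply/funext => x; rewrite mulN1r.
Qed.

Lemma Lfun2B f g : f \in L2 -> g \in L2 -> (fun x => f x - g x) \in L2.
Proof. by move=> fL gL; apply: Lfun2D => //; exact: Lfun2N. Qed.

Lemma Lfun2_0 : (fun=> 0 : R) \in L2.
Proof.
apply/Lfun2P; split; first exact: measurable_cst.
rewrite (_ : _ \o _ = cst 0%E); first exact: integrable0.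
by apply/funext => x /=; rewrite expr0n.
Qed.

Lemma Lfun2_sum (J : Type) (r : seq J) (P : pred J) (f : J -> T -> R) :
  (forall j, P j -> f j \in L2) -> (fun x => \sum_(j <- r | P j) f j x) \in L2.
Proof.
move=> fL; elim: r => [|j r IH].
  by under eq_fun do rewrite big_nil; exact: Lfun2_0.
rewrite (_ : (fun x => _) = fun x => (if P j then f j x else 0) +
    \sum_(i <- r | P i) f i x); last first.
  by apply/funext => x; rewrite big_cons; case: ifP => //; rewrite add0r.
by apply: Lfun2D => //; case Pj : (P j); [exact: fL|exact: Lfun2_0].
Qed.

Lemma Lfun2_le f g : g \in L2 -> measurable_fun setT f ->
  (forall x, `|f x| <= `|g x|) -> f \in L2.
Proof.
move=> /Lfun2P[mg ig] mf fg; apply/Lfun2P; split => //.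
apply: le_integrable ig => //.
  by apply/measurable_EFinP; exact: measurable_funX.
by move=> x _ /=; rewrite lee_fin !normrX lerXn2r ?nnegrE.
Qed.

Lemma Lfun2M_bounded (C : R) f g : g \in L2 -> measurable_fun setT f ->
  (forall x, `|f x| <= C) -> (fun x => f x * g x) \in L2.
Proof.
move=> gL mf fC; apply: (@Lfun2_le _ (fun x => C * g x)); first exact: Lfun2Z.
  by apply: measurable_funM => //; exact: Lfun2_measurable.
by move=> x; rewrite !normrM ler_wpM2r// (le_trans (fC x))// ler_norm.
Qed.

Lemma Lfun2_restrict (A : set T) f : measurable A -> f \in L2 -> f \_ A \in L2.
Proof.
move=> mA fL; apply: (Lfun2_le fL).
  apply/(measurable_restrictT f mA).
  by apply: measurable_funTS; exact: Lfun2_measurable.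
by move=> x; rewrite patchE; case: ifPn => // _; rewrite normr0.
Qed.

Lemma Lfun2_indic (A : set T) : measurable A -> (mu A < +oo)%E ->
  (\1_A : T -> R) \in L2.
Proof.
move=> mA fA; apply/Lfun2P; split; first exact: measurable_indic.
rewrite (_ : _ \o _ = EFin \o \1_A).
  apply/integrableP; split.
    by apply/measurable_EFinP; exact: measurable_indic.
  under eq_integral => x _ do rewrite /= ger0_norm//.
  by rewrite integral_indic// setIT.
by apply/funext => x /=; rewrite indicE; case: (_ \in _); rewrite ?expr1n ?expr0n.
Qed.

Lemma dot_integrable f g : f \in L2 -> g \in L2 ->
  mu.-integrable setT (EFin \o (fun x => f x * g x)).
Proof. by move=> fL gL; apply/Lfun1_integrable; exact: Lfun2_mul_Lfun1. Qed.

Lemma dotC f g : L2dot f g = L2dot g f.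
Proof. by apply: eq_Rintegral => x _; rewrite mulrC. Qed.

Lemma dotDl f g h : f \in L2 -> g \in L2 -> h \in L2 ->
  L2dot (fun x => f x + g x) h = L2dot f h + L2dot g h.
Proof.
move=> fL gL hL; rewrite /L2dot -RintegralD//; try exact: dot_integrable.
by apply: eq_Rintegral => x _; rewrite mulrDl.
Qed.

Lemma dotZl a f h : f \in L2 -> h \in L2 ->
  L2dot (fun x => a * f x) h = a * L2dot f h.
Proof.
move=> fL hL; rewrite /L2dot -RintegralZl//; try exact: dot_integrable.
by apply: eq_Rintegral => x _; rewrite mulrA.
Qed.

Lemma dotNl f h : f \in L2 -> h \in L2 -> L2dot (fun x => - f x) h = - L2dot f h.
Proof.
move=> fL hL; rewrite -mulN1r -dotZl//.
by apply: eq_Rintegral => x _; rewrite mulN1r.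
Qed.

Lemma dotBl f g h : f \in L2 -> g \in L2 -> h \in L2 ->
  L2dot (fun x => f x - g x) h = L2dot f h - L2dot g h.
Proof. by move=> fL gL hL; rewrite dotDl ?dotNl//; exact: Lfun2N. Qed.

Lemma dotBr f g h : f \in L2 -> g \in L2 -> h \in L2 ->
  L2dot h (fun x => f x - g x) = L2dot h f - L2dot h g.
Proof. by move=> fL gL hL; rewrite dotC dotBl// !(dotC h). Qed.

Lemma dot0l h : L2dot (fun=> 0) h = 0.
Proof.
rewrite /L2dot (_ : (fun x => _) = cst 0); last by apply/funext => x; rewrite mul0r.
by rewrite Rintegral_cst// mul0r.
Qed.

Lemma dot_suml (J : Type) (r : seq J) (P : pred J) (f : J -> T -> R) h :
  (forall j, P j -> f j \in L2) -> h \in L2 ->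
  L2dot (fun x => \sum_(j <- r | P j) f j x) h = \sum_(j <- r | P j) L2dot (f j) h.
Proof.
move=> fL hL; elim: r => [|j r IH].
  by under eq_fun do rewrite big_nil; rewrite big_nil dot0l.
rewrite (_ : (fun x => _) = fun x => (if P j then f j x else 0) +
    \sum_(i <- r | P i) f i x); last first.
  by apply/funext => x; rewrite big_cons; case: ifP => //; rewrite add0r.
have fjL : (fun x => if P j then f j x else 0) \in L2.
  by case Pj : (P j); [exact: fL|exact: Lfun2_0].
rewrite dotDl ?IH//; last exact: Lfun2_sum.
by rewrite big_cons; case: ifP => // _; rewrite dot0l add0r.
Qed.

Lemma dot_ge0 f : 0 <= L2dot f f.
Proof. by apply: Rintegral_ge0 => x _; rewrite -expr2 sqr_ge0. Qed.

Lemma dot_le f g : g \in L2 -> measurable_fun setT f ->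
  (forall x, `|f x| <= `|g x|) -> L2dot f f <= L2dot g g.
Proof.
move=> gL mf fg; have fL := Lfun2_le gL mf fg.
apply: le_Rintegral => //; try exact: dot_integrable.
by move=> x _; rewrite -!expr2 -(real_normK (num_real (f x))) -(real_normK (num_real (g x)))
  lerXn2r ?nnegrE.
Qed.

Lemma dot_sqD f g : f \in L2 -> g \in L2 ->
  L2dot (fun x => f x + g x) (fun x => f x + g x) = L2dot f f + 2 * L2dot f g + L2dot g g.
Proof.
move=> fL gL; have fgL := Lfun2D fL gL.
rewrite dotDl// !(dotC _ (fun x => f x + g x)) !dotDl// (dotC g f); ring.
Qed.

Lemma dot_CauchySchwarz f g : f \in L2 -> g \in L2 ->
  L2dot f g ^+ 2 <= L2dot f f * L2dot g g.
Proof.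
move=> fL gL; apply: discriminant_le (dot_ge0 g) _ => t.
have tgL := Lfun2Z t gL.
have := dot_ge0 (fun x => f x + t * g x); rewrite dot_sqD// dotZl//.
by rewrite (dotC f) !(dotC g) !dotZl// (dotC g f); congr (_ <= _); ring.
Qed.

Lemma dot_le_norm f g : f \in L2 -> g \in L2 ->
  `|L2dot f g| <= Num.sqrt (L2dot f f) * Num.sqrt (L2dot g g).
Proof.
move=> fL gL; rewrite -sqrtrM ?dot_ge0// -sqrtr_sqr.
by rewrite ler_sqrt ?mulr_ge0 ?dot_ge0// dot_CauchySchwarz.
Qed.

Lemma dot_sqB f g : f \in L2 -> g \in L2 ->
  L2dot (fun x => f x - g x) (fun x => f x - g x) = L2dot f f - 2 * L2dot f g + L2dot g g.
Proof.
move=> fL gL; have gN := Lfun2N gL.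
rewrite dot_sqD// (dotC f) !dotNl// (dotC g (fun x => - g x)) dotNl// (dotC g f); ring.
Qed.

Lemma dot_sqD_le f g : f \in L2 -> g \in L2 ->
  L2dot (fun x => f x + g x) (fun x => f x + g x) <= 2 * L2dot f f + 2 * L2dot g g.
Proof.
move=> fL gL; rewrite dot_sqD//.
have := dot_ge0 (fun x => f x - g x); rewrite dot_sqB//; lra.
Qed.

Lemma dot_ae f f' g : measurable_fun setT f -> measurable_fun setT f' ->
  measurable_fun setT g -> (\forall x \ae mu, f x = f' x) -> L2dot f g = L2dot f' g.
Proof.
move=> mf mf' mg ff'; congr fine; apply: ae_eq_integral => //.
- by apply/measurable_EFinP; exact: measurable_funM.
- by apply/measurable_EFinP; exact: measurable_funM.
- by apply: filterS ff' => x -> _.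
Qed.

Lemma dot_eq0 f : f \in L2 -> L2dot f f = 0 -> \forall x \ae mu, f x = 0.
Proof.
move=> fL f0.
have if2 := dot_integrable fL fL.
have : (\int[mu]_x `|(f x * f x)%:E| = 0)%E.
  rewrite -(fineK (integrable_fin_num _ (integrable_abse if2)))//.
  congr EFin; rewrite -[RHS]f0; congr fine; apply: eq_integral => x _ /=.
  by rewrite ger0_norm// -expr2 sqr_ge0.
move/ae_eq_integral_abs => /(_ measurableT (measurable_int _ if2)).
by apply: filterS => x /(_ I) /= [] /eqP; rewrite mulf_eq0 orbb => /eqP.
Qed.

End square_integrable.

(** * Completeness of the space of square-integrable functions *)

Section completeness.
Context d (T : measurableType d) (R : realType) (mu : {measure set T -> \bar R}).
Local Notation L2 := (Lfun mu 2%:E).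
Local Notation dot := (L2dot mu).

Definition L2sqn (f : T -> R) := dot f f.

(** A sequence whose consecutive distances decay like 8^-k converges almost
    everywhere: the weighted sum S of the 4^k |v_(k+1) - v_k|^2 is integrable and
    bounds |v_m - v_k| by a multiple of 2^-k sqrt S for all m >= k. *)
Lemma fast_Cauchy_cvg (v : nat -> T -> R) : (forall k, v k \in L2) ->
  (forall k, L2sqn (fun x => v k.+1 x - v k x) <= 8^-1 ^+ k) ->
  exists2 l, l \in L2 & forall k, L2sqn (fun x => v k x - l x) <= 8 * 4^-1 ^+ k.
Proof.
move=> vL v8.
pose dv k x := v k.+1 x - v k x.
have dvL k : dv k \in L2 by exact: Lfun2B.
pose s k x : \bar R := (4 ^+ k * dv k x ^+ 2)%:E.
have s0 k x : (0 <= s k x)%E by rewrite lee_fin mulr_ge0 ?sqr_ge0 ?exprn_ge0.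
have ms k : measurable_fun setT (s k).
  apply/measurable_EFinP; apply: measurable_funM => //; apply: measurable_funX.
  exact: Lfun2_measurable (dvL k).
pose S x := (\sum_(0 <= k <oo) s k x)%E.
have S0 x : (0 <= S x)%E by exact: nneseries_ge0.
have mS : measurable_fun setT S by exact: ge0_emeasurable_sum.
have intS : (\int[mu]_x S x <= 2%:E)%E.
  rewrite /S integral_nneseries//.
  have -> : 2%:E = (\sum_(0 <= k <oo) (2 / (2 ^ (k + 1))%:R : R)%:E)%E.
    apply/esym/cvg_lim => //.
    have := @cvg_geometric_eseries_half R 2 0; rewrite expr0 divr1.
    exact: cvg_trans.
  apply: lee_nneseries => k _; first by move=> _; exact: integral_ge0.
  have if2 := dot_integrable (dvL k) (dvL k).
  have -> : (\int[mu]_x s k x = (4 ^+ k)%:E * \int[mu]_x (dv k x * dv k x)%:E)%E.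
    by rewrite -integralZl//; apply: eq_integral => x _; rewrite /s EFinM expr2.
  rewrite -[X in (_ * X <= _)%E]fineK; last exact: (integrable_fin_num _ if2).
  rewrite -EFinM lee_fin.
  have -> : 2 / (2 ^ (k + 1))%:R = 4 ^+ k * 8^-1 ^+ k :> R.
    rewrite addn1 expnS natrM invfM mulrA divff ?mul1r// -exprMn.
    by rewrite natrX -exprVn; congr (_ ^+ _); field.
  by rewrite ler_wpM2l ?exprn_ge0//; exact: v8.
have iS : mu.-integrable setT S.
  apply/integrableP; split => //.
  under eq_integral do rewrite gee0_abs//.
  exact: le_lt_trans intS (ltry _).
(* the sequence is set to zero on the null set where S is infinite, so that
   the bounds below hold everywhere *)
pose A := [set x | (S x < +oo)%E].
have mA : measurable A.
  by rewrite -[A]setTI; apply: emeasurable_fun_infty_o => //.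
have aeA : \forall x \ae mu, A x.
  by apply: filterS (integrable_ae measurableT iS) => x /(_ I) /fin_numPlt /andP[].
pose w k := v k \_ A.
have wL k : w k \in L2 by exact: Lfun2_restrict.
pose G x := fine ((S \_ A) x).
have GE x : A x -> (G x)%:E = S x.
  by move=> Ax; rewrite /G patchE mem_set// fineK// ge0_fin_numE.
have G0 x : 0 <= G x by rewrite /G patchE; case: ifP => //= _; exact: fine_ge0.
have iG : mu.-integrable setT (EFin \o G).
  apply: (@eq_integrable _ _ _ _ _ measurableT (S \_ A)).
    move=> x _ /=; rewrite /G patchE; case: ifPn => // /set_mem Ax.
    by rewrite fineK// ge0_fin_numE.
  by apply/(integrable_mkcond _ mA); exact: integrableS iS.
have intG : \int[mu]_x G x <= 2.
  rewrite -lee_fin fineK; last exact: integrable_fin_num.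
  apply: le_trans intS; apply: ge0_le_integral => //.
  - by move=> x _ /=; rewrite lee_fin.
  - by case/integrableP : iG.
  - by move=> x _ /=; have [/GE ->//|nA] := pselect (A x);
      rewrite /G patchE memNset.
have dw k x : `|w k.+1 x - w k x| <= 2^-1 ^+ k * Num.sqrt (G x).
  have [Ax|nA] := pselect (A x); last first.
    rewrite /w !patchE memNset// subrr normr0.
    by rewrite mulr_ge0 ?exprn_ge0 ?sqrtr_ge0.
  rewrite -(@ler_pXn2r _ 2) ?nnegrE ?mulr_ge0 ?exprn_ge0 ?sqrtr_ge0//.
  rewrite exprMn sqr_sqrtr//.
  rewrite real_normK ?num_real// /w !patchE mem_set// -/(dv k x).
  have -> : (2^-1 ^+ k) ^+ 2 = (4 ^+ k)^-1 :> R.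
    by rewrite -exprM mulnC exprM -exprVn; congr (_ ^+ _); field.
  rewrite mulrC ler_pdivlMr ?exprn_gt0// mulrC -lee_fin GE//.
  apply: le_trans (nneseries_lim_ge k.+1 _) => [|i _ _]; last exact: s0.
  by rewrite big_nat_recr//= leeDr// sume_ge0.
(* the factor 1 - 2^-m makes the induction on m go through *)
have dwm m k x : `|w (k + m)%N x - w k x| <=
    2 * 2^-1 ^+ k * (1 - 2^-1 ^+ m) * Num.sqrt (G x).
  elim: m => [|m IH]; first by rewrite addn0 subrr normr0 expr0 subrr mulr0 mul0r.
  rewrite addnS -[X in `|X|](subrKA (w (k + m)%N x)).
  apply: le_trans (ler_normD _ _) _; apply: le_trans (lerD (dw _ _) IH) _.
  by rewrite -mulrDl ler_wpM2r ?sqrtr_ge0// exprD exprS; lra.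
have wC x : cvgn (w ^~ x).
  rewrite (funext (eq_sum_telescope (w ^~ x))); apply: is_cvgD; first exact: is_cvg_cst.
  apply: normed_cvg; apply: (@series_le_cvg _ _ (geometric (Num.sqrt (G x)) 2^-1)).
  - by move=> n /=; exact: normr_ge0.
  - by move=> n /=; rewrite mulr_ge0 ?sqrtr_ge0 ?exprn_ge0.
  - by move=> n /=; rewrite mulrC; exact: dw.
  - by apply: is_cvg_geometric_series; rewrite ger0_norm ?invf_lt1 ?ltr1n.
pose l x := limn (w ^~ x).
have wl x : w ^~ x @ \oo --> l x by exact: wC.
have ml : measurable_fun setT l.
  apply: (@measurable_fun_cvg _ _ _ _ w) => [k|x _]; last exact: wl.
  exact: Lfun2_measurable.
have wkl k x : `|w k x - l x| <= 2 * 2^-1 ^+ k * Num.sqrt (G x).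
  have h : (fun m => `|w k x - w m x|) @ \oo --> `|w k x - l x|.
    by apply: cvg_norm; apply: cvgB; [exact: cvg_cst|exact: wl].
  rewrite -(cvg_lim _ h)//; apply: limr_le; first by apply: cvgP h.
  exists k => // m /= km; rewrite -(subnKC km) distrC.
  apply: le_trans (dwm _ _ _) _; rewrite ler_wpM2r ?sqrtr_ge0//.
  by rewrite ler_piMr ?mulr_ge0 ?exprn_ge0// gerBl exprn_ge0.
have wkl2 k x : (w k x - l x) ^+ 2 <= 4 * 4^-1 ^+ k * G x.
  rewrite -real_normK ?num_real//.
  have -> : 4 * 4^-1 ^+ k * G x = (2 * 2^-1 ^+ k * Num.sqrt (G x)) ^+ 2.
    rewrite !exprMn sqr_sqrtr// -exprM mulnC exprM; congr (_ * _ * _).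
      by rewrite expr2; ring.
    by congr (_ ^+ _); field.
  by rewrite lerXn2r ?nnegrE// !mulr_ge0 ?exprn_ge0 ?sqrtr_ge0.
have iGk k : mu.-integrable setT (fun x => (4 * 4^-1 ^+ k * G x)%:E).
  rewrite (_ : (fun x => _) = fun x => ((4 * 4^-1 ^+ k)%:E * (EFin \o G) x)%E).
    exact: integrableZl.
  by apply/funext => x; rewrite EFinM.
have wlL k : (fun x => w k x - l x) \in L2.
  have mwl : measurable_fun setT (fun x => w k x - l x).
    by apply: measurable_funB => //; exact: Lfun2_measurable.
  apply/Lfun2P; split => //; apply: le_integrable (iGk k) => //.
    by apply/measurable_EFinP; exact: measurable_funX.
  move=> x _; rewrite lee_fin ger0_norm ?sqr_ge0// ger0_norm//.
  by rewrite !mulr_ge0 ?exprn_ge0.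
exists l.
  rewrite (_ : l = fun x => w 0%N x - (w 0%N x - l x)); first exact: Lfun2B.
  by apply/funext => x; rewrite subKr.
move=> k.
have -> : L2sqn (fun x => v k x - l x) = L2sqn (fun x => w k x - l x).
  have h : \forall x \ae mu, v k x - l x = w k x - l x.
    by apply: filterS aeA => x Ax; rewrite /w patchE mem_set.
  have m1 : measurable_fun setT (fun x => v k x - l x).
    by apply: measurable_funB => //; exact: Lfun2_measurable.
  have m2 := Lfun2_measurable (wlL k).
  by rewrite /L2sqn (dot_ae m1 m2 m1 h) dotC (dot_ae m1 m2 m2 h).
apply: (@le_trans _ _ (\int[mu]_x (4 * 4^-1 ^+ k * G x))).
  apply: le_Rintegral => //; [exact: dot_integrable|exact: iGk|].
  by move=> x _; rewrite -expr2.
rewrite RintegralZl//; apply: le_trans (ler_wpM2l _ intG) _.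
  by rewrite mulr_ge0 ?exprn_ge0.
by rewrite mulrAC ler_wpM2r ?exprn_ge0//; lra.
Qed.

Lemma Lfun2_complete (u : nat -> T -> R) : (forall n, u n \in L2) ->
  (forall e : R, 0 < e -> exists N, forall m n, (N <= m)%N -> (N <= n)%N ->
     L2sqn (fun x => u m x - u n x) < e) ->
  exists2 l, l \in L2 & forall e : R, 0 < e -> exists N, forall n, (N <= n)%N ->
     L2sqn (fun x => u n x - l x) < e.
Proof.
move=> uL uC.
have e8 k : (0 : R) < 8^-1 ^+ k by rewrite exprn_gt0.
have /choice[N NP] k := uC _ (e8 k).
(* both M k and M k.+1 have to exceed N k *)
pose M k := (\sum_(j < k.+1) N j)%N.
have NM k : (N k <= M k)%N by rewrite /M big_ord_recr leq_addl.
have NM1 k : (N k <= M k.+1)%N.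
  by rewrite /M big_ord_recr/= (leq_trans (NM k))// leq_addr.
have [l lL lP] : exists2 l, l \in L2 &
    forall k, L2sqn (fun x => u (M k) x - l x) <= 8 * 4^-1 ^+ k.
  apply: (@fast_Cauchy_cvg (u \o M)) => [k|k]; first exact: uL.
  by apply: ltW; exact: NP.
exists l => // e e0.
(* 18 = 2 + 2 * 8, the constants of the two halves of the triangle inequality *)
have [k ke] : exists k : nat, 18 * 4^-1 ^+ k < e.
  have : geometric (18 : R) 4^-1 @ \oo --> 0.
    by apply: cvg_geometric; rewrite ger0_norm ?invf_lt1 ?ltr1n.
  move=> /cvgr0_norm_lt/(_ e e0)[k _ /(_ k (leqnn k))]/= h; exists k.
  by rewrite (le_lt_trans (ler_norm _)).
exists (N k) => n Nn; apply: le_lt_trans ke.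
rewrite (_ : (fun x => _) = fun x => (u n x - u (M k) x) + (u (M k) x - l x)).
  apply: le_trans (dot_sqD_le (Lfun2B (uL _) (uL _)) (Lfun2B (uL _) lL)) _.
  have h1 := ltW (NP k n (M k) Nn (NM k)); have h2 := lP k.
  have h3 : (8^-1 ^+ k : R) <= 4^-1 ^+ k.
    by rewrite lerXn2r ?nnegrE// lef_pV2 ?posrE// ler_nat.
  by move: h1 h2 h3; rewrite /L2sqn; lra.
by apply/funext => x; rewrite subrKA.
Qed.

End completeness.

(** * Lebesgue measure on row vectors *)

Section row_vectors.
Context (R : realType) (n : nat).
Local Notation pt := 'rV[R]_n.
Local Notation leb := (@lebesgue_rV R n).
Implicit Types (x y h : pt) (A : set pt) (f g : pt -> R).

Lemma rV_norm_leP x (e : R) : 0 <= e -> `|x| <= e <-> forall i, `|x 0 i| <= e.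
Proof.
move=> e0; rewrite -[`|x|]/(mx_norm x) mx_normrE; split=> [h i|h].
  by apply: le_trans h; apply: (le_bigmax _ (fun ij => `|x ij.1 ij.2|) (0, i)).
by apply/bigmax_leP; split=> // -[k i] _ /=; rewrite ord1.
Qed.

Lemma rV_coord_le x i : `|x 0 i| <= `|x|.
Proof. by apply: (rV_norm_leP x (normr_ge0 x)).1. Qed.

Lemma rV_norm_ltP x (e : R) : 0 < e -> `|x| < e <-> forall i, `|x 0 i| < e.
Proof.
move=> e0; rewrite -[`|x|]/(mx_norm x) mx_normrE; split=> [h i|h].
  by apply: le_lt_trans h; apply: (le_bigmax _ (fun ij => `|x ij.1 ij.2|) (0, i)).
by apply/bigmax_ltP; split=> // -[k i] _ /=; rewrite ord1.
Qed.

Lemma open_rVP A : open A <->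
  forall x, A x -> exists2 e : R, 0 < e & forall y, `|y - x| < e -> A y.
Proof.
split=> [oA x Ax|h].
  have /nbhs_normP[e /= e0 eA] : nbhs x A by exact: open_nbhs_nbhs.
  by exists e => // y yx; apply: eA; rewrite /ball_/= distrC.
rewrite openE => x /h[e e0 eA].
apply: filterS (nbhsx_ballx (x : pt) e e0) => y.
by rewrite -ball_normE /= distrC; exact: eA.
Qed.

Lemma continuous_coord (i : 'I_n) : continuous (fun x : pt => x 0 i).
Proof. by move=> x; exact: coord_continuous. Qed.

Definition open_box (a b : pt) : set pt :=
  [set x | forall i, a 0 i < x 0 i < b 0 i].

Lemma open_boxI a b a' b' : open_box a b `&` open_box a' b' =
  open_box (\row_i Num.max (a 0 i) (a' 0 i)) (\row_i Num.min (b 0 i) (b' 0 i)).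
Proof.
apply/seteqP; split=> [x [h h'] i|x h].
  have := h i; have := h' i; rewrite !mxE gt_max lt_min.
  by move=> /andP[-> ->] /andP[-> ->].
split=> i; have := h i; rewrite !mxE gt_max lt_min.
  by move=> /andP[/andP[-> _] /andP[-> _]].
by move=> /andP[/andP[_ ->] /andP[_ ->]].
Qed.

Lemma measurable_open_box a b : measurable (open_box a b).
Proof.
rewrite (_ : open_box a b = \big[setI/setT]_(i < n)
   ((fun x : pt => x 0 i) @^-1` `]a 0 i, b 0 i[)).
  apply: bigsetI_measurable => i _; rewrite -[X in measurable X]setTI.
  exact: (measurable_coor i).
apply/seteqP; split => x /=.
  by move=> h; rewrite -bigcap_seq => i _ /=; rewrite in_itv/=; exact: h.
rewrite -bigcap_seq => h i; have := h i; rewrite /= in_itv/=; apply.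
by rewrite mem_index_enum.
Qed.

Definition box_system : set (set pt) := [set B | exists a b, B = open_box a b].

Definition closed_box (a b : pt) : set pt :=
  [set x | forall i, a 0 i <= x 0 i <= b 0 i].

(** Boxes with rational corners are enumerated, and those whose closed box leaves A
    are replaced by the empty set; the closed boxes will carry the supports of test
    functions on A. *)
Lemma open_box_cover A : open A -> exists B : nat -> set pt,
  (forall k, B k = set0 \/
     exists a b, B k = open_box a b /\ closed_box a b `<=` A) /\
  A = \bigcup_k B k.
Proof.
move=> /open_rVP oA.
pose lo (p : 'rV[rat]_n * 'rV[rat]_n) : pt := map_mx ratr p.1.
pose hi (p : 'rV[rat]_n * 'rV[rat]_n) : pt := map_mx ratr p.2.
pose B k := if @unpickle ('rV[rat]_n * 'rV[rat]_n)%type k is Some p then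
   (if `[< closed_box (lo p) (hi p) `<=` A >] then open_box (lo p) (hi p) else set0)
   else set0.
exists B; split.
  move=> k; rewrite /B; case: unpickle => [p|]; last by left.
  by case: asboolP => [h|_]; [right; exists (lo p), (hi p)|left].
apply/seteqP; split=> [x Ax|x [k _]]; last first.
  rewrite /B; case: unpickle => [p|//]; case: asboolP => [h|//] xB; apply: h => i.
  by have /andP[/ltW -> /ltW ->] := xB i.
have [e e0 eA] := oA x Ax.
have /choice[q qP] (i : 'I_n) : exists q : rat, ratr q \in `]x 0 i - e, x 0 i[.
  by apply: rat_in_itvoo; rewrite ltrBlDr ltrDl.
have /choice[r rP] (i : 'I_n) : exists r : rat, ratr r \in `]x 0 i, x 0 i + e[.
  by apply: rat_in_itvoo; rewrite ltrDl.
pose p : ('rV[rat]_n * 'rV[rat]_n)%type := (\row_i q i, \row_i r i).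
exists (pickle p) => //; rewrite /B pickleK; case: asboolP => [h|[]].
  move=> i; rewrite /lo /hi !mxE.
  by have := qP i; have := rP i; rewrite !in_itv/= => /andP[-> _] /andP[_ ->].
move=> y yB; apply: eA; apply/rV_norm_ltP => // i.
have := yB i; rewrite /lo /hi !mxE.
have := qP i; have := rP i; rewrite !in_itv/= ltr_norml => /andP[_ h1] /andP[h2 _] /andP[h3 h4].
by apply/andP; split; lra.
Qed.

Lemma measurable_open A : open A -> measurable A.
Proof.
move=> /open_box_cover[B [Bbox ->]]; apply: bigcup_measurable => k _.
by have [->//|[a [b [-> _]]]] := Bbox k; exact: measurable_open_box.
Qed.

Lemma measurable_closed A : closed A -> measurable A.
Proof.
move=> cA; rewrite -[A]setCK; apply: measurableC; apply: measurable_open.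
by rewrite openC.
Qed.

Lemma continuous_measurable_rV f : continuous f -> measurable_fun setT f.
Proof.
move=> cf; apply: (measurability _ (RGenOpens.measurableE R)) => _ [_ [a [b ->]] <-].
rewrite setTI; apply: measurable_open.
by apply: open_comp; [move=> x _; exact: cf|exact: itv_open].
Qed.

Lemma measurable_boxE : @measurable _ pt = <<s box_system >>.
Proof.
apply/seteqP; split; last first.
  apply: smallest_sub; first exact: sigma_algebra_measurable.
  by move=> _ [a [b ->]]; exact: measurable_open_box.
have oS A : open A -> <<s box_system >> A.
  move=> /open_box_cover[B [Bbox ->]]; apply: sigma_algebra_bigcup => k.
  by have [->|[a [b [-> _]]]] := Bbox k; [exact: sigma_algebra0|];
    apply: sub_sigma_algebra; exists a, b.
apply: smallest_sub; first exact: smallest_sigma_algebra.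
move=> A; rewrite -bigcup_seq => -[i /= _ [Y mY <-]]; rewrite setTI.
move: Y mY; rewrite (RGenOpens.measurableE R); apply: smallest_sub.
  split=> [|Y /= mY|F /= mF].
  - by rewrite /= preimage_set0; exact: sigma_algebra0.
  - by rewrite setTD preimage_setC; exact: sigma_algebraC.
  - by rewrite /= preimage_bigcup; exact: sigma_algebra_bigcup.
move=> _ [a [b ->]]; apply: oS; apply: open_comp; last exact: itv_open.
by move=> x _; exact: continuous_coord.
Qed.

Lemma lebesgue_open_box a b :
  leb (open_box a b) = (\big[mule/1]_(i < n) lebesgue_measure (`]a 0%R i, b 0%R i[%classic : set R))%E.
Proof.
rewrite -lebesgue_rV_box; last by move=> i; exact: measurable_itv.
by congr (leb _); apply/seteqP; split=> x /= h i; have := h i; rewrite in_itv.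
Qed.

Lemma lebesgue_open_box_fin a b : (leb (open_box a b) < +oo)%E.
Proof.
suff /andP[] : (0 <= leb (open_box a b) < +oo)%E by [].
rewrite lebesgue_open_box; elim/big_ind : _ => [|x y /andP[x0 xoo] /andP[y0 yoo]|i _].
- by rewrite lee01 ltry.
- by rewrite mule_ge0//= lte_mul_pinfty// ge0_fin_numE.
- rewrite measure_ge0/= lebesgue_measure_itv/=; case: ifP => // _.
  by rewrite -EFinB ltry.
Qed.

(** The boxes generate the sigma-algebra, are stable under intersection and exhaust
    the space. *)
Lemma measure_box_unique (m1 m2 : {measure set pt -> \bar R}) :
  (forall a b, m1 (open_box a b) = m2 (open_box a b)) ->
  (forall a b, (m1 (open_box a b) < +oo)%E) ->
  forall A, measurable A -> m1 A = m2 A.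
Proof.
move=> m12 mfin; pose g (k : nat) := open_box (const_mx (- k%:R)) (const_mx k%:R).
apply: (@measure_unique _ _ _ box_system g measurable_boxE).
- by move=> _ _ [a [b ->]] [a' [b' ->]]; rewrite open_boxI; eexists _, _.
- by move=> k; eexists _, _.
- apply/seteqP; split=> // x _; exists (Num.truncn `|x|).+1 => // i.
  rewrite !mxE -ltr_norml; apply: le_lt_trans (rV_coord_le x i) _.
  exact: truncnS_gt.
- by move=> _ [a [b ->]].
- by move=> k; exact: mfin.
Qed.

Lemma measurable_shift h : measurable_fun setT (fun x : pt => x + h).
Proof.
apply: measurable_fun_rV => i.
rewrite (_ : (fun x => _) = (fun x : pt => x 0 i + h 0 i)).
  by apply: measurable_funD => //; exact: measurable_coor.
by apply/funext => x; rewrite mxE.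
Qed.

Lemma lebesgue_rV_shift h A : measurable A -> leb ((fun x => x + h) @^-1` A) = leb A.
Proof.
move=> mA; apply/esym.
apply: (@measure_box_unique leb
  (measure_function_pushforward__canonical__measure_function_Measure leb (measurable_shift h))) mA.
  move=> a b /=; rewrite /pushforward.
  rewrite (_ : _ @^-1` _ = open_box (a - h) (b - h)); last first.
    by apply/seteqP; split=> x /= xB i; have := xB i; rewrite !mxE ltrBlDr ltrBrDr.
  rewrite !lebesgue_open_box; apply: eq_bigr => i _.
  rewrite !lebesgue_measure_itv/= !mxE !lte_fin ltrD2r; case: ifP => // _.
  by rewrite -!EFinB; congr EFin; ring.
exact: lebesgue_open_box_fin.
Qed.

Lemma bounded_setP A : bounded_set A -> exists2 M : R, 0 < M & forall x, A x -> `|x| < M.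
Proof.
move=> [M [Mr MA]]; exists (`|M| + 2); first by rewrite ltr_wpDl.
move=> x Ax; have M1 : M < `|M| + 1 by rewrite (le_lt_trans (ler_norm M))// ltrDl.
by apply: le_lt_trans (MA _ M1 x Ax) _; rewrite ltrD2l ltr1n.
Qed.

Lemma bounded_lebesgue_fin A : bounded_set A -> measurable A -> (leb A < +oo)%E.
Proof.
move=> /bounded_setP[M M0 AM] mA.
apply: le_lt_trans (lebesgue_open_box_fin (const_mx (- M)) (const_mx M)).
apply: le_measure; rewrite ?inE//; first exact: measurable_open_box.
by move=> x /AM xM i; rewrite !mxE -ltr_norml; apply: le_lt_trans xM; exact: rV_coord_le.
Qed.

Lemma bounded_closure A : bounded_set A -> bounded_set (closure A).
Proof.
move=> /bounded_setP[M M0 AM].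
have cM : closed [set x : pt | `|x| <= M].
  by apply: (closed_comp _ (@closed_le R M)) => x _; exact: norm_continuous.
have sM : closure A `<=` [set x : pt | `|x| <= M].
  by rewrite [X in _ `<=` X](closure_id _).1//; apply: closure_subset => x /AM/ltW.
exists M; split; first exact: num_real.
by move=> N MN x /sM /= xM; rewrite (le_trans xM)// ltW.
Qed.

Lemma compact_closure_bounded A : bounded_set A -> compact (closure A).
Proof.
move=> bA; apply: bounded_closed_compact; first exact: bounded_closure.
exact: closed_closure.
Qed.

Lemma integral_shift (F : pt -> \bar R) h : measurable_fun setT F ->
  (\int[leb]_x F (x + h)%R = \int[leb]_x F x)%E.
Proof.
move=> mF.
have ge0 (G : pt -> \bar R) : measurable_fun setT G -> (forall x, 0 <= G x)%E ->
    (\int[leb]_x G (x + h)%R = \int[leb]_x G x)%E.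
  move=> mG G0.
  pose m2 := measure_function_pushforward__canonical__measure_function_Measure
    leb (measurable_shift h).
  have -> : (\int[leb]_x G (x + h)%R = \int[m2]_x G x)%E.
    by rewrite (ge0_integral_pushforward (measurable_shift h)).
  apply: eq_measure_integral => A mA _.
  exact: (lebesgue_rV_shift h mA).
rewrite integralE [RHS]integralE; congr (_ - _)%E.
  transitivity (\int[leb]_x (F^\+ (x + h)%R))%E; first by apply: eq_integral => x _; rewrite ?funeposE ?funenegE.
  by apply: (ge0 (F^\+)%E) => //; exact: measurable_funepos.
transitivity (\int[leb]_x (F^\- (x + h)%R))%E; first by apply: eq_integral => x _; rewrite ?funeposE ?funenegE.
by apply: (ge0 (F^\-)%E) => //; exact: measurable_funeneg.
Qed.

Lemma Rintegral_shift f h : measurable_fun setT f ->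
  \int[leb]_x f (x + h) = \int[leb]_x f x.
Proof.
move=> mf; congr fine.
by rewrite -(@integral_shift (EFin \o f) h)//; exact/measurable_EFinP.
Qed.

Lemma integrable_shift f h : leb.-integrable setT (EFin \o f) ->
  leb.-integrable setT (EFin \o (fun x => f (x + h))).
Proof.
move=> /integrableP[mf fi]; apply/integrableP; split.
  by apply: (measurableT_comp mf); exact: measurable_shift.
by rewrite (@integral_shift (fun x => `|(f x)%:E|)%E)//; exact: measurableT_comp.
Qed.

Lemma Lfun2_shift f h : f \in Lfun leb 2%:E -> (fun x => f (x + h)) \in Lfun leb 2%:E.
Proof.
move=> /Lfun2P[mf fi]; apply/Lfun2P; split.
  by apply: (measurableT_comp mf); exact: measurable_shift.
exact: (@integrable_shift (fun x => f x ^+ 2)).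
Qed.

Lemma dot_shift f g h : f \in Lfun leb 2%:E -> g \in Lfun leb 2%:E ->
  L2dot leb (fun x => f (x + h)) (fun x => g (x + h)) = L2dot leb f g.
Proof.
move=> fL gL; apply: (@Rintegral_shift (fun x => f x * g x)).
by apply: measurable_funM; [exact: Lfun2_measurable fL|exact: Lfun2_measurable gL].
Qed.

End row_vectors.

(** * Calculus of smooth functions *)

Section smooth_functions.
Context (R : realType) (d : nat).
Local Notation pt := 'rV[R]_d.
Implicit Types (f g : pt -> R) (x y v h : pt) (i : 'I_d).

Lemma partialD f g i : (forall x, differentiable f x) -> (forall x, differentiable g x) ->
  partial i (fun x => f x + g x) = fun x => partial i f x + partial i g x.
Proof.
by move=> df dg; apply/funext => x; rewrite /partial (deriveD (diff_derivable (df x)) (diff_derivable (dg x))).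
Qed.

Lemma partialM f g i : (forall x, differentiable f x) -> (forall x, differentiable g x) ->
  partial i (fun x => f x * g x) = fun x => partial i f x * g x + f x * partial i g x.
Proof.
move=> df dg; apply/funext => x.
rewrite /partial (deriveM (diff_derivable (df x)) (diff_derivable (dg x))).
by rewrite addrC; congr (_ + _); exact: mulrC.
Qed.

Lemma partialV f i : (forall x, differentiable f x) -> (forall x, f x != 0) ->
  partial i (fun x => (f x)^-1) = fun x => - (partial i f x * ((f x)^-1 * (f x)^-1)).
Proof.
move=> df f0; apply/funext => x.
rewrite /partial (deriveV (f0 x) (diff_derivable (df x))).
by rewrite /GRing.scale/= expr2 invfM mulNr mulrC.
Qed.

Lemma partial_cst (c : R) i : partial i (fun _ : pt => c) = fun=> 0.
Proof. by apply/funext => x; exact: derive_cst. Qed.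

Lemma partialZ (c : R) f i : (forall x, differentiable f x) ->
  partial i (fun x => c * f x) = fun x => c * partial i f x.
Proof.
move=> df; rewrite partialM//.
by apply/funext => x; rewrite partial_cst mul0r add0r.
Qed.

Lemma partialN f i : (forall x, differentiable f x) ->
  partial i (fun x => - f x) = fun x => - partial i f x.
Proof.
move=> df; rewrite (_ : (fun x => - f x) = fun x => -1 * f x); last first.
  by apply/funext => x; rewrite mulN1r.
by rewrite partialZ//; apply/funext => x; rewrite mulN1r.
Qed.

Lemma partial_coord i j : partial i (fun x : pt => x 0 j) = fun=> (i == j)%:R.
Proof.
apply/funext => x; rewrite /partial /derive; apply/cvg_lim => //.
apply: (@cvg_trans _ ((fun=> (i == j)%:R : R) @ (0 : R)^')); last exact: cvg_cst.
apply: near_eq_cvg; near=> t; rewrite /= !mxE eqxx/= addrK eq_sym.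
have t0 : t != 0 by near: t; exact: nbhs_dnbhs_neq.
by rewrite /GRing.scale/= mulrA mulVf// mul1r.
Unshelve. all: by end_near. Qed.

Lemma partial_shift f h i : partial i (fun x => f (x + h)) = fun x => partial i f (x + h).
Proof.
apply/funext => x; rewrite /partial /derive.
pose q1 (t : R) := t^-1 *: (((fun y => f (y + h)) \o shift x) (t *: 'e_i) - f (x + h)).
pose q2 (t : R) := t^-1 *: ((f \o shift (x + h)) (t *: 'e_i) - f (x + h)).
rewrite -/q1 -/q2; suff -> : q1 = q2 by [].
by apply/funext => t; rewrite /q1 /q2 /= addrA.
Qed.

Lemma differentiable_shift f h x : differentiable f (x + h) ->
  differentiable (fun y => f (y + h)) x.
Proof.
move=> df; apply: (@differentiable_comp _ _ _ _ (fun y => y + h) f) => //.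
Qed.

(** Differentiability of all partial derivatives up to order k, by recursion on the
    derivative that is taken first, as suits the product and chain rules. *)
Fixpoint diff_class (k : nat) (f : pt -> R) : Prop :=
  (forall x, differentiable f x) /\
  (if k is k'.+1 then forall i, diff_class k' (partial i f) else True).

Lemma smooth_partial f i : smooth f -> smooth (partial i f).
Proof. by move=> sf s x; rewrite -foldr_rcons; exact: sf. Qed.

Lemma smooth_differentiable f x : smooth f -> differentiable f x.
Proof. by move=> sf; exact: (sf [::] x). Qed.

Lemma smoothP f : smooth f <-> forall k, diff_class k f.
Proof.
split=> [sf k|df s x].
  elim: k f sf => [|k IH] f sf; split=> //; try by move=> x; exact: smooth_differentiable.
  by move=> i; apply: IH; exact: smooth_partial.
move: (df (size s)); elim/last_ind: s f {df} => [|s i IH] f.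
  by case.
by rewrite size_rcons foldr_rcons => -[_ /(_ i)]; exact: IH.
Qed.

Lemma diff_classW k f : diff_class k.+1 f -> diff_class k f.
Proof.
elim: k f => [|k IH] f [df h]; split=> // i; exact/IH/h.
Qed.

Lemma diff_class_diff k f x : diff_class k f -> differentiable f x.
Proof. by case: k => [|k] []. Qed.

Lemma diff_class_cst k (c : R) : diff_class k (fun=> c).
Proof.
elim: k c => [|k IH] c; split=> //; try by move=> x; exact: differentiable_cst.
by move=> i; rewrite partial_cst.
Qed.

Lemma diff_classD k f g : diff_class k f -> diff_class k g ->
  diff_class k (fun x => f x + g x).
Proof.
elim: k f g => [|k IH] f g cf cg; split=> //; try by move=> x; apply: differentiableD; apply: diff_class_diff; [exact: cf|exact: cg].
case: cf cg => df cf [dg cg] i; rewrite partialD//.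
by apply: IH; [exact: cf|exact: cg].
Qed.

Lemma diff_classM k f g : diff_class k f -> diff_class k g ->
  diff_class k (fun x => f x * g x).
Proof.
elim: k f g => [|k IH] f g cf cg; split=> //; try by move=> x; apply: differentiableM; apply: diff_class_diff; [exact: cf|exact: cg].
have wf := diff_classW cf; have wg := diff_classW cg.
case: cf cg => df cf [dg cg] i; rewrite partialM//.
by apply: diff_classD; apply: IH => //; [exact: cf|exact: cg].
Qed.

Lemma diff_classV k f : (forall x, f x != 0) -> diff_class k f ->
  diff_class k (fun x => (f x)^-1).
Proof.
move=> f0; elim: k f f0 => [|k IH] f f0 cf; split=> //; try by move=> x; apply: differentiableV; [exact: diff_class_diff cf|].
have wf := IH _ f0 (diff_classW cf).
case: cf => df cf i; rewrite partialV//.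
rewrite (_ : (fun x => _) = fun x => -1 * (partial i f x * ((f x)^-1 * (f x)^-1))).
  apply: diff_classM; first exact: diff_class_cst.
  by apply: diff_classM; [exact: cf|exact: diff_classM].
by apply/funext => x; rewrite mulN1r.
Qed.

Lemma smooth_cst (c : R) : smooth (fun _ : pt => c).
Proof. by apply/smoothP => k; exact: diff_class_cst. Qed.

Lemma smooth_coord i : smooth (fun x : pt => x 0 i).
Proof.
apply/smoothP => -[|k]; split=> //; try by move=> x; exact: differentiable_coord.
by move=> j; rewrite partial_coord; exact: diff_class_cst.
Qed.

Lemma smoothD f g : smooth f -> smooth g -> smooth (fun x => f x + g x).
Proof. by move=> /smoothP sf /smoothP sg; apply/smoothP => k; exact: diff_classD. Qed.

Lemma smoothM f g : smooth f -> smooth g -> smooth (fun x => f x * g x).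
Proof. by move=> /smoothP sf /smoothP sg; apply/smoothP => k; exact: diff_classM. Qed.

Lemma smoothV f : (forall x, f x != 0) -> smooth f -> smooth (fun x => (f x)^-1).
Proof. by move=> f0 /smoothP sf; apply/smoothP => k; exact: diff_classV. Qed.

Lemma smoothZ (c : R) f : smooth f -> smooth (fun x => c * f x).
Proof. by move=> sf; apply: smoothM => //; exact: smooth_cst. Qed.

Lemma smoothN f : smooth f -> smooth (fun x => - f x).
Proof.
move=> sf; rewrite (_ : (fun x => - f x) = fun x => -1 * f x); first exact: smoothZ.
by apply/funext => x; rewrite mulN1r.
Qed.

Lemma smoothB f g : smooth f -> smooth g -> smooth (fun x => f x - g x).
Proof. by move=> sf sg; apply: smoothD => //; exact: smoothN. Qed.

Lemma smooth_sum (J : Type) (r : seq J) (P : pred J) (F : J -> pt -> R) :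
  (forall j, P j -> smooth (F j)) -> smooth (fun x => \sum_(j <- r | P j) F j x).
Proof.
move=> sF; elim: r => [|j r IH].
  by under eq_fun do rewrite big_nil; exact: smooth_cst.
rewrite (_ : (fun x => _) = fun x => (if P j then F j x else 0) +
    \sum_(i <- r | P i) F i x); last first.
  by apply/funext => x; rewrite big_cons; case: ifP => //; rewrite add0r.
by apply: smoothD => //; case Pj : (P j); [exact: sF|exact: smooth_cst].
Qed.

Lemma smooth_prod (J : Type) (r : seq J) (F : J -> pt -> R) :
  (forall j, smooth (F j)) -> smooth (fun x => \prod_(j <- r) F j x).
Proof.
move=> sF; elim: r => [|j r IH].
  by under eq_fun do rewrite big_nil; exact: smooth_cst.
by under eq_fun do rewrite big_cons; exact: smoothM.
Qed.

Lemma foldr_partial_shift f h s :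
  foldr partial (fun x => f (x + h)) s = fun x => foldr partial f s (x + h).
Proof. by elim: s => //= i s ->; rewrite partial_shift. Qed.

Lemma smooth_shift f h : smooth f -> smooth (fun x => f (x + h)).
Proof.
by move=> sf s x; rewrite foldr_partial_shift; apply: differentiable_shift; exact: sf.
Qed.

Lemma smooth_continuous f : smooth f -> continuous f.
Proof.
by move=> sf x; apply: differentiable_continuous; exact: smooth_differentiable.
Qed.

Lemma smooth_measurable f : smooth f -> measurable_fun setT f.
Proof. by move=> /smooth_continuous; exact: continuous_measurable_rV. Qed.

Lemma partial_local f g i (U : set pt) : open U -> (forall x, U x -> f x = g x) ->
  forall x, U x -> partial i f x = partial i g x.
Proof.
move=> oU fg x Ux; apply: near_eq_derive.
by apply: filterS (open_nbhs_nbhs (conj oU Ux)) => y /fg.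
Qed.

Lemma partial_off f i (K : set pt) : closed K -> (forall x, ~ K x -> f x = 0) ->
  forall x, ~ K x -> partial i f x = 0.
Proof.
move=> cK f0 x Kx.
rewrite (@partial_local f (fun=> 0) i (~` K))//; first by rewrite partial_cst.
by rewrite openC.
Qed.

Lemma derive_sum_partial f x v : differentiable f x ->
  'D_v f x = \sum_i v 0 i * partial i f x.
Proof.
move=> df; rewrite deriveE// {1}(row_sum_delta v) linear_sum.
by apply: eq_bigr => i _; rewrite linearZ /partial deriveE.
Qed.

Lemma is_derive_line f x v (s : R) : differentiable f (x + s *: v) ->
  is_derive s 1 (fun t : R => f (x + t *: v)) ('D_v f (x + s *: v)).
Proof.
move=> df; have := diff_derivable (v := v) df; rewrite /derivable /derive.
pose q1 (h : R) := h^-1 *: ((f \o shift (x + s *: v)) (h *: v) - f (x + s *: v)).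
pose q2 (h : R) := h^-1 *: (((fun t : R => f (x + t *: v)) \o shift s) (h *: 1) - f (x + s *: v)).
have q12 : q1 = q2.
  apply/funext => h; rewrite /q1 /q2 /= scalerDl addrCA.
  by rewrite [h *: 1]mulr1.
rewrite -/q1 q12 => cq.
by apply: DeriveDef; rewrite /derivable /derive -/q2//= -/q1 q12.
Qed.

Lemma line_MVT f x v : (forall y, differentiable f y) ->
  exists2 s : R, 0 <= s <= 1 & f (x + v) - f x = 'D_v f (x + s *: v).
Proof.
move=> df; have dl (s : R) := is_derive_line (df (x + s *: v)).
have cl : {within `[0, 1], continuous (fun t : R => f (x + t *: v))}.
  by apply: derivable_within_continuous => s _; have [] := dl s.
have [s s01 E] := MVT_segment ler01 (fun s (_ : s \in `]0, 1[%R) => dl s) cl.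
exists s; first by move: s01; rewrite in_itv.
by move: E; rewrite scale1r scale0r addr0 subr0 mulr1.
Qed.

End smooth_functions.

(** * Bump functions *)

Section flat_functions.
Context (R : realType).

(** The functions t^-n exp(-1/t), extended by zero to the left half-line; they
    form a family that is stable under differentiation up to linear
    combinations. *)
Definition flat (n : nat) (t : R) : R :=
  if 0 < t then t^-1 ^+ n * expR (- t^-1) else 0.

Lemma flat_ge0 n t : 0 <= flat n t.
Proof.
rewrite /flat; case: ifPn => // t0.
by rewrite mulr_ge0 ?expR_ge0// exprn_ge0// invr_ge0 ltW.
Qed.

Lemma flat_gt0 t : 0 < t -> 0 < flat 0 t.
Proof. by move=> t0; rewrite /flat t0 expr0 mul1r expR_gt0. Qed.

Lemma flat_le0 n t : t <= 0 -> flat n t = 0.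
Proof. by move=> t0; rewrite /flat ltNge t0. Qed.

(** The exponential of 1/t dominates the term of order n + 2 of its series. *)
Lemma flat_le_sq n t : flat n t <= n.+2`!%:R * t ^+ 2.
Proof.
rewrite /flat; case: ifPn => [t0|_]; last by rewrite mulr_ge0 ?sqr_ge0.
have s0 : 0 < t^-1 by rewrite invr_gt0.
have := @expR_ge1Dxn _ t^-1 n.+1 (ltW s0).
move=> /(le_trans _)-/(_ (t^-1 ^+ n.+2 / n.+2`!%:R)) h.
have {}h : t^-1 ^+ n.+2 / n.+2`!%:R <= expR t^-1 by apply: h; rewrite lerDr.
rewrite expRN ler_pdivrMr ?expR_gt0//.
apply: le_trans (ler_wpM2l _ h); last by rewrite mulr_ge0 ?sqr_ge0.
have f0 : n.+2`!%:R != 0 :> R by rewrite pnatr_eq0 -lt0n fact_gt0.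
rewrite [leRHS](_ : _ = t^-1 ^+ n)// !exprS expr0; move: (t^-1 ^+ n) => w.
by field; rewrite f0 gt_eqF.
Qed.

Lemma is_derive_flat (n : nat) (t : R) :
  is_derive t (1 : R) (flat n : R -> R) (flat n.+2 t - n%:R * flat n.+1 t).
Proof.
have [t0|t0|->] := ltgtP t 0.
- rewrite !flat_le0 ?(ltW t0)// mulr0 subr0.
  have hc : is_derive t (1 : R) (fun _ : R => 0 : R) 0 by exact: is_derive_cst.
  apply: near_eq_is_derive hc.
  near=> s; rewrite flat_le0//; apply: ltW; near: s; exact: lt_nbhsl.
- have tn : t != 0 by rewrite gt_eqF.
  have dV : is_derive t (1 : R) (GRing.inv : R -> R) (- t ^- 2).
    apply: DeriveDef; first by apply: (@derivableV _ _ id t 1).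
    have := @deriveV _ _ (id : R -> R) t (1 : R) tn (@derivable_id _ _ t 1).
    by rewrite derive_id [_ *: 1]mulr1.
  have dX := is_deriveX n dV.
  have dN := is_deriveN dV.
  have dE : is_derive t (1 : R) (fun s : R => expR (- s^-1)) (expR (- t^-1) * (- (- t ^- 2))).
    exact: (@is_derive1_comp _ expR (fun s => - s^-1)).
  have hf : is_derive t (1 : R) (flat n) (t^-1 ^+ n *: (expR (- t^-1) * - - t ^- 2) +
      expR (- t^-1) *: ((n%:R * t^-1 ^+ n.-1) *: - t ^- 2)).
    have := is_deriveM dX dE; rewrite exprfctE => hd.
    apply: near_eq_is_derive hd; near=> s.
    by rewrite /flat ifT//; near: s; exact: lt_nbhsr.
  have [dF vF] := hf; apply: DeriveDef => //; rewrite vF.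
  rewrite /flat t0 /GRing.scale/= opprK; case: (n) => [|m] /=.
    by rewrite !mul0r !mulr0 addr0 subr0 expr0 mul1r exprVn mulrC.
  by rewrite !exprS; field.
- rewrite !flat_le0// mulr0 subr0.
  (* at the origin the difference quotients are of order h by flat_le_sq *)
  have h : (fun h : R => h^-1 *: ((flat n \o shift 0) (h *: 1) - flat n 0)) @ 0^' --> (0 : R).
    apply/cvgr0Pnorm_le => e e0.
    have f0 : (0 : R) < n.+2`!%:R by rewrite ltr0n fact_gt0.
    have ef : 0 < e / n.+2`!%:R by rewrite divr_gt0.
    near=> h; have h0 : h != 0 by near: h; exact: nbhs_dnbhs_neq.
    have he : `|h| <= e / n.+2`!%:R by near: h; exact: dnbhs0_le.
    rewrite /= addr0 [h *: 1]mulr1 (flat_le0 n (lexx 0)) subr0 normrZ (ger0_norm (flat_ge0 _ _)).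
    rewrite normfV ler_pdivrMl ?normr_gt0//; apply: le_trans (flat_le_sq n h) _.
    rewrite -real_normK ?num_real// expr2 mulrA mulrC ler_wpM2l//.
    by rewrite mulrC -ler_pdivlMr.
  by apply: DeriveDef; [apply: cvgP h|apply: cvg_lim h].
Unshelve. all: by end_near. Qed.

End flat_functions.

Section bumps.
Context (R : realType) (d : nat).
Local Notation pt := 'rV[R]_d.
Implicit Types (f g : pt -> R) (x y v h a b : pt) (i : 'I_d).

Lemma diff_class_flat k n f : diff_class k f -> diff_class k (fun x => flat n (f x)).
Proof.
elim: k n f => [|k IH] n f cf.
  split=> // x; apply: (@differentiable_comp _ _ _ _ f (flat n)).
    exact: diff_class_diff cf.
  by apply/derivable1_diffP; have [] := is_derive_flat n (f x).
have wf := diff_classW cf; case: cf => df cf; split.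
  move=> x; apply: (@differentiable_comp _ _ _ _ f (flat n)) => //.
  by apply/derivable1_diffP; have [] := is_derive_flat n (f x).
move=> i.
rewrite (_ : partial i _ = fun x => (flat n.+2 (f x) + (- n%:R) * flat n.+1 (f x)) * partial i f x).
  apply: diff_classM; last exact: cf.
  apply: diff_classD; first exact: IH.
  by apply: diff_classM; [exact: diff_class_cst|exact: IH].
apply/funext => x; have [dF vF] := is_derive_flat n (f x).
have dF' := (derivable1_diffP _ _).1 dF.
rewrite /partial deriveE; last exact: (@differentiable_comp _ _ _ _ f (flat n)).
rewrite (@diff_comp _ _ _ _ f (flat n))//= diff1E//= -deriveE// derive1E vF.
by rewrite mulNr; exact: mulrC.
Qed.

Lemma smooth_flat n f : smooth f -> smooth (fun x => flat n (f x)).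
Proof. by move=> /smoothP sf; apply/smoothP => k; exact: diff_class_flat. Qed.

Definition box_bump a b x : R :=
  \prod_(i < d) (flat 0 (x 0 i - a 0 i) * flat 0 (b 0 i - x 0 i)).

Lemma box_bump_ge0 a b x : 0 <= box_bump a b x.
Proof. by apply: prodr_ge0 => i _; rewrite mulr_ge0 ?flat_ge0. Qed.

Lemma box_bump_gt0 a b x : open_box a b x -> 0 < box_bump a b x.
Proof.
move=> xab; apply: prodr_gt0 => i _; have /andP[ax xb] := xab i.
by rewrite mulr_gt0// flat_gt0// subr_gt0.
Qed.

Lemma box_bump_off a b x : ~ open_box a b x -> box_bump a b x = 0.
Proof.
move=> /existsNP[i /negP]; rewrite negb_and -!leNgt /box_bump (bigD1 i)//=.
case/orP => h; [rewrite (@flat_le0 _ _ (x 0 i - a 0 i))|rewrite (@flat_le0 _ _ (b 0 i - x 0 i))];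
  by rewrite ?subr_le0// ?mulr0 ?mul0r.
Qed.

Lemma smooth_box_bump a b : smooth (box_bump a b).
Proof.
apply: smooth_prod => i; apply: smoothM; apply: smooth_flat; apply: smoothB;
  by [exact: smooth_coord|exact: smooth_cst].
Qed.

(** With u = r^2 - q and v = q - r^2/4, where q is the squared Euclidean distance to
    a, the quotient of flat(u) by flat(u) + flat(v) does the job: u and v are never
    both nonpositive. *)
Lemma smooth_plateau a (r : R) : 0 < r -> exists (chi : pt -> R) (s : R),
  [/\ 0 < s, smooth chi, (forall x, `|x - a| <= s -> chi x = 1) &
      forall x, r < `|x - a| -> chi x = 0].
Proof.
move=> r0; pose q x : R := \sum_i (x 0 i - a 0 i) ^+ 2.
pose u x := r ^+ 2 - q x; pose v x := q x - r ^+ 2 / 4.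
have sq : smooth q.
  apply: smooth_sum => i _; under eq_fun do rewrite expr2.
  by apply: smoothM; apply: smoothB; by [exact: smooth_coord|exact: smooth_cst].
have su : smooth u by apply: smoothB => //; exact: smooth_cst.
have sv : smooth v by apply: smoothB => //; exact: smooth_cst.
have r2 : 0 < r ^+ 2 by rewrite exprn_gt0.
have uv x : 0 < flat 0 (u x) + flat 0 (v x).
  have [u0|u0] := ltP 0 (u x); first by rewrite ltr_wpDr ?flat_ge0 ?flat_gt0.
  by rewrite ltr_wpDl ?flat_ge0 ?flat_gt0//; move: u0; rewrite /u /v; lra.
(* since the norm is the maximum norm, q <= d s^2 <= r^2/4 on the ball of
   radius s *)
exists (fun x => flat 0 (u x) * (flat 0 (u x) + flat 0 (v x))^-1), (r / (2 * (d%:R + 1))).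
have d1 : (0 : R) < d%:R + 1 by rewrite ltr_wpDl.
split.
- by rewrite divr_gt0// mulr_gt0.
- apply: smoothM; first exact: smooth_flat.
  apply: smoothV; first by move=> x; rewrite gt_eqF.
  by apply: smoothD; exact: smooth_flat.
- move=> x xs.
  have : q x <= r ^+ 2 / 4.
    have h i : (x 0 i - a 0 i) ^+ 2 <= (r / (2 * (d%:R + 1))) ^+ 2.
      rewrite -real_normK ?num_real// lerXn2r ?nnegrE//.
        by rewrite ltW// divr_gt0// mulr_gt0.
      by apply: le_trans xs; have := rV_coord_le (x - a) i; rewrite !mxE.
    apply: le_trans (ler_sum _ (fun i _ => h i)) _.
    rewrite sumr_const card_ord -mulr_natl.
    have dD : (d%:R : R) <= (d%:R + 1) ^+ 2 by have : (0 : R) <= d%:R by []; nra.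
    rewrite (_ : (r / _) ^+ 2 = r ^+ 2 / 4 / (d%:R + 1) ^+ 2); last first.
      by field; rewrite gt_eqF.
    rewrite -[_ *+ d]mulr_natl.
    by rewrite mulrA ler_pdivrMr ?exprn_gt0// mulrC ler_wpM2l// divr_ge0 ?ltW.
  move=> qx; have v0 : v x <= 0 by rewrite /v; lra.
  by rewrite (flat_le0 _ v0) addr0 mulfV// gt_eqF// flat_gt0// /u; lra.
- move=> x xr; rewrite flat_le0 ?mul0r// /u subr_le0.
  have /existsNP[i /negP] : ~ forall i, `|(x - a) 0 i| <= r.
    by move=> /(rV_norm_leP _ (ltW r0)); rewrite leNgt xr.
  rewrite -ltNge !mxE => ri; rewrite /q (bigD1 i)//=.
  apply: (@le_trans _ _ ((x 0 i - a 0 i) ^+ 2)).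
    by rewrite -[leRHS]real_normK ?num_real// lerXn2r ?nnegrE// ltW.
  by rewrite lerDl sumr_ge0// => j _; exact: sqr_ge0.
Qed.

End bumps.

(** * Integration by parts *)

Section integration.
Context (R : realType) (d : nat).
Local Notation pt := 'rV[R]_d.
Local Notation leb := (@lebesgue_rV R d).
Local Notation L2 := (Lfun leb 2%:E).
Implicit Types (f g : pt -> R) (x y v h a b : pt) (i : 'I_d) (A K : set pt).

Lemma compact_bounded_fun f K : continuous f -> compact K ->
  exists2 C : R, 0 < C & forall x, K x -> `|f x| <= C.
Proof.
move=> cf cK.
have /compact_bounded[M [_ MK]] := continuous_compact (continuous_subspaceT cf) cK.
exists (`|M| + 1) => [|x Kx]; first by rewrite ltr_wpDl.
by apply: MK; [rewrite (le_lt_trans (ler_norm M))// ltrDl|exists x].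
Qed.

Definition cball (M : R) : set pt := [set x | `|x| <= M].

Lemma closed_cball M : closed (cball M).
Proof. by apply: (closed_comp _ (@closed_le R M)) => x _; exact: norm_continuous. Qed.

Lemma bounded_cball M : bounded_set (cball M).
Proof.
by exists M; split; [exact: num_real|move=> N MN x /= xM; rewrite (le_trans xM)// ltW].
Qed.

Lemma compact_cball M : compact (cball M).
Proof. by apply: bounded_closed_compact; [exact: bounded_cball|exact: closed_cball]. Qed.

Lemma measurable_cball M : measurable (cball M).
Proof. by apply: measurable_closed; exact: closed_cball. Qed.

Lemma cball_fin M : (leb (cball M) < +oo)%E.
Proof. by apply: bounded_lebesgue_fin; [exact: bounded_cball|exact: measurable_cball]. Qed.

Lemma Lfun2_bounded A (C : R) f : measurable A -> (leb A < +oo)%E ->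
  measurable_fun setT f -> (forall x, `|f x| <= C) -> (forall x, ~ A x -> f x = 0) ->
  f \in L2.
Proof.
move=> mA fA mf fC f0.
rewrite (_ : f = fun x => f x * \1_A x); last first.
  apply/funext => x; rewrite indicE; have [Ax|nA] := pselect (A x).
    by rewrite mem_set// mulr1.
  by rewrite f0// mul0r.
by apply: Lfun2M_bounded fC => //; exact: Lfun2_indic.
Qed.

Lemma integrable_bounded A (C : R) f : measurable A -> (leb A < +oo)%E ->
  measurable_fun setT f -> (forall x, `|f x| <= C) -> (forall x, ~ A x -> f x = 0) ->
  leb.-integrable setT (EFin \o f).
Proof.
move=> mA fA mf fC f0.
have := dot_integrable (Lfun2_bounded mA fA mf fC f0) (Lfun2_indic mA fA).
congr (leb.-integrable _ _); apply/funext => x /=; congr EFin.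
rewrite indicE; have [Ax|nA] := pselect (A x); first by rewrite mem_set// mulr1.
by rewrite f0// mul0r.
Qed.

Definition bsupp f := exists M : R, forall x, M < `|x| -> f x = 0.

Lemma bsupp_bounded f : continuous f -> bsupp f -> exists2 C : R, 0 < C & forall x, `|f x| <= C.
Proof.
move=> cf [M fM]; have [C C0 fC] := compact_bounded_fun cf (@compact_cball M).
exists C => // x; have [xM|xM] := leP `|x| M; first exact: fC.
by rewrite fM// normr0 ltW.
Qed.

Lemma bsupp_partial f i : bsupp f -> bsupp (partial i f).
Proof.
move=> [M fM]; exists M => x xM.
apply: (@partial_off _ _ f i (cball M)); first exact: closed_cball.
  by move=> y /negP; rewrite -ltNge; exact: fM.
by apply/negP; rewrite -ltNge.
Qed.

Lemma bsuppMl f g : bsupp f -> bsupp (fun x => f x * g x).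
Proof. by move=> [M fM]; exists M => x /fM ->; rewrite mul0r. Qed.

Lemma bsuppMr f g : bsupp g -> bsupp (fun x => f x * g x).
Proof. by move=> [M gM]; exists M => x /gM ->; rewrite mulr0. Qed.

Lemma bsuppD f g : bsupp f -> bsupp g -> bsupp (fun x => f x + g x).
Proof.
move=> [M fM] [N gN]; exists (Num.max M N) => x.
by rewrite gt_max => /andP[/fM -> /gN ->]; rewrite addr0.
Qed.

Lemma bsupp_shift f h : bsupp f -> bsupp (fun x => f (x + h)).
Proof.
move=> [M fM]; exists (M + `|h|) => x xM; apply: fM.
have := lerB_dist x (- h); rewrite opprK normrN; apply: lt_le_trans.
by rewrite ltrBrDr.
Qed.

Lemma bsupp_L2 f : continuous f -> bsupp f -> f \in L2.
Proof.
move=> cf bf; have [C _ fC] := bsupp_bounded cf bf; have [M fM] := bf.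
apply: (Lfun2_bounded (measurable_cball M) (cball_fin M) _ fC).
  exact: continuous_measurable_rV.
by move=> x /negP; rewrite -ltNge; exact: fM.
Qed.

Lemma bsupp_integrable f : continuous f -> bsupp f -> leb.-integrable setT (EFin \o f).
Proof.
move=> cf bf; have [C _ fC] := bsupp_bounded cf bf; have [M fM] := bf.
apply: (integrable_bounded (measurable_cball M) (cball_fin M) _ fC).
  exact: continuous_measurable_rV.
by move=> x /negP; rewrite -ltNge; exact: fM.
Qed.

Lemma continuous_L2_on A f : continuous f -> bounded_set A -> measurable A -> f \_ A \in L2.
Proof.
move=> cf bA mA.
have [C C0 fC] := compact_bounded_fun cf (compact_closure_bounded bA).
apply: (@Lfun2_bounded A C) => //.
- exact: bounded_lebesgue_fin.
- apply/(measurable_restrictT _ mA); apply: measurable_funTS.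
  exact: continuous_measurable_rV.
- move=> x; rewrite patchE; case: ifPn => [/set_mem Ax|_].
    by apply: fC; exact: subset_closure.
  by rewrite normr0 ltW.
- by move=> x nA; rewrite patchE memNset.
Qed.

Lemma norm_delta_le1 i : `|'e_i : pt| <= 1.
Proof.
by apply/rV_norm_leP => // j; rewrite mxE eqxx/=; case: eqP; rewrite ?normr1 ?normr0.
Qed.

Lemma partial_MVT f x i (t : R) : (forall y, differentiable f y) ->
  exists2 y, `|y - x| <= `|t| & f (x + t *: 'e_i) - f x = t * partial i f y.
Proof.
move=> df; have [s /andP[s0 s1] ->] := line_MVT x (t *: 'e_i) df.
exists (x + s *: (t *: 'e_i)).
  rewrite addrAC subrr add0r scalerA normrZ.
  apply: (@le_trans _ _ (`|s * t| * 1)); last first.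
    by rewrite mulr1 normrM ler_piMl// ger0_norm.
  by rewrite ler_wpM2l// norm_delta_le1.
rewrite derive_sum_partial// (bigD1 i)//= big1 ?addr0.
  by rewrite !mxE !eqxx/= mulr1.
by move=> j ji; rewrite !mxE eqxx/= (negbTE ji) mulr0 mul0r.
Qed.

(** The integral of a difference quotient vanishes because the measure is
    invariant under translations; the quotients converge boundedly. *)
Lemma integral_partial f i : smooth f -> bsupp f -> \int[leb]_x partial i f x = 0.
Proof.
move=> sf bf; have [M fM] := bf.
have cf := smooth_continuous sf; have mf := smooth_measurable sf.
have [C C0 pC] := bsupp_bounded (smooth_continuous (smooth_partial i sf)) (bsupp_partial i bf).
have if_ := bsupp_integrable cf bf.
pose t (k : nat) : R := k.+1%:R^-1.
have t0 k : 0 < t k by rewrite invr_gt0.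
have t1 k : t k <= 1 by rewrite invf_le1// ler1n.
pose g k x := (t k)^-1 * (f (x + t k *: 'e_i) - f x).
have ish k : leb.-integrable setT (EFin \o (fun x => f (x + t k *: 'e_i))).
  exact: integrable_shift.
have isub k : leb.-integrable setT (EFin \o (fun x => f (x + t k *: 'e_i) - f x)).
  exact: (integrableB measurableT (ish k) if_).
have ig k : leb.-integrable setT (EFin \o g k).
  exact: (integrableZl measurableT (t k)^-1 (isub k)).
have g0 k : (\int[leb]_x (EFin \o g k) x = 0)%E.
  rewrite -[LHS]fineK; last exact: integrable_fin_num (ig k).
  congr EFin; rewrite -[LHS]/(\int[leb]_x g k x) /g RintegralZl//.
  by rewrite RintegralB// Rintegral_shift// subrr mulr0.
(* the quotients vanish off the ball of radius M + 1, as t k <= 1 *)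
pose h x := C * \1_(cball (M + 1)) x.
have ih : leb.-integrable setT (EFin \o h).
  apply: (@integrable_bounded (cball (M + 1)) C).
  - exact: measurable_cball.
  - exact: cball_fin.
  - by apply: measurable_funM => //; apply: measurable_indic; exact: measurable_cball.
  - move=> x; rewrite /h indicE; case: (_ \in _); rewrite ?mulr1 ?mulr0 ?normr0 ?ger0_norm//; exact: ltW.
  - by move=> x nx; rewrite /h indicE memNset// mulr0.
have gh k x : `|g k x| <= h x.
  rewrite /h indicE; have [xM|xM] := leP `|x| (M + 1).
    rewrite mem_set// mulr1.
    have [y _ E] := partial_MVT x i (t k) (fun y => smooth_differentiable y sf).
    by rewrite /g E mulrA mulVf ?gt_eqF// mul1r.
  rewrite memNset ?mulr0; last by apply/negP; rewrite -ltNge.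
  rewrite /g !fM ?subrr ?mulr0 ?normr0//.
    by rewrite (le_lt_trans _ xM)// lerDl.
  have := lerB_dist x (- (t k *: 'e_i)); rewrite opprK normrN => /(lt_le_trans _); apply.
  rewrite ltrBrDr (le_lt_trans _ xM)// lerD2l normrZ gtr0_norm//.
  by apply: le_trans (t1 k); rewrite ler_piMr ?norm_delta_le1// ltW.
have gcv x : (EFin \o g k) x @[k --> \oo] --> (EFin \o partial i f) x.
  apply: cvg_EFin; first exact: nearW.
  pose q (s : R) := s^-1 *: ((f \o shift x) (s *: 'e_i) - f x).
  have qc : q s @[s --> 0^'] --> partial i f x.
    exact: (diff_derivable (smooth_differentiable x sf)).
  have gq : (fun k => g k x) = q \o t.
    by apply/funext => k; rewrite /q /g /= (addrC x).
  change ((fun k => g k x) @ \oo --> partial i f x); rewrite gq.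
  apply: cvg_comp qc => U [e /= e0 eU].
  have [N _ Ne] := cvgr0_norm_lt _ (@cvg_harmonic R) _ e0.
  exists N => // k /= Nk; apply: eU; last by rewrite /= gt_eqF.
  by rewrite /ball_ /= sub0r normrN; exact: Ne.
have [] := @dominated_convergence _ _ _ leb setT measurableT (fun k => EFin \o g k)
  (EFin \o partial i f) (EFin \o h) _ _ _ ih _.
- by move=> k; have /integrableP[] := ig k.
- by apply/measurable_EFinP; apply: smooth_measurable; exact: smooth_partial.
- by apply: aeW => x _; exact: gcv.
- by apply: aeW => x k _ /=; rewrite lee_fin.
move=> _ _ cv; have : (\int[leb]_x (EFin \o partial i f) x = 0)%E.
  apply/esym; apply: (cvg_unique _ _ cv) => //.
  rewrite (_ : (fun k => _) = cst 0%E); first exact: cvg_cst.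
  by apply/funext => k; exact: g0.
by rewrite /Rintegral => ->.
Qed.

Lemma integral_by_parts f g i : smooth f -> smooth g -> bsupp g ->
  \int[leb]_x (partial i f x * g x) = - \int[leb]_x (f x * partial i g x).
Proof.
move=> sf sg bg.
have := @integral_partial (fun x => f x * g x) i (smoothM sf sg) (bsuppMr _ bg).
rewrite partialM; [|by move=> x; exact: smooth_differentiable..].
rewrite RintegralD//.
- by move=> /eqP; rewrite addr_eq0 => /eqP.
- apply: bsupp_integrable (bsuppMr _ bg); apply: smooth_continuous.
  by apply: smoothM => //; exact: smooth_partial.
- apply: bsupp_integrable (bsuppMr _ (bsupp_partial i bg)); apply: smooth_continuous.
  by apply: smoothM => //; exact: smooth_partial.
Qed.

End integration.

(** * The fundamental lemma of the calculus of variations *)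

Section fundamental_lemma.
Context (R : realType) (d : nat).
Local Notation pt := 'rV[R]_d.
Local Notation leb := (@lebesgue_rV R d).
Local Notation L2 := (Lfun leb 2%:E).
Implicit Types (f g : pt -> R) (x y v h a b : pt) (i : 'I_d) (A K : set pt).

Lemma open_box_norm a b x : open_box a b x -> `|x| <= `|a| + `|b|.
Proof.
move=> xab; apply/rV_norm_leP => [|i]; first by rewrite addr_ge0.
have /andP[h1 h2] := xab i; have := rV_coord_le a i; have := rV_coord_le b i.
rewrite !ler_norml => /andP[b1 b2] /andP[a1 a2].
have := normr_ge0 a; have := normr_ge0 b => *; apply/andP; split; lra.
Qed.

(** Unlike the bump, these functions increase to the indicator function of the box
    as k grows. *)
Definition box_cutoff a b (k : nat) x : R :=
  box_bump a b x * (box_bump a b x + k.+1%:R^-1)^-1.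

Lemma smooth_box_cutoff a b k : smooth (box_cutoff a b k).
Proof.
apply: smoothM; first exact: smooth_box_bump.
apply: smoothV; last by apply: smoothD; [exact: smooth_box_bump|exact: smooth_cst].
by move=> x; rewrite gt_eqF// ltr_wpDl ?box_bump_ge0.
Qed.

Lemma box_cutoff_off a b k x : ~ open_box a b x -> box_cutoff a b k x = 0.
Proof. by move=> nx; rewrite /box_cutoff box_bump_off// mul0r. Qed.

Lemma box_cutoff_norm a b k x : `|box_cutoff a b k x| <= 1.
Proof.
have h : 0 < box_bump a b x + k.+1%:R^-1 by rewrite ltr_wpDl ?box_bump_ge0.
rewrite ger0_norm; last by rewrite divr_ge0 ?box_bump_ge0// ltW.
by rewrite ler_pdivrMr// mul1r lerDl.
Qed.

Lemma bsupp_box_cutoff a b k : bsupp (box_cutoff a b k).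
Proof.
exists (`|a| + `|b|) => x; rewrite ltNge => /negP xab.
by apply: box_cutoff_off => /open_box_norm.
Qed.

Lemma box_cutoff_cvg a b x : box_cutoff a b k x @[k --> \oo] --> (\1_(open_box a b) x : R).
Proof.
rewrite indicE; have [xab|nx] := pselect (open_box a b x); last first.
  rewrite memNset//; under eq_fun do rewrite box_cutoff_off//.
  exact: cvg_cst.
rewrite mem_set//; have u0 := box_bump_gt0 xab.
rewrite -[X in _ --> X](@mulfV _ (box_bump a b x)) ?gt_eqF//.
rewrite /box_cutoff; apply: cvgM; first exact: cvg_cst.
apply: cvgV; first by rewrite gt_eqF.
rewrite -[X in _ --> X]addr0; apply: cvgD; first exact: cvg_cst.
exact: cvg_harmonic.
Qed.

(** Integrals against smooth cutoffs of boxes determine the integrals over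
    boxes, hence over all measurable sets. *)
Lemma ae_eq0_of_boxes g : leb.-integrable setT (EFin \o g) ->
  (forall a b k, \int[leb]_x (g x * box_cutoff a b k x) = 0) ->
  \forall x \ae leb, g x = 0.
Proof.
move=> ig g0; have /integrableP[mg _] := ig.
have mgR : measurable_fun setT g by exact/measurable_EFinP.
have igE E : measurable E -> leb.-integrable E (EFin \o g).
  by move=> mE; exact: integrableS ig.
have boxes a b : (\int[leb]_(x in open_box a b) (g x)%:E = 0)%E.
  have mB := measurable_open_box a b.
  pose F k x := (g x * box_cutoff a b k x)%:E.
  have mF k : measurable_fun setT (F k).
    apply/measurable_EFinP; apply: measurable_funM => //.
    by apply: smooth_measurable; exact: smooth_box_cutoff.
  have Fg k x : (`|F k x| <= (abse \o (EFin \o g)) x)%E.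
    by rewrite /F /= lee_fin normrM ler_piMr// box_cutoff_norm.
  have := @dominated_convergence _ _ _ leb setT measurableT F
    (fun x => (g x * \1_(open_box a b) x)%:E) (abse \o (EFin \o g)) mF _ _
    (integrable_abse ig) _.
  case.
  - apply/measurable_EFinP; apply: measurable_funM => //; exact: measurable_indic.
  - apply: aeW => x _; apply: cvg_EFin; first exact: nearW.
    by apply: cvgM; [exact: cvg_cst|exact: box_cutoff_cvg].
  - by apply: aeW => x k _; exact: Fg.
  move=> _ _ cv.
  have iF k : leb.-integrable setT (F k).
    apply: le_integrable (integrable_abse ig) => // x _.
    by apply: le_trans (Fg k x) _; exact: lee_abs.
  have F0 k : (\int[leb]_x F k x = 0)%E.
    rewrite -[LHS]fineK; last exact: (integrable_fin_num _ (iF k)).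
    by congr EFin; exact: g0.
  transitivity (\int[leb]_x (g x * \1_(open_box a b) x)%:E)%E.
    rewrite integral_mkcond; apply: eq_integral => x _.
    by rewrite patchE indicE; case: (_ \in _); rewrite ?mulr1 ?mulr0.
  apply: (cvg_unique _ cv) => //.
  rewrite (_ : (fun k => _) = cst 0%E); first exact: cvg_cst.
  by apply/funext => k; exact: F0.
have gT : (\int[leb]_x (g x)%:E = 0)%E.
  pose B (k : nat) := open_box (const_mx (- k%:R) : pt) (const_mx k%:R).
  pose F k x := (g x * \1_(B k) x)%:E.
  have mF k : measurable_fun setT (F k).
    apply/measurable_EFinP; apply: measurable_funM => //; apply: measurable_indic.
    exact: measurable_open_box.
  have Fg k x : (`|F k x| <= (abse \o (EFin \o g)) x)%E.
    rewrite /F /= lee_fin normrM ler_piMr// indicE.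
    by case: (_ \in _); rewrite ?normr1 ?normr0.
  have := @dominated_convergence _ _ _ leb setT measurableT F
    (fun x => (g x)%:E) (abse \o (EFin \o g)) mF mg _ (integrable_abse ig) _.
  case.
  - apply: aeW => x _; apply: cvg_near_cst.
    exists (Num.truncn `|x|).+1 => // k /= xk.
    rewrite /F indicE mem_set ?mulr1// => i; rewrite !mxE -ltr_norml.
    apply: le_lt_trans (rV_coord_le x i) _; apply: lt_le_trans (truncnS_gt _) _.
    by rewrite ler_nat.
  - by apply: aeW => x k _; exact: Fg.
  move=> _ _ cv; apply: (cvg_unique _ cv) => //.
  rewrite (_ : (fun k => _) = cst 0%E); first exact: cvg_cst.
  apply/funext => k /=; rewrite -[RHS](boxes (const_mx (- k%:R)) (const_mx k%:R)).
  rewrite [RHS]integral_mkcond; apply: eq_integral => x _.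
  by rewrite patchE /F indicE; case: (_ \in _); rewrite ?mulr1 ?mulr0.
have all0 E : measurable E -> (\int[leb]_(x in E) (g x)%:E = 0)%E.
  rewrite measurable_boxE; move: E; apply: (@dynkin_induction _ _ (@box_system R d)
    [set E | (\int[leb]_(x in E) (g x)%:E = 0)%E] (@measurable_boxE R d)).
  - by move=> _ _ [a [b ->]] [a' [b' ->]]; rewrite open_boxI; eexists _, _.
  - exact: gT.
  - by move=> _ [a [b ->]]; exact: boxes.
  - move=> S mS S0; have := gT; rewrite -(setUv S) integral_setU_EFin//.
    + by rewrite (S0 : (\int[leb]_(x in S) (g x)%:E = 0)%E) add0e.
    + exact: measurableC.
    + exact: measurable_funTS.
    + by apply/disj_setPS; rewrite setICr.
  - move=> F mF tF F0; rewrite /= integral_bigcup//.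
      by apply: eseries0 => k _ _; exact: F0.
    by apply: igE; exact: bigcupT_measurable.
have := @integral_ae_eq _ _ _ leb setT measurableT (cst 0%E) (EFin \o g) ig.
case=> //.
- by move=> E _ mE; rewrite all0// integral0.
- move=> N [mN N0 Ns]; exists N; split=> // x /= gx; apply: Ns => /= h.
  by apply: gx; have [] := h I.
Qed.

Lemma open_box_test A a b k : closed_box a b `<=` A -> test_fun A (box_cutoff a b k).
Proof.
move=> cA; split; first exact: smooth_box_cutoff.
exists (closed_box a b); split=> //.
  have := @rV_compact _ d (fun i => `[a 0 i, b 0 i]%classic) (fun i => @segment_compact R _ _).
  by congr compact; apply/seteqP; split=> x /= h i; have := h i; rewrite in_itv.
by move=> x nx; apply: box_cutoff_off => xab; apply: nx => i; have /andP[/ltW -> /ltW ->] := xab i.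
Qed.

Lemma test_fun_bsupp A f : test_fun A f -> bsupp f.
Proof.
move=> [_ [K [cK _ K0]]].
have [M M0 KM] := bounded_setP (compact_bounded cK).
exists M => x xM; apply: K0 => /KM; rewrite ltNge => /negP; apply; exact: ltW.
Qed.

Lemma test_funM A f g : test_fun A f -> smooth g -> test_fun A (fun x => f x * g x).
Proof.
move=> [sf [K [cK KA K0]]] sg; split; first exact: smoothM.
by exists K; split=> // x /K0 ->; rewrite mul0r.
Qed.

(** Multiplying by a cutoff reduces this to the whole space, and countably many
    cutoffs detect every point of the open set. *)
Lemma fundamental_lemma A f : open A -> f \_ A \in L2 ->
  (forall phi, test_fun A phi -> ip A f phi = 0) ->
  \forall x \ae leb, A x -> f x = 0.
Proof.
move=> oA fL f0.
have ipE phi : test_fun A phi -> \int[leb]_x ((f \_ A) x * phi x) = 0.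
  move=> tphi; rewrite -(f0 phi tphi) /ip [RHS]Rintegral_mkcond.
  apply: eq_Rintegral => x _; rewrite !patchE; case: ifP => // _.
  by rewrite mul0r.
have [B [Bbox AB]] := open_box_cover oA.
suff h k : \forall x \ae leb, B k x -> f x = 0.
  have := ae_foralln h; apply: filterS => x hx Ax.
  by move: (Ax); rewrite AB => -[k _]; exact: hx.
have [->|[a [b [-> cA]]]] := Bbox k; first by apply: aeW.
(* the cutoff of index 0 is positive on the whole box *)
have tB := open_box_test 0 cA.
have cL : box_cutoff a b 0 \in L2.
  by apply: bsupp_L2 (bsupp_box_cutoff _ _ _); exact/smooth_continuous/smooth_box_cutoff.
have := @ae_eq0_of_boxes (fun x => (f \_ A) x * box_cutoff a b 0 x) (dot_integrable fL cL).
case=> [a' b' k'|N [mN N0 Ns]].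
  rewrite -(ipE _ (test_funM tB (smooth_box_cutoff a' b' k'))).
  by apply: eq_Rintegral => x _; rewrite mulrA.
exists N; split=> // x /= fx; apply: Ns => /= fx0; apply: fx => xab.
move/eqP: fx0; rewrite mulf_eq0 patchE mem_set => [/orP[/eqP//|]|].
  rewrite /box_cutoff mulf_eq0 invr_eq0 !gt_eqF ?box_bump_gt0//.
  by rewrite ltr_wpDl ?box_bump_ge0.
by apply: cA => i; have /andP[/ltW -> /ltW ->] := xab i.
Qed.

End fundamental_lemma.

(** * Density of smooth functions and continuity of translations *)

Section translations.
Context (R : realType) (d : nat).
Local Notation pt := 'rV[R]_d.
Local Notation leb := (@lebesgue_rV R d).
Local Notation L2 := (Lfun leb 2%:E).
Implicit Types (f g v u : pt -> R) (x y z h : pt) (i : 'I_d).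

(** The orthogonal complement of the test functions is trivial by the
    fundamental lemma, so the projection onto their closure is the identity. *)
Lemma test_dense f : f \in L2 -> forall e : R, 0 < e ->
  exists phi, [/\ smooth phi, bsupp phi & L2sqn leb (fun x => f x - phi x) < e].
Proof.
move=> fL.
pose X := [set f : pt -> R | f \in L2].
pose S := [set f : pt -> R | smooth f /\ bsupp f].
have XS : S `<=` X by move=> g [sg bg]; apply: bsupp_L2 => //; exact: smooth_continuous.
have [|||||||p [pL pS orth]] := @orthogonal_projection R (pt -> R) X S (L2dot leb) _ _ _ _ _ XS _ _ f fL.
- by move=> a u v uL vL; exact: (Lfun2D (Lfun2Z a uL) vL).
- move=> a u v w uL vL wL.
  by rewrite [LHS](dotDl (Lfun2Z a uL) vL wL) (dotZl _ uL wL).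
- by move=> u v _ _; exact: dotC.
- by move=> u _; exact: dot_ge0.
- by move=> u uL uC; have [l lL lP] := Lfun2_complete uL uC; exists l.
- by split; [exact: smooth_cst|exists 0].
- move=> a u v [su bu] [sv bv]; split.
    by apply: smoothD => //; exact: smoothZ.
  by apply: bsuppD => //; exact: bsuppMr.
have fpL : (fun x => f x - p x) \in L2 by exact: Lfun2B.
have fp0 : \forall x \ae leb, setT x -> f x - p x = 0.
  apply: fundamental_lemma; first exact: openT.
    by rewrite (_ : _ \_ _ = fun x => f x - p x)//; apply/funext => x; rewrite patchE in_setT.
  move=> phi tphi; apply: (orth phi); split; first exact: tphi.1.
  exact: test_fun_bsupp tphi.
move=> e e0; have [phi [sphi bphi] ne] := pS e e0.
exists phi; split=> //; have phiL := XS _ (conj sphi bphi).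
apply: le_lt_trans ne.
have m1 := Lfun2_measurable (Lfun2B fL phiL).
have m2 := Lfun2_measurable (Lfun2B pL phiL).
have fpa : \forall x \ae leb, f x - phi x = p x - phi x.
  by apply: filterS fp0 => x /(_ I) /eqP; rewrite subr_eq0 => /eqP ->.
rewrite /L2sqn (dot_ae m1 m2 m1 fpa) dotC (dot_ae m1 m2 m2 fpa).
rewrite le_eqVlt; apply/orP; left; apply/eqP; apply: eq_Rintegral => x _.
by rewrite -!expr2 -sqrrN opprB.
Qed.

Lemma smooth_lipschitz f : smooth f -> bsupp f ->
  exists2 C : R, 0 < C & forall x h, `|f (x + h) - f x| <= C * `|h|.
Proof.
move=> sf bf.
have /choice[C CP] i : exists C : R, 0 < C /\ forall x, `|partial i f x| <= C.
  have [C C0 fC] := bsupp_bounded (smooth_continuous (smooth_partial i sf)) (bsupp_partial i bf).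
  by exists C.
exists (1 + \sum_i C i); first by rewrite ltr_wpDr// sumr_ge0// => i _; exact: ltW (CP i).1.
move=> x h; have [s _ ->] := line_MVT x h (fun y => smooth_differentiable y sf).
rewrite derive_sum_partial; last exact: smooth_differentiable.
apply: le_trans (ler_norm_sum _ _ _) _; rewrite mulrDl mulr_suml.
apply: (@le_trans _ _ (\sum_i C i * `|h|)); last by rewrite lerDr mul1r.
apply: ler_sum => i _; rewrite normrM mulrC ler_pM//; first exact: (CP i).2.
exact: rV_coord_le.
Qed.

Lemma smooth_taylor f : smooth f -> bsupp f ->
  exists2 C : R, 0 < C & forall x h,
    `|f (x + h) - f x - \sum_i h 0 i * partial i f x| <= C * `|h| ^+ 2.
Proof.
move=> sf bf.
have /choice[C CP] i : exists C : R, 0 < C /\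
    forall x h, `|partial i f (x + h) - partial i f x| <= C * `|h|.
  have [C C0 fC] := smooth_lipschitz (smooth_partial i sf) (bsupp_partial i bf).
  by exists C.
exists (1 + \sum_i C i); first by rewrite ltr_wpDr// sumr_ge0// => i _; exact: ltW (CP i).1.
move=> x h; have [s /andP[s0 s1] ->] := line_MVT x h (fun y => smooth_differentiable y sf).
rewrite derive_sum_partial; last exact: smooth_differentiable.
rewrite -sumrB; under eq_bigr do rewrite -mulrBr.
apply: le_trans (ler_norm_sum _ _ _) _; rewrite mulrDl mulr_suml.
apply: (@le_trans _ _ (\sum_i C i * `|h| ^+ 2)); last by rewrite lerDr mul1r sqr_ge0.
apply: ler_sum => i _; rewrite normrM expr2 mulrA mulrC ler_pM//; last exact: rV_coord_le.
apply: le_trans ((CP i).2 _ _) _; rewrite ler_wpM2l ?(ltW (CP i).1)//.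
by rewrite normrZ ger0_norm// ler_piMl.
Qed.

(** Density reduces this to smooth functions with bounded support, which are
    Lipschitz. *)
Lemma translation_continuous f : f \in L2 -> forall e : R, 0 < e ->
  exists2 r : R, 0 < r &
    forall h, `|h| <= r -> L2sqn leb (fun x => f (x + h) - f x) < e.
Proof.
move=> fL e e0; have e16 : 0 < e / 16 by rewrite divr_gt0.
have [phi [sphi bphi fphi]] := test_dense fL e16.
have phiL : phi \in L2 by apply: bsupp_L2 => //; exact: smooth_continuous.
have [C C0 lphi] := smooth_lipschitz sphi bphi.
have [M Mphi] := bphi.
pose m := fine (leb (cball (M + 1))).
have m0 : 0 <= m by exact: fine_ge0.
pose r : R := Num.min 1 (e / (16 * (C ^+ 2 * (m + 1)))).
have D0 : 0 < 16 * (C ^+ 2 * (m + 1)) by rewrite !mulr_gt0 ?exprn_gt0// ltr_wpDl.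
have r0 : 0 < r by rewrite lt_min ltr01/= divr_gt0.
exists r => // h hr.
have h1 : `|h| <= 1 by apply: le_trans hr _; rewrite ge_min lexx.
have h2 : `|h| ^+ 2 <= e / (16 * (C ^+ 2 * (m + 1))).
  apply: (@le_trans _ _ `|h|); first by rewrite expr2 ler_piMl.
  by apply: le_trans hr _; rewrite ge_min lexx orbT.
have shL g : g \in L2 -> (fun x => g (x + h)) \in L2 by exact: Lfun2_shift.
pose a x := f x - phi x; have aL : a \in L2 by exact: Lfun2B.
pose b x := phi (x + h) - phi x.
have bL : b \in L2 by apply: Lfun2B => //; exact: shL.
(* b vanishes off the ball of radius M + 1, as the norm of h is at most 1 *)
have sb : L2sqn leb b <= C ^+ 2 * `|h| ^+ 2 * m.
  have iL := Lfun2_indic (measurable_cball (M + 1)) (cball_fin d (M + 1)).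
  pose k : pt -> R := fun x => (C * `|h|) * \1_(cball (M + 1)) x.
  have kL : k \in L2 by exact: Lfun2Z.
  apply: (@le_trans _ _ (L2dot leb k k)).
    apply: dot_le => //; first exact: Lfun2_measurable bL.
    move=> x; rewrite /k indicE; have [xM|xM] := leP `|x| (M + 1).
      rewrite mem_set// mulr1 [leRHS]ger0_norm; first exact: lphi.
      by rewrite mulr_ge0// ltW.
    rewrite memNset ?mulr0; last by apply/negP; rewrite -ltNge.
    rewrite normr0 /b !Mphi ?subrr ?normr0//.
      by rewrite (le_lt_trans _ xM)// lerDl.
    have := lerB_dist x (- h); rewrite opprK normrN => /(lt_le_trans _); apply.
    by rewrite ltrBrDr (le_lt_trans _ xM)// lerD2l.
  rewrite /k dotZl// dotC dotZl// mulrA -expr2 exprMn ler_wpM2l ?(mulr_ge0 (sqr_ge0 _) (sqr_ge0 _))//.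
  rewrite /L2dot (_ : (fun x => _) = \1_(cball (M + 1))); last first.
    by apply/funext => x; rewrite indicE; case: (_ \in _); rewrite ?mulr1 ?mulr0.
  by rewrite /Rintegral integral_indic ?setIT//; exact: measurable_cball.
have sb' : L2sqn leb b <= e / 16.
  apply: le_trans sb _; apply: (@le_trans _ _ (C ^+ 2 * (e / (16 * (C ^+ 2 * (m + 1)))) * m)).
    by rewrite ler_wpM2r// ler_wpM2l ?sqr_ge0.
  rewrite (_ : C ^+ 2 * _ * m = e / 16 * (m / (m + 1))); last first.
    by field; rewrite !gt_eqF// ltr_wpDl.
  rewrite ler_piMr ?(ltW e16)// ler_pdivrMr ?mul1r ?lerDl//; by rewrite ltr_wpDl.
have -> : (fun x => f (x + h) - f x) = fun x => (a (x + h) + b x) + - a x.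
  by apply/funext => x; rewrite /a /b; ring.
have := dot_sqD_le (Lfun2D (shL _ aL) bL) (Lfun2N aL).
have := dot_sqD_le (shL _ aL) bL.
rewrite dot_shift// (dotNl aL (Lfun2N aL)) dotC (dotNl aL aL) opprK.
move: sb' fphi; rewrite /L2sqn -/a; lra.
Qed.

End translations.

(** * Mollification *)

Section mollification.
Context (R : realType) (d : nat).
Local Notation pt := 'rV[R]_d.
Local Notation leb := (@lebesgue_rV R d).
Local Notation L2 := (Lfun leb 2%:E).
Implicit Types (f g v u eta : pt -> R) (x y z h : pt) (i : 'I_d).

(** Mollifiers are squares, which lets the square root of the weight enter the
    Cauchy-Schwarz inequality as a smooth function. *)
Lemma mollifier_exists (e : R) : 0 < e -> exists u,
  [/\ smooth u, (forall x, e < `|x| -> u x = 0) & L2dot leb u u = 1].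
Proof.
move=> e0; pose a : pt := const_mx (- e); pose b : pt := const_mx e.
pose w := box_bump a b.
have off x : e < `|x| -> w x = 0.
  move=> ex; apply: box_bump_off => xab; move: ex; rewrite ltNge => /negP; apply.
  apply/rV_norm_leP; first exact: ltW.
  by move=> i; have := xab i; rewrite !mxE ler_norml => /andP[/ltW -> /ltW ->].
have sw : smooth w by exact: smooth_box_bump.
have wL : w \in L2 by apply: bsupp_L2; [exact: smooth_continuous|exists e].
have w0 : 0 < L2dot leb w w.
  rewrite lt_neqAle dot_ge0 andbT; apply/eqP => /esym/(dot_eq0 wL)[N [mN N0 Ns]].
  have : (leb (open_box a b) <= leb N)%E.
    apply: le_measure; rewrite ?inE//; first exact: measurable_open_box.
    by move=> x xab; apply: Ns => /= /eqP; rewrite gt_eqF// box_bump_gt0.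
  rewrite N0 leNgt => /negP; apply; rewrite lebesgue_open_box.
  elim/big_ind : _ => // [x y x0 y0|i _]; first exact: mule_gt0.
  by rewrite lebesgue_measure_itv/= !mxE lte_fin gtrN// -EFinB lte_fin opprK addr_gt0.
exists (fun x => (Num.sqrt (L2dot leb w w))^-1 * w x); split.
- exact: smoothZ.
- by move=> x /off ->; rewrite mulr0.
- have h := Lfun2Z (Num.sqrt (L2dot leb w w))^-1 wL.
  rewrite dotZl// dotC dotZl// mulrA -invfM -expr2 sqr_sqrtr ?dot_ge0//.
  by rewrite mulVf// gt_eqF.
Qed.

Definition mollify v eta x : R := \int[leb]_y (v y * eta (y - x)).

Lemma mollifyE v eta x : measurable_fun setT v -> measurable_fun setT eta ->
  mollify v eta x = \int[leb]_z (v (z + x) * eta z).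
Proof.
move=> mv me; rewrite /mollify -(@Rintegral_shift _ _ _ x).
  by apply: eq_Rintegral => z _; rewrite addrK.
apply: measurable_funM => //; apply: (measurableT_comp me).
exact: (measurable_shift (- x)).
Qed.

Lemma mollify_integrable v eta x : leb.-integrable setT (EFin \o v) ->
  smooth eta -> bsupp eta ->
  leb.-integrable setT (EFin \o (fun y => v y * eta (y - x))).
Proof.
move=> iv se be; have [C C0 eC] := bsupp_bounded (smooth_continuous se) be.
have /integrableP[/measurable_EFinP mv _] := iv.
apply: (le_integrable measurableT _ _ (integrableZl measurableT C (integrable_norm iv))).
  apply/measurable_EFinP; apply: measurable_funM => //.
  by apply: smooth_measurable; exact: (smooth_shift (- x) se).
move=> y _; rewrite /= lee_fin normrM mulrC [leRHS]ger0_norm; first by rewrite ler_wpM2r.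
by rewrite mulr_ge0// ltW.
Qed.

(** A quadratic error is in particular of lower order than the increment. *)
Lemma differentiable_of_quadratic (F : pt -> R) (c : 'I_d -> R) x (C : R) : 0 < C ->
  (forall h, `|F (x + h) - F x - \sum_i h 0 i * c i| <= C * `|h| ^+ 2) ->
  differentiable F x /\ forall i, partial i F x = c i.
Proof.
move=> C0 FC; pose l h : R := \sum_i h 0 i * c i.
have linl : linear l.
  move=> a u v; rewrite /l /GRing.scale/= mulr_sumr -big_split; apply: eq_bigr => i _ /=.
  by rewrite !mxE mulrDl mulrA.
pose lM := GRing.isLinear.Build _ _ _ _ _ linl.
pose L : {linear pt -> R} := HB.pack l lM.
have cL : continuous L.
  rewrite (_ : (L : pt -> R) = fun h => \sum_i h 0 i * c i)//.
  apply: smooth_continuous; apply: smooth_sum => i _; apply: smoothM; first exact: smooth_coord.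
  exact: smooth_cst.
have E : F \o shift x = cst (F x) + L +o_ (0 : pt) id.
  apply/eqaddoP => e e0.
  have nh : \forall h \near (0 : pt), `|h| <= e / C.
    have eC0 : 0 < e / C by rewrite divr_gt0.
    apply: filterS (nbhsx_ballx (0 : pt) (e / C) eC0) => h.
    by rewrite -ball_normE /= sub0r normrN => /ltW.
  apply: filterS nh => h he.
  rewrite -[X in `|X|]/(F (h + x) - (F x + l h)) opprD addrA (addrC h).
  apply: le_trans (FC h) _; rewrite expr2 mulrA ler_wpM2r//.
  by rewrite mulrC -ler_pdivlMr.
have dE := diff_unique cL E.
have dF : differentiable F x by apply/diff_locallyP; rewrite dE.
split=> // i; rewrite /partial deriveE// dE -[LHS]/(l 'e_i) /l (bigD1 i)//= big1 ?addr0.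
  by rewrite mxE !eqxx mul1r.
by move=> j ji; rewrite mxE eqxx/= (negbTE ji) mul0r.
Qed.

Lemma Rintegral_sum (J : Type) (r : seq J) (F : J -> pt -> R) :
  (forall j, leb.-integrable setT (EFin \o F j)) ->
  \int[leb]_x (\sum_(j <- r) F j x) = \sum_(j <- r) \int[leb]_x F j x.
Proof.
move=> iF; elim: r => [|j r IH].
  by rewrite big_nil; under eq_Rintegral do rewrite big_nil; rewrite Rintegral_cst// mul0r.
rewrite big_cons -IH -RintegralD//; first by apply: eq_Rintegral => x _; rewrite big_cons.
have := integrable_sum measurableT r (P := xpredT) (fun j _ => iF j).
by congr (leb.-integrable _ _); apply/funext => x; rewrite /= sumEFin.
Qed.

(** The Taylor expansion of eta is integrated against v, which yields a remainder of
    at most C |h|^2 times the integral of |v|. *)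
Lemma mollify_diff v eta x : leb.-integrable setT (EFin \o v) ->
  smooth eta -> bsupp eta ->
  differentiable (mollify v eta) x /\
  forall i, partial i (mollify v eta) x = - mollify v (partial i eta) x.
Proof.
move=> iv se be; have [C C0 eC] := smooth_taylor se be.
have iN : leb.-integrable setT (EFin \o (fun y => `|v y|)) by exact: integrable_norm.
pose D := \int[leb]_y `|v y|.
have D0 : 0 <= D by apply: Rintegral_ge0.
apply: (@differentiable_of_quadratic _ _ _ (C * (D + 1))).
  by rewrite mulr_gt0// ltr_wpDl.
move=> h.
have i0 z : leb.-integrable setT (EFin \o (fun y => v y * eta (y - z))).
  exact: mollify_integrable.
have ip i : leb.-integrable setT (EFin \o (fun y => h 0 i * (v y * partial i eta (y - x)))).
  have ii := mollify_integrable x iv (smooth_partial i se) (bsupp_partial i be).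
  exact: (integrableZl measurableT (h 0 i) ii).
have iB : leb.-integrable setT (EFin \o (fun y => v y * eta (y - (x + h)) - v y * eta (y - x))).
  exact: (integrableB measurableT (i0 _) (i0 _)).
have iS : leb.-integrable setT (EFin \o (fun y => \sum_i h 0 i * (v y * partial i eta (y - x)))).
  have := integrable_sum measurableT (index_enum 'I_d) (P := xpredT) (fun i _ => ip i).
  by congr (leb.-integrable _ _); apply/funext => y; rewrite /= sumEFin.
(* x enters eta (y - x) with a minus sign, so the increment of its argument is - h *)
pose q y := v y * (eta ((y - x) + - h) - eta (y - x) - \sum_i (- h) 0 i * partial i eta (y - x)).
have qE : q = fun y => (v y * eta (y - (x + h)) - v y * eta (y - x)) +
    \sum_i h 0 i * (v y * partial i eta (y - x)).
  apply/funext => y; rewrite /q mulrBr mulrBr opprD addrA; congr (_ + _).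
  rewrite mulr_sumr -sumrN; apply: eq_bigr => i _; rewrite mxE; ring.
have iq : leb.-integrable setT (EFin \o q).
  by rewrite qE; exact: (integrableD measurableT iB iS).
have -> : mollify v eta (x + h) - mollify v eta x - \sum_i h 0 i * - mollify v (partial i eta) x =
    \int[leb]_y q y.
  rewrite qE RintegralD// RintegralB//; congr (_ + _).
  rewrite Rintegral_sum// -sumrN; apply: eq_bigr => i _.
  rewrite RintegralZl//; first by rewrite mulrN opprK.
  by apply: mollify_integrable => //; [exact: smooth_partial|exact: bsupp_partial].
apply: le_trans (le_normr_Rintegral measurableT iq) _.
apply: (@le_trans _ _ (\int[leb]_y (C * `|h| ^+ 2 * `|v y|))).
  apply: le_Rintegral => //.
  - exact: integrable_norm.
  - exact: (integrableZl measurableT (C * `|h| ^+ 2) iN).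
  - move=> y _; rewrite /q normrM mulrC ler_wpM2r//.
    by have := eC (y - x) (- h); rewrite normrN.
rewrite RintegralZl// -/D mulrAC ler_wpM2r ?sqr_ge0//.
by rewrite mulrDr mulr1 lerDl ltW.
Qed.

Lemma smooth_mollify v eta : leb.-integrable setT (EFin \o v) ->
  smooth eta -> bsupp eta -> smooth (mollify v eta).
Proof.
move=> iv se be; apply/smoothP => k.
elim: k eta se be => [|k IH] eta se be; split=> //; try by move=> x; have [] := mollify_diff x iv se be.
move=> i; rewrite (_ : partial i _ = fun x => -1 * mollify v (partial i eta) x).
  apply: diff_classM; first exact: diff_class_cst.
  by apply: IH; [exact: smooth_partial|exact: bsupp_partial].
by apply/funext => x; rewrite mulN1r; have [_ ->] := mollify_diff x iv se be.
Qed.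

Lemma partial_mollify v eta i : leb.-integrable setT (EFin \o v) ->
  smooth eta -> bsupp eta ->
  partial i (mollify v eta) = fun x => - mollify v (partial i eta) x.
Proof.
by move=> iv se be; apply/funext => x; have [_ ->] := mollify_diff x iv se be.
Qed.

Lemma mollify_off v eta x (e : R) (A : set pt) : (forall y, ~ A y -> v y = 0) ->
  (forall z, e < `|z| -> eta z = 0) -> (forall y, A y -> e < `|y - x|) ->
  mollify v eta x = 0.
Proof.
move=> v0 e0 Ax; rewrite /mollify (_ : (fun y => _) = cst 0); first by rewrite Rintegral_cst// mul0r.
apply/funext => y; have [Ay|nA] := pselect (A y).
  by rewrite e0 ?mulr0//; exact: Ax.
by rewrite v0// mul0r.
Qed.

(** Jensen's inequality for the density u^2: the squared distance is at most the
    average over h, with weight u^2, of the squared distances from v to its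
    translates by h. *)
Lemma mollify_sqn_le v u (r e : R) : 0 <= e -> v \in L2 -> smooth u ->
  (forall x, r < `|x| -> u x = 0) -> L2dot leb u u = 1 ->
  (forall h, `|h| <= r -> L2sqn leb (fun x => v (x + h) - v x) <= e) ->
  measurable_fun setT (mollify v (fun z => u z * u z)) ->
  L2sqn leb (fun x => mollify v (fun z => u z * u z) x - v x) <= e.
Proof.
move=> e0 vL su u0 u1 vr mM.
have bu : bsupp u by exists r.
have uL : u \in L2 by apply: bsupp_L2 => //; exact: smooth_continuous.
have mv := Lfun2_measurable vL; have mu := smooth_measurable su.
have mphi : measurable_fun setT (fun z => u z * u z) by exact: measurable_funM.
have [C C0 uC] := bsupp_bounded (smooth_continuous su) bu.
have uint : (\int[leb]_z (u z * u z)%:E = 1)%E.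
  by rewrite -[LHS]fineK ?(integrable_fin_num _ (dot_integrable uL uL))//; congr EFin.
pose G (p : pt * pt) := ((v (p.2 + p.1) - v p.1) ^+ 2 * (u p.2 * u p.2))%:E.
have G0 p : (0 <= G p)%E by rewrite lee_fin mulr_ge0 ?sqr_ge0// -expr2 sqr_ge0.
have madd : measurable_fun setT (fun p : pt * pt => p.2 + p.1).
  apply: measurable_fun_rV => i.
  rewrite (_ : (fun _ => _) = fun p : pt * pt => p.2 0 i + p.1 0 i).
    by apply: measurable_funD; [apply: (measurableT_comp (measurable_coor i)); exact: measurable_snd|
      apply: (measurableT_comp (measurable_coor i)); exact: measurable_fst].
  by apply/funext => p; rewrite mxE.
have mG : measurable_fun setT G.
  apply/measurable_EFinP; apply: measurable_funM.
    apply: measurable_funX; apply: measurable_funB; first exact: (measurableT_comp mv).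
    by apply: (measurableT_comp mv); exact: measurable_fst.
  by apply: measurable_funM; apply: (measurableT_comp mu); exact: measurable_snd.
(* as u has norm one, the difference at x is the pairing of u with
   z |-> (v (z + x) - v x) * u z *)
have point x : (((mollify v (fun z => u z * u z) x - v x) ^+ 2)%:E <= \int[leb]_z G (x, z))%E.
  pose a z := (v (z + x) - v x) * u z.
  have aL : a \in L2.
    rewrite (_ : a = fun z => u z * v (z + x) - v x * u z).
      apply: Lfun2B; last exact: Lfun2Z.
      by apply: Lfun2M_bounded uC => //; exact: Lfun2_shift.
    by apply/funext => z; rewrite /a mulrBl mulrC.
  have -> : mollify v (fun z => u z * u z) x - v x = L2dot leb a u.
    have i1 := dot_integrable uL uL.
    have i2 : leb.-integrable setT (EFin \o (fun z => v (z + x) * (u z * u z))).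
      have := dot_integrable (Lfun2M_bounded (Lfun2_shift x vL) mu uC) uL.
      by congr (leb.-integrable _ _); apply/funext => z /=; congr EFin; ring.
    rewrite mollifyE// -[v x]mulr1 -u1 /L2dot -RintegralZl// -RintegralB//.
      by apply: eq_Rintegral => z _; rewrite /a; ring.
    exact: (integrableZl measurableT (v x) i1).
  have := dot_CauchySchwarz aL uL; rewrite u1 mulr1 -lee_fin => /le_trans; apply.
  rewrite /L2dot /Rintegral fineK; last exact: (integrable_fin_num _ (dot_integrable aL aL)).
  rewrite le_eqVlt; apply/orP; left; apply/eqP; apply: eq_integral => z _.
  by rewrite /G /a /=; congr EFin; ring.
rewrite -lee_fin /L2sqn /L2dot /Rintegral.
have : (\int[leb]_x ((mollify v (fun z => u z * u z) x - v x) ^+ 2)%:E <= e%:E)%E.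
  apply: (@le_trans _ _ (\int[leb]_x \int[leb]_z G (x, z))%E).
    apply: ge0_le_integral => //.
    - by move=> x _; rewrite lee_fin sqr_ge0.
    - by apply/measurable_EFinP; apply: measurable_funX; exact: measurable_funB.
    - exact: (@measurable_fun_fubini_tonelli_F _ _ _ _ R leb G).
  rewrite (@fubini_tonelli _ _ _ _ R leb leb G)//.
  apply: (@le_trans _ _ (\int[leb]_z (e * (u z * u z))%:E)%E).
    apply: ge0_le_integral => //.
    - by move=> z _; exact: integral_ge0.
    - exact: (@measurable_fun_fubini_tonelli_G _ _ _ _ R leb G).
    - by apply/measurable_EFinP; apply: measurable_funM.
    move=> z _; rewrite /fubini_G /=.
    have [zr|zr] := leP `|z| r; last first.
      rewrite u0// mulr0 mulr0 (_ : (fun x => _) = cst 0%E) ?integral0//.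
      by apply/funext => x; rewrite /G /= u0// !mulr0.
    have vzL := Lfun2B (Lfun2_shift z vL) vL.
    have -> : (\int[leb]_x G (x, z) = (u z * u z)%:E *
        \int[leb]_x ((v (x + z) - v x) * (v (x + z) - v x))%:E)%E.
      rewrite -integralZl//; last exact: (dot_integrable vzL vzL).
      by apply: eq_integral => x _; rewrite /G /= -EFinM (addrC z); congr EFin; ring.
    rewrite -[X in (_ * X)%E]fineK; last exact: (integrable_fin_num _ (dot_integrable vzL vzL)).
    by rewrite -EFinM lee_fin mulrC ler_wpM2r -?expr2 ?sqr_ge0//; exact: vr.
  under eq_integral do rewrite EFinM.
  rewrite integralZl//; last exact: (dot_integrable uL uL).
  by rewrite uint mule1.
move=> le_e; rewrite fineK; first by under eq_integral do rewrite -expr2.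
rewrite ge0_fin_numE; last by apply: integral_ge0 => x _; rewrite lee_fin -expr2 sqr_ge0.
by apply: le_lt_trans (ltry e); under eq_integral do rewrite -expr2.
Qed.

End mollification.

(** * Lipschitz boundaries *)

Section lipschitz_boundaries.
Context (R : realType) (d : nat).
Local Notation pt := 'rV[R]_d.
Local Notation leb := (@lebesgue_rV R d).
Local Notation L2 := (Lfun leb 2%:E).
Implicit Types (A K : set pt) (a x y z h e : pt).

Lemma closure_near A z (s : R) : closure A z -> 0 < s -> exists2 y, A y & `|y - z| < s.
Proof.
move=> cz s0; have [y [Ay]] := cz _ (nbhsx_ballx z s s0).
by rewrite -ball_normE /= distrC => ys; exists y.
Qed.

(** The constant c makes the inward direction e robust: points at distance c t
    from the set are still pushed inside by a translation of length t. *)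
Definition pushes_inside A (B : set pt) e (c t0 : R) :=
  forall (t : R) y z, 0 < t <= t0 -> B y -> closure A z -> `|y - z| <= c * t ->
    A (y - t *: e).

(** Near a boundary point, subtracting t e lowers the height over the graph by t
    in the rotated coordinates, whereas a displacement of length s raises it by at
    most a multiple of s. *)
Lemma inward_direction A a : open A -> lipschitz_boundary A -> closure A a ->
  exists e (r c t0 : R), [/\ 0 < r, 0 < c, 0 < t0 &
    pushes_inside A [set y | `|y - a| <= r] e c t0].
Proof.
move=> /open_rVP oA lip ca; have [Aa|nAa] := pselect (A a).
  (* an interior point has a neighborhood that lies in A without any translation *)
  have [r r0 rA] := oA a Aa.
  exists 0, (r / 2), 1, 1; split=> //; first by rewrite divr_gt0.
  move=> t y z _ /= ya _ _; rewrite scaler0 subr0; apply: rA.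
  by rewrite (le_lt_trans ya)// ltr_pdivrMr// ltr_pMr// ltr1n.
have [U [Q [k [g [L [[oU Ua] QQ Lg AU]]]]]] := lip a ca nAa.
have [dl dl0 dU] := (open_rVP U).1 oU a Ua.
pose C : R := \sum_i \sum_j `|Q i j|.
have C0 : 0 <= C by apply: sumr_ge0 => i _; apply: sumr_ge0.
have hQ h j : `|(h *m Q) 0 j| <= C * `|h|.
  rewrite mxE; apply: le_trans (ler_norm_sum _ _ _) _; rewrite /C mulr_suml.
  apply: ler_sum => i _; rewrite normrM mulrC ler_pM//; last exact: rV_coord_le.
  by rewrite (bigD1 j)//= lerDl sumr_ge0.
(* the height over the graph; inside U, the set A is given by F < 0 *)
pose F x := (x *m Q) 0 k - g (col' k (x *m Q)).
pose K := C * (1 + `|L|) + 1.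
have K0 : 0 < K by rewrite ltr_wpDl// mulr_ge0// addr_ge0.
have FK x y : F x <= F y + K * `|x - y|.
  have := hQ (x - y) k; rewrite mulmxBl !mxE => h1.
  have h2 : `|g (col' k (x *m Q)) - g (col' k (y *m Q))| <= `|L| * (C * `|x - y|).
    have := Lg (col' k (x *m Q), col' k (y *m Q)) (conj I I); move=> /le_trans; apply => /=.
    apply: (@le_trans _ _ (`|L| * `|col' k (x *m Q) - col' k (y *m Q)|)).
      by rewrite ler_wpM2r// ler_norm.
    rewrite ler_wpM2l//; apply/rV_norm_leP; first by rewrite mulr_ge0.
    by move=> j; have := hQ (x - y) (lift k j); rewrite mulmxBl !mxE.
  move: h1 h2; rewrite !ler_norml /K /F => /andP[_ h1] /andP[h2 _].
  have := normr_ge0 (x - y); rewrite !mxE; lra.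
have ek : exists e, e *m Q = 'e_k.
  by exists ('e_k *m Q^T); rewrite -mulmxA (mulmx1C QQ) mulmx1.
case: ek => e eQ.
have Fe t y : F (y - t *: e) = F y - t.
  rewrite /F mulmxBl -scalemxAl eQ !mxE !eqxx mulr1.
  rewrite (_ : col' k (y *m Q - t *: 'e_k) = col' k (y *m Q)); first by rewrite addrAC.
  apply/rowP => j; rewrite !mxE eqxx/= [lift k j == k]eq_sym (negbTE (neq_lift k j)).
  by rewrite mulr0 subr0.
have Fz z : closure A z -> U z -> F z <= 0.
  move=> cz Uz; rewrite leNgt; apply/negP => Fz0.
  have [s s0 sU] := (open_rVP U).1 oU z Uz.
  have m0 : 0 < Num.min s (F z / K) by rewrite lt_min s0 divr_gt0.
  have [y Ay ym] := closure_near cz m0.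
  have [ys yF] : `|y - z| < s /\ `|y - z| < F z / K.
    by move: ym; rewrite lt_min => /andP[].
  have := (AU y (sU y ys)).1 Ay; rewrite -subr_lt0 -/(F y) => Fy.
  have := FK z y; rewrite distrC => Fzy; move: yF; rewrite ltr_pdivlMr// => yF.
  by suff : F z < F z; [rewrite ltxx|lra].
(* a displacement of length c t raises F by at most K c t = t / 2, which is half
   of what the translation gains *)
pose c := (2 * K)^-1.
have c0 : 0 < c by rewrite invr_gt0 mulr_gt0.
pose t0 := dl / (4 * (c + `|e| + 1)).
have ce0 : 0 < c + `|e| + 1 by rewrite ltr_wpDl// addr_ge0// ltW.
have t00 : 0 < t0 by rewrite divr_gt0// mulr_gt0.
have t0c : t0 * (c + `|e| + 1) = dl / 4 by rewrite /t0; field; rewrite gt_eqF.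
exists e, (dl / 4), c, t0; split=> //; first by rewrite divr_gt0.
move=> t y z /andP[tp tt0] /= ya cz yz.
have bt : t * (c + `|e| + 1) <= dl / 4 by rewrite -t0c ler_wpM2r// ltW.
have tc := mulr_ge0 (ltW tp) (ltW c0); have te := mulr_ge0 (ltW tp) (normr_ge0 e).
have Uz : U z.
  apply: dU; have := ler_distD y z a; rewrite (distrC z y) => /le_lt_trans; apply.
  by move: bt; rewrite !mulrDr; lra.
have Uy : U (y - t *: e).
  apply: dU; rewrite addrAC; apply: le_lt_trans (ler_normB _ _) _.
  by rewrite normrZ gtr0_norm//; move: bt; rewrite !mulrDr; lra.
apply/(AU _ Uy); rewrite -subr_lt0 -/(F _) Fe.
have := FK y z; have := Fz z cz Uz.
have : K * `|y - z| <= t / 2.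
  apply: (@le_trans _ _ (K * (c * t))); first by rewrite ler_wpM2l// ltW.
  by rewrite /c le_eqVlt; apply/orP; left; apply/eqP; field; rewrite gt_eqF.
lra.
Qed.

Lemma finite_ball_cover K (P : pt -> R -> Prop) : compact K ->
  (forall a, K a -> exists2 s : R, 0 < s & P a s) ->
  exists s : seq (pt * R), (forall p, p \in s -> P p.1 p.2) /\
    forall x, K x -> exists2 p, p \in s & `|x - p.1| < p.2.
Proof.
move=> cK KP.
have /choice[s sP] a : exists s : R, 0 < s /\ (K a -> P a s).
  have [/KP[s s0 Ps]|nKa] := pselect (K a); first by exists s.
  by exists 1.
have : cover_compact K by rewrite -compact_cover.
move=> /(_ pt K (fun a => [set x | `|x - a| < s a])) [].
- move=> a _; apply/open_rVP => x /= xa; exists (s a - `|x - a|); first by rewrite subr_gt0.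
  move=> y yx; have := ler_distD x y a; move: yx; lra.
- by move=> a Ka; exists a => //=; rewrite subrr normr0; exact: (sP a).1.
move=> D DK Dc; exists [seq (a, s a) | a <- finmap.enum_fset D]; split.
  move=> p /mapP[a aD ->] /=; apply: (sP a).2.
  by have := DK a aD; rewrite inE.
by move=> x /Dc[a /= aD xa]; exists (a, s a) => //; apply/mapP; exists a.
Qed.

Lemma negligible_seq (J : eqType) (r : seq J) (F : J -> set pt) :
  (forall j, j \in r -> leb.-negligible (F j)) ->
  leb.-negligible [set x | exists2 j, j \in r & F j x].
Proof.
elim: r => [|j r IH] rF.
  by apply: negligibleS (negligible_set0 _) => x [].
have h1 := rF j (mem_head _ _).
have h2 : leb.-negligible [set x | exists2 j, j \in r & F j x].
  by apply: IH => i ir; apply: rF; rewrite in_cons ir orbT.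
apply: negligibleS (negligibleU h1 h2) => x [i]; rewrite in_cons => /predU1P[->|ir] Fx.
  by left.
by right; exists i.
Qed.

(** A translation in an inward direction moves a boundary piece off itself, so
    its indicator function stays at a fixed distance from its translates unless
    it vanishes almost everywhere. *)
Lemma boundary_null A : bounded_set A -> open A -> lipschitz_boundary A ->
  leb (closure A `\` A) = 0%E.
Proof.
move=> bA oA lip.
have mcA : measurable (closure A) by apply: measurable_closed; exact: closed_closure.
have mA := measurable_open oA.
pose piece a (r : R) := (closure A `\` A) `&` [set y | `|y - a| <= r].
have mpiece a r : measurable (piece a r).
  apply: measurableI; first exact: measurableD.
  have := measurable_shift (- a) measurableT (measurable_cball (d := d) r).
  by rewrite setTI.
have null a : closure A a -> exists2 r : R, 0 < r & leb (piece a r) = 0%E.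
  move=> ca; have [e [r [c [t0 [r0 c0 t00 push]]]]] := inward_direction oA lip ca.
  exists r => //; set S := piece a r.
  have finS : (leb S < +oo)%E.
    apply: (@le_lt_trans _ _ (leb (closure A))).
      by apply: le_measure; rewrite ?inE//; [exact: mpiece|move=> x [[]]].
    by apply: bounded_lebesgue_fin => //; exact: bounded_closure.
  have SL := Lfun2_indic (mpiece a r) finS.
  (* if x + t e is a boundary point, then x lies in the open set A *)
  have disj t x : 0 < t <= t0 -> \1_S (x + t *: e) * \1_S x = 0 :> R.
    move=> t0t; rewrite !indicE.
    have [xS|] := boolP (x \in S); last by rewrite mulr0.
    have [yS|] := boolP (x + t *: e \in S); last by rewrite mul0r.
    move: xS yS => /set_mem[[_ nAx] _] /set_mem[[cy _] ya].
    case: nAx; rewrite -[x](addrK (t *: e)).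
    apply: (push t _ _ t0t ya cy).
    by rewrite subrr normr0 mulr_ge0 ?ltW//; case/andP: t0t.
  have sqS : L2sqn leb (\1_S) = fine (leb S).
    rewrite /L2sqn /L2dot (_ : (fun x => _) = \1_S); last first.
      by apply/funext => x; rewrite indicE; case: (_ \in _); rewrite ?mulr1 ?mulr0.
    by rewrite /Rintegral integral_indic ?setIT//; exact: mpiece.
  suff s0 : fine (leb S) <= 0.
    have f0 : 0 <= fine (leb S) by exact: fine_ge0.
    rewrite -[LHS]fineK ?ge0_fin_numE//; congr EFin; lra.
  rewrite -sqS; apply/ler_addgt0Pl => q q0; rewrite addr0.
  have [rho rho0 tr] := translation_continuous SL q0.
  pose t := Num.min t0 (rho / (`|e| + 1)).
  have e1 : 0 < `|e| + 1 by rewrite ltr_wpDl.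
  have tp : 0 < t by rewrite lt_min t00 divr_gt0.
  have tt0 : 0 < t <= t0 by rewrite tp ge_min lexx.
  have /tr : `|t *: e| <= rho.
    rewrite normrZ gtr0_norm//; apply: (@le_trans _ _ (rho / (`|e| + 1) * `|e|)).
      by rewrite ler_wpM2r// ge_min lexx orbT.
    by rewrite mulrAC ler_pdivrMr// ler_wpM2l ?(ltW rho0)// lerDl.
  have shL := Lfun2_shift (t *: e) SL.
  (* by disjointness the squared distance is twice the squared norm *)
  rewrite {1}/L2sqn (dot_sqB shL SL) dot_shift//.
  have -> : L2dot leb (fun x => \1_S (x + t *: e)) \1_S = 0.
    rewrite /L2dot (_ : (fun x => _) = cst 0); first by rewrite Rintegral_cst// mul0r.
    by apply/funext => x; exact: disj.
  have := dot_ge0 leb (\1_S : pt -> R); rewrite /L2sqn; lra.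
have cB : compact (closure A `\` A).
  apply: bounded_closed_compact.
    have [M M0 AM] := bounded_setP (bounded_closure bA).
    exists M; split; first exact: num_real.
    by move=> N MN x [/AM xM _]; apply: ltW; exact: lt_trans MN.
  by apply: closedI; [exact: closed_closure|exact: open_closedC].
have [s [sP sc]] := @finite_ball_cover _ (fun a r => leb (piece a r) = 0%E) cB
  (fun a (h : (closure A `\` A) a) => null a h.1).
apply/(negligibleP _ (measurableD mcA mA)).
apply: (@negligibleS _ _ _ _ [set x | exists2 p, p \in s & piece p.1 p.2 x]).
  by move=> x xB; have [p ps xp] := sc x xB; exists p => //; split=> //; exact: ltW.
by apply: negligible_seq => p ps; apply/(negligibleP _ (mpiece _ _)); exact: sP.
Qed.

End lipschitz_boundaries.

(** * Second derivatives *)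

Opaque partial.

Section second_derivatives.
Context (R : realType) (d : nat).
Local Notation pt := 'rV[R]_d.
Local Notation leb := (@lebesgue_rV R d).
Local Notation L2 := (Lfun leb 2%:E).
Implicit Types (f g phi : pt -> R) (i j : 'I_d).

Definition hess_entry i j f x : R :=
  2^-1 * (partial j (partial i f) x + partial i (partial j f) x).

Lemma continuous_addr (w : pt) : continuous (fun y : pt => y + w).
Proof. by move=> y; exact: differentiable_continuous. Qed.

Lemma symgrad_grad f x i j : symgrad (grad f) x i j = hess_entry i j f x.
Proof.
rewrite /symgrad mxE /hess_entry; congr (_ * (_ + _)); congr (partial _ _ x).
  by apply/funext => y; rewrite mxE.
by apply/funext => y; rewrite mxE.
Qed.

Lemma smooth_hess_entry i j f : smooth f -> smooth (hess_entry i j f).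
Proof.
move=> sf; apply: smoothZ; apply: smoothD; apply: smooth_partial; exact: smooth_partial.
Qed.

Lemma bsupp_hess_entry i j f : bsupp f -> bsupp (hess_entry i j f).
Proof.
move=> bf; apply: bsuppMr; apply: bsuppD; apply: bsupp_partial; exact: bsupp_partial.
Qed.

Lemma smooth_bsupp_L2 f : smooth f -> bsupp f -> f \in L2.
Proof. by move=> sf bf; apply: bsupp_L2 => //; exact: smooth_continuous. Qed.

Lemma hess_entry_L2 i j f : smooth f -> bsupp f -> hess_entry i j f \in L2.
Proof.
by move=> sf bf; apply: smooth_bsupp_L2; [exact: smooth_hess_entry|exact: bsupp_hess_entry].
Qed.

Lemma hess_entry_shift i j f h :
  hess_entry i j (fun x => f (x + h)) = fun x => hess_entry i j f (x + h).
Proof. by apply/funext => x; rewrite /hess_entry !partial_shift. Qed.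

Lemma hess_entryD i j f g : smooth f -> smooth g ->
  hess_entry i j (fun x => f x + g x) = fun x => hess_entry i j f x + hess_entry i j g x.
Proof.
move=> sf sg; have df k x := smooth_differentiable x (smooth_partial k sf).
have dg k x := smooth_differentiable x (smooth_partial k sg).
have d0 x := smooth_differentiable x sf; have e0 x := smooth_differentiable x sg.
apply/funext => x; rewrite /hess_entry !(partialD _ d0 e0).
rewrite (partialD _ (df _) (dg _)) (partialD _ (df _) (dg _)) -mulrDr.
move: (partial j (partial i f) x) (partial i (partial j f) x) => f1 f2.
by move: (partial j (partial i g) x) (partial i (partial j g) x) => g1 g2; rewrite addrACA.
Qed.

Lemma hess_entryM i j f g : smooth f -> smooth g ->
  hess_entry i j (fun x => f x * g x) = fun x =>
    (f x * hess_entry i j g x + hess_entry i j f x * g x) +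
    (partial i f x * partial j g x + partial j f x * partial i g x).
Proof.
move=> sf sg; have df k x := smooth_differentiable x (smooth_partial k sf).
have dg k x := smooth_differentiable x (smooth_partial k sg).
have d0 x := smooth_differentiable x sf; have e0 x := smooth_differentiable x sg.
have sp k : smooth (fun x => partial k f x * g x) by apply: smoothM => //; exact: smooth_partial.
have sq k : smooth (fun x => f x * partial k g x) by apply: smoothM => //; exact: smooth_partial.
apply/funext => x; rewrite /hess_entry !(partialM _ d0 e0).
rewrite !partialD; try by move=> y; exact: smooth_differentiable.
rewrite (partialM _ (df i) e0) (partialM _ (df j) e0) (partialM _ d0 (dg i)) (partialM _ d0 (dg j)).
move: (partial j (partial i f) x) (partial i (partial j f) x) => f1 f2.
move: (partial j (partial i g) x) (partial i (partial j g) x) => g1 g2.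
by move: (partial i f x) (partial j f x) (partial i g x) (partial j g x) => a b c e; field.
Qed.

Lemma hess_entry_local i j f g (U : set pt) : open U -> (forall x, U x -> f x = g x) ->
  forall x, U x -> hess_entry i j f x = hess_entry i j g x.
Proof.
move=> oU fg x Ux; rewrite /hess_entry.
have p k y (Uy : U y) := partial_local k oU fg Uy.
by rewrite (partial_local j oU (p i) Ux) (partial_local i oU (p j) Ux).
Qed.

Lemma hess_entry_off i j f (K : set pt) : closed K -> (forall x, ~ K x -> f x = 0) ->
  forall x, ~ K x -> hess_entry i j f x = 0.
Proof.
move=> cK f0 x nK; have p k := partial_off k cK f0.
by rewrite /hess_entry (partial_off j cK (p i) nK) (partial_off i cK (p j) nK) addr0 mulr0.
Qed.

End second_derivatives.

(** * Pairs that are biorthogonal to the second derivatives *)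

Section biorthogonal.
Context (R : realType) (d : nat).
Local Notation pt := 'rV[R]_d.
Local Notation leb := (@lebesgue_rV R d).
Local Notation L2 := (Lfun leb 2%:E).
Local Notation dot := (L2dot leb).
Local Notation sqn := (L2sqn leb).
Implicit Types (f g phi chi psi u : pt -> R) (i j : 'I_d) (x y z e : pt).

Definition is_moll (rho : R) u :=
  [/\ smooth u, (forall x, rho < `|x| -> u x = 0) & dot u u = 1].

Definition smoothing f u : pt -> R := mollify f (fun z => u z * u z).

(** The conditions on the radius accumulate along the argument; they are combined in
    the manner of a filter, without naming the radii. *)
Definition small_moll (Q : (pt -> R) -> Prop) :=
  exists2 rho : R, 0 < rho & forall u, is_moll rho u -> Q u.

Lemma is_mollW (rho rho' : R) u : rho <= rho' -> is_moll rho u -> is_moll rho' u.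
Proof. by move=> h [su u0 u1]; split=> // x /(le_lt_trans h); exact: u0. Qed.

Lemma small_moll_and Q Q' : small_moll Q -> small_moll Q' -> small_moll (fun u => Q u /\ Q' u).
Proof.
move=> [r r0 rQ] [r' r0' rQ']; exists (Num.min r r'); first by rewrite lt_min r0.
move=> u um; split; [apply: rQ|apply: rQ']; apply: is_mollW um; by rewrite ge_min lexx ?orbT.
Qed.

Lemma small_moll_sub (Q Q' : (pt -> R) -> Prop) :
  (forall u, Q u -> Q' u) -> small_moll Q -> small_moll Q'.
Proof. by move=> QQ' [r r0 rQ]; exists r => // u /rQ/QQ'. Qed.

Lemma small_moll_true (Q : (pt -> R) -> Prop) : (forall u, Q u) -> small_moll Q.
Proof. by move=> h; exists 1. Qed.

Lemma small_moll_fin (J : finType) (Q : J -> (pt -> R) -> Prop) :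
  (forall k : J, small_moll (Q k)) -> small_moll (fun u => forall k : J, Q k u).
Proof.
move=> QJ; suff : small_moll (fun u => forall k : J, k \in enum J -> Q k u).
  by apply: small_moll_sub => u h k; apply: h; rewrite mem_enum.
elim: (enum J) => [|k0 s IH]; first exact: small_moll_true.
apply: small_moll_sub (small_moll_and (QJ k0) IH) => u [h1 h2] k.
by rewrite in_cons => /predU1P[->//|]; exact: h2.
Qed.

Lemma smooth_weight (rho : R) u : is_moll rho u ->
  smooth (fun z => u z * u z) /\ bsupp (fun z => u z * u z).
Proof. by move=> [su u0 _]; split; [exact: smoothM|apply: bsuppMl; exists rho]. Qed.

Lemma smoothing_close f (dl : R) : f \in L2 -> leb.-integrable setT (EFin \o f) -> 0 < dl ->
  small_moll (fun u => sqn (fun x => smoothing f u x - f x) <= dl).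
Proof.
move=> fL fi dl0; have [r r0 rf] := translation_continuous fL dl0.
exists r => // u um; have [su u0 u1] := um; have [sw bw] := smooth_weight um.
apply: (mollify_sqn_le (ltW dl0) fL su u0 u1).
  by move=> h /rf/ltW.
by apply: smooth_measurable; exact: smooth_mollify.
Qed.

Lemma sqn_sub_le f g : f \in L2 -> (fun x => g x - f x) \in L2 ->
  sqn g <= 2 * sqn (fun x => g x - f x) + 2 * sqn f.
Proof.
move=> fL gfL; have := dot_sqD_le gfL fL.
by rewrite /sqn; under [in X in X -> _]eq_fun do rewrite subrK.
Qed.

Lemma sqnM_le (K : R) f g : g \in L2 -> measurable_fun setT f -> (forall x, `|f x| <= K) ->
  sqn (fun x => f x * g x) <= K ^+ 2 * sqn g.
Proof.
move=> gL mf fK; have KgL := Lfun2Z K gL.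
apply: (@le_trans _ _ (sqn (fun x => K * g x))).
  apply: dot_le => //.
    by apply: measurable_funM => //; exact: Lfun2_measurable gL.
  by move=> x; rewrite !normrM ler_wpM2r// (le_trans (fK x))// ler_norm.
by rewrite /sqn dotZl// dotC dotZl// mulrA expr2.
Qed.

Context (Omega : set pt) (v : pt -> R) (E : 'I_d -> 'I_d -> pt -> R).
Hypothesis openOmega : open Omega.
Hypothesis bndOmega : bounded_set Omega.
Hypothesis lipOmega : lipschitz_boundary Omega.
Hypothesis vL : v \in L2.
Hypothesis EL : forall i j, E i j \in L2.
Hypothesis v_off : forall x, ~ Omega x -> v x = 0.
Hypothesis E_off : forall i j x, ~ Omega x -> E i j x = 0.
Hypothesis vE : forall phi, test_fun Omega phi ->
  dot v phi = \sum_i \sum_j dot (E i j) (hess_entry i j phi).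
Hypothesis Ev : forall i j theta, smooth theta -> bsupp theta ->
  dot (E i j) theta = - dot v (hess_entry i j theta).

Lemma off_integrable f : f \in L2 -> (forall x, ~ Omega x -> f x = 0) ->
  leb.-integrable setT (EFin \o f).
Proof.
move=> fL f0; have mO := measurable_open openOmega.
have := dot_integrable fL (Lfun2_indic mO (bounded_lebesgue_fin bndOmega mO)).
congr (leb.-integrable _ _); apply/funext => x /=; congr EFin.
rewrite indicE; have [Ox|nO] := pselect (Omega x); first by rewrite mem_set// mulr1.
by rewrite f0// mul0r.
Qed.

Let vi := off_integrable vL v_off.
Let Ei i j := off_integrable (EL i j) (@E_off i j).

Lemma smoothing_smooth (rho : R) u : is_moll rho u -> smooth (smoothing v u).
Proof. by move=> um; have [sw bw] := smooth_weight um; exact: smooth_mollify. Qed.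

Lemma smoothing_near (rho : R) u x : is_moll rho u -> smoothing v u x <> 0 ->
  exists2 z, Omega z & `|z - x| <= rho.
Proof.
move=> [su u0 u1] wx; apply: contrapT => nz; apply: wx.
apply: (@mollify_off _ _ v _ x rho Omega) => //.
  by move=> z /u0 ->; rewrite mul0r.
by move=> y Oy; rewrite ltNge; apply/negP => yx; apply: nz; exists y.
Qed.

Lemma smoothing_bsupp (rho : R) u : is_moll rho u -> bsupp (smoothing v u).
Proof.
move=> um; have [M M0 OM] := bounded_setP bndOmega; exists (M + rho) => x xM.
apply: contrapT => /(smoothing_near um)[z /OM zM zx].
have := ler_distD z 0 x; rewrite !sub0r !normrN => h.
have := lt_le_trans xM h; lra.
Qed.

(** The mollifier centered at x is an admissible theta in the relation Ev, which
    holds on the whole space and not only for test functions on Omega. *)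
Lemma hess_smoothing (rho : R) u i j : is_moll rho u ->
  hess_entry i j (smoothing v u) = fun x => - smoothing (E i j) u x.
Proof.
move=> um; pose eta z := u z * u z.
have [sw bw] : smooth eta /\ bsupp eta by exact: smooth_weight um.
have sp k := smooth_partial k sw; have bp k := bsupp_partial k bw.
have two k l : partial k (partial l (mollify v eta)) = mollify v (partial k (partial l eta)).
  rewrite (partial_mollify l vi sw bw) partialN; last first.
    by move=> x; apply: smooth_differentiable; exact: smooth_mollify.
  by rewrite (partial_mollify k vi (sp l) (bp l)); apply/funext => x; rewrite opprK.
apply/funext => x; rewrite /hess_entry /smoothing (two j i) (two i j).
have := Ev i j (smooth_shift (- x) sw) (bsupp_shift (- x) bw).
rewrite hess_entry_shift => h.
rewrite -[mollify (E i j) eta x]/(dot (E i j) (fun y => eta (y + - x))) h opprK.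
rewrite /dot /mollify /hess_entry -RintegralD//; last 2 first.
- by apply: mollify_integrable => //; [exact: smooth_partial|exact: bsupp_partial].
- by apply: mollify_integrable => //; [exact: smooth_partial|exact: bsupp_partial].
rewrite -RintegralZl//; first by apply: eq_Rintegral => y _; rewrite -mulrDr mulrCA.
have i1 := mollify_integrable x vi (smooth_partial j (sp i)) (bsupp_partial j (bp i)).
have i2 := mollify_integrable x vi (smooth_partial i (sp j)) (bsupp_partial i (bp j)).
exact: (integrableD measurableT i1 i2).
Qed.

(** The mollifications stay close to v and E, which bounds the function and its second
    derivatives. The first derivatives are controlled by interpolation, as their
    squared norm is minus the pairing of the function with its pure second
    derivatives. *)
Lemma smoothing_bounds : exists2 C : R, 0 < C & small_moll (fun u =>
  [/\ sqn (smoothing v u) <= C,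
      forall i j, sqn (hess_entry i j (smoothing v u)) <= C &
      forall j, sqn (partial j (smoothing v u)) <= C]).
Proof.
pose C := 2 + 2 * sqn v + \sum_i \sum_j 2 * sqn (E i j).
have S0 : 0 <= \sum_i \sum_j 2 * sqn (E i j).
  by apply: sumr_ge0 => i _; apply: sumr_ge0 => j _; rewrite mulr_ge0 ?dot_ge0.
have v0 : 0 <= sqn v by exact: dot_ge0.
exists C; first by rewrite /C; lra.
have h1 := smoothing_close vL vi ltr01.
have h2 : small_moll (fun u => forall ij : 'I_d * 'I_d,
    sqn (fun x => smoothing (E ij.1 ij.2) u x - E ij.1 ij.2 x) <= 1).
  by apply: small_moll_fin => -[i j] /=; exact: smoothing_close.
have [rho rho0 h] := small_moll_and h1 h2.
exists rho => // u um; have [hv hE] := h u um.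
have sw := smoothing_smooth um; have bw := smoothing_bsupp um.
have wL := smooth_bsupp_L2 sw bw.
have b1 : sqn (smoothing v u) <= C.
  by apply: le_trans (sqn_sub_le vL (Lfun2B wL vL)) _; rewrite /C; lra.
have b2 i j : sqn (hess_entry i j (smoothing v u)) <= C.
  have hL := hess_entry_L2 i j sw bw; rewrite (hess_smoothing i j um) in hL *.
  have sL : smoothing (E i j) u \in L2.
    by have := Lfun2N hL; under eq_fun do rewrite opprK.
  rewrite /sqn dotNl// dotC dotNl// opprK.
  apply: le_trans (sqn_sub_le (EL i j) (Lfun2B sL (EL i j))) _.
  have := hE (i, j); rewrite /= => hij.
  have : 2 * sqn (E i j) <= \sum_i \sum_j 2 * sqn (E i j).
    rewrite (bigD1 i)//= (bigD1 j)//= -addrA lerDl addr_ge0// sumr_ge0// => k _.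
      by rewrite mulr_ge0 ?dot_ge0.
    by apply: sumr_ge0 => l _; rewrite mulr_ge0 ?dot_ge0.
  by rewrite /C; lra.
split=> // j.
have sp := smooth_partial j sw; have bp := bsupp_partial j bw.
have -> : sqn (partial j (smoothing v u)) =
    - dot (smoothing v u) (hess_entry j j (smoothing v u)).
  have ibp := integral_by_parts j sw sp bp.
  rewrite [LHS]ibp; congr (- _).
  apply: eq_Rintegral => x _; rewrite /hess_entry.
  by move: (partial j (partial j (smoothing v u)) x) => p; field.
apply: le_trans (ler_norm _) _; rewrite normrN.
apply: le_trans (dot_le_norm wL (hess_entry_L2 j j sw bw)) _.
have C0 : 0 <= C by rewrite /C; lra.
rewrite -[leRHS](sqr_sqrtr C0) expr2; apply: ler_pM; rewrite ?sqrtr_ge0// ler_sqrt//.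
  exact: b2.
Qed.

Lemma sqn_bound4 (K : R) f1 f2 f3 f4 : sqn f1 <= K -> sqn f2 <= K -> sqn f3 <= K ->
  sqn f4 <= K -> f1 \in L2 -> f2 \in L2 -> f3 \in L2 -> f4 \in L2 ->
  sqn (fun x => (f1 x + f2 x) + (f3 x + f4 x)) <= 16 * K.
Proof.
move=> h1 h2 h3 h4 l1 l2 l3 l4.
apply: le_trans (dot_sqD_le (Lfun2D l1 l2) (Lfun2D l3 l4)) _.
have := dot_sqD_le l1 l2; have := dot_sqD_le l3 l4.
move: h1 h2 h3 h4; rewrite /L2sqn; lra.
Qed.

(** The second derivatives of the product involve the first derivatives of both
    factors, hence the need for the bounds of the gradient. *)
Lemma localized_bounds chi : smooth chi -> bsupp chi -> exists2 C : R, 0 < C &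
  small_moll (fun u => sqn (fun x => chi x * smoothing v u x) <= C /\
    forall i j, sqn (hess_entry i j (fun x => chi x * smoothing v u x)) <= C).
Proof.
move=> sc bc; have [C C0 hC] := smoothing_bounds.
have bounded f : smooth f -> bsupp f -> exists K : R, forall x, `|f x| <= K.
  by move=> sf bf; have [K _ fK] := bsupp_bounded (smooth_continuous sf) bf; exists K.
have [K0 hK0] := bounded _ sc bc.
have /choice[K1 hK1] i := bounded _ (smooth_partial i sc) (bsupp_partial i bc).
have /choice[K2 hK2] (ij : 'I_d * 'I_d) :=
  bounded _ (smooth_hess_entry ij.1 ij.2 sc) (bsupp_hess_entry ij.1 ij.2 bc).
pose K := 1 + K0 ^+ 2 + \sum_i K1 i ^+ 2 + \sum_ij K2 ij ^+ 2.
have K1s : 0 <= \sum_i K1 i ^+ 2 by apply: sumr_ge0 => i _; exact: sqr_ge0.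
have K2s : 0 <= \sum_ij K2 ij ^+ 2 by apply: sumr_ge0 => ij _; exact: sqr_ge0.
have K0s := sqr_ge0 K0.
have K0K : K0 ^+ 2 <= K by rewrite /K; lra.
have K1K i : K1 i ^+ 2 <= K.
  have : K1 i ^+ 2 <= \sum_i K1 i ^+ 2.
    by rewrite (bigD1 i)//= lerDl sumr_ge0// => k _; exact: sqr_ge0.
  by rewrite /K; lra.
have K2K ij : K2 ij ^+ 2 <= K.
  have : K2 ij ^+ 2 <= \sum_ij K2 ij ^+ 2.
    by rewrite (bigD1 ij)//= lerDl sumr_ge0// => k _; exact: sqr_ge0.
  by rewrite /K; lra.
have Kp : 0 < K by rewrite /K; lra.
have KC : 0 < K * C by rewrite mulr_gt0.
exists (16 * (K * C)); first by rewrite mulr_gt0.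
have [rho rho0 h] := hC; exists rho => // u um; have [h0 h2 h1] := h u um.
have sw := smoothing_smooth um; have bw := smoothing_bsupp um.
have wL := smooth_bsupp_L2 sw bw.
have pL i := smooth_bsupp_L2 (smooth_partial i sw) (bsupp_partial i bw).
have hL i j := hess_entry_L2 i j sw bw.
have prod (k : R) f g : smooth f -> (forall x, `|f x| <= k) -> k ^+ 2 <= K -> g \in L2 ->
    sqn g <= C -> sqn (fun x => f x * g x) <= K * C /\ (fun x => f x * g x) \in L2.
  move=> sf fk kK gL gC; have mf := smooth_measurable sf; split.
    apply: le_trans (sqnM_le gL mf fk) _.
    by rewrite ler_pM ?sqr_ge0// /L2sqn dot_ge0.
  exact: Lfun2M_bounded fk.
have [p0 p0L] := prod _ _ _ sc hK0 K0K wL h0.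
split; first by move: p0 KC; lra.
move=> i j; rewrite hess_entryM//.
have [a aL] := prod _ _ _ sc hK0 K0K (hL i j) (h2 i j).
have [b bL] := prod _ _ _ (smooth_hess_entry i j sc) (hK2 (i, j)) (K2K _) wL h0.
have [c cL] := prod _ _ _ (smooth_partial i sc) (hK1 i) (K1K i) (pL j) (h1 j).
have [e eL] := prod _ _ _ (smooth_partial j sc) (hK1 j) (K1K j) (pL i) (h1 i).
exact: (sqn_bound4 a b c e aL bL cL eL).
Qed.

(** The defect in the test identity for a function that need not be supported
    inside the domain. *)
Definition defect phi : R := dot v phi - \sum_i \sum_j dot (E i j) (hess_entry i j phi).

Definition pushable chi := smooth chi /\ exists B e (c t0 : R),
  [/\ compact B, (forall x, ~ B x -> chi x = 0), 0 < c, 0 < t0 &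
      pushes_inside Omega B e c t0].

Lemma pushable_bsupp chi : pushable chi -> bsupp chi.
Proof.
move=> [_ [B [e [c [t0 [cB B0 _ _ _]]]]]].
have [M M0 BM] := bounded_setP (compact_bounded cB).
by exists M => x xM; apply: B0 => /BM; rewrite ltNge => /negP; apply; exact: ltW.
Qed.

Lemma pushableM chi psi : pushable chi -> smooth psi -> pushable (fun x => chi x * psi x).
Proof.
move=> [sc [B [e [c [t0 [cB B0 c0 t00 push]]]]]] sp; split; first exact: smoothM.
by exists B, e, c, t0; split=> // x /B0 ->; rewrite mul0r.
Qed.

(** The mollification is supported within rho of Omega, and a point at distance at
    most c t from the closure is still pushed inside by a translation of length t. *)
Lemma pushed_test chi (rho t : R) u e (c t0 : R) B : is_moll rho u -> smooth chi ->
  compact B -> (forall x, ~ B x -> chi x = 0) -> 0 < t <= t0 -> rho <= c * t ->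
  pushes_inside Omega B e c t0 ->
  test_fun Omega (fun x => chi (x + t *: e) * smoothing v u (x + t *: e)).
Proof.
move=> um sc cB B0 tt rhoc push; have sw := smoothing_smooth um.
split; first by apply: (@smooth_shift _ _ (fun x => chi x * smoothing v u x)); exact: smoothM.
pose N : set pt := [set y | exists2 z, closure Omega z & `|y - z| <= rho].
have cN : compact N.
  have := @continuous_compact _ _ (fun p : pt * pt => p.1 + p.2)
    (closure Omega `*` cball rho) _ (compact_setX (compact_closure_bounded bndOmega) (@compact_cball R d rho)).
  rewrite (_ : _ @` _ = N).
    apply; apply: continuous_subspaceT => p; exact: add_continuous.
  apply/seteqP; split=> [_ [[z h] [/= cz hr] <-]|y [z cz yz]].
    by exists z => //; rewrite addrAC subrr add0r.
  by exists (z, y - z); [split|rewrite /= addrC subrK].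
pose K : set pt := (fun y => y - t *: e) @` (B `&` N).
exists K; split.
- apply: continuous_compact.
    by apply: continuous_subspaceT; exact: continuous_addr.
  by apply: compact_closedI => //; exact: compact_closed cN.
- move=> _ [y [By [z cz yz]] <-]; apply: (push t y z) => //.
  exact: le_trans yz rhoc.
- move=> x nK; apply: contrapT => /eqP; rewrite mulf_eq0 negb_or => /andP[/eqP h1 /eqP h2].
  apply: nK; exists (x + t *: e); last by rewrite addrK.
  split; first by apply: contrapT => /B0.
  have [z Oz zx] := smoothing_near um h2.
  by exists z; [exact: subset_closure|rewrite distrC].
Qed.

(** The defect of the translate vanishes, as the translate is a test function on
    Omega. Moving the translation onto v and E, which are continuous under
    translations, leaves an error that the bounds of the localized function control
    uniformly in the mollifier. *)
Lemma defect_pushable chi (dl : R) : pushable chi -> 0 < dl ->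
  small_moll (fun u => `|defect (fun x => chi x * smoothing v u x)| <= dl).
Proof.
move=> pc dl0; have bc := pushable_bsupp pc.
have [sc [B [e [c [t0 [cB B0 c0 t00 push]]]]]] := pc.
have [C C0 hC] := localized_bounds sc bc.
(* 1 + d^2 pairings are estimated, and C + 1 bounds the square root of C *)
pose D : R := (1 + (d * d)%:R) * (C + 1).
have D0 : 0 < D by rewrite mulr_gt0 ?ltr_wpDr ?addr_gt0.
pose k := (dl / D) ^+ 2.
have k0 : 0 < k by rewrite exprn_gt0// divr_gt0.
have sk : Num.sqrt k = dl / D by rewrite sqrtr_sqr ger0_norm// divr_ge0 ?ltW.
have [r1 r10 tv] := translation_continuous vL k0.
have /choice[r2 hr2] (ij : 'I_d * 'I_d) : exists r : R, 0 < r /\ forall h, `|h| <= r ->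
    sqn (fun x => E ij.1 ij.2 (x + h) - E ij.1 ij.2 x) < k.
  by have [r r0 h] := translation_continuous (EL ij.1 ij.2) k0; exists r.
(* the inverse of the sum of the inverses is a common lower bound of the radii *)
have [r [r0 rr1 rr2]] : exists r : R, [/\ 0 < r, r <= r1 & forall ij, r <= r2 ij].
  pose S := r1^-1 + \sum_ij (r2 ij)^-1.
  have p2 ij : 0 <= (r2 ij)^-1 by rewrite invr_ge0 ltW// (hr2 ij).1.
  have S2 : 0 <= \sum_ij (r2 ij)^-1 by apply: sumr_ge0.
  have S0 : 0 < S by rewrite ltr_wpDr// invr_gt0.
  exists S^-1; split=> [||ij]; first by rewrite invr_gt0.
    by rewrite -[leRHS]invrK lef_pV2 ?posrE ?invr_gt0// lerDl.
  rewrite -[leRHS]invrK lef_pV2 ?posrE ?invr_gt0 ?(hr2 ij).1//.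
  rewrite /S (bigD1 ij)//= addrCA lerDl addr_ge0 ?invr_ge0 ?(ltW r10)//.
  by apply: sumr_ge0.
pose t := Num.min t0 (r / (`|e| + 1)).
have e1 : 0 < `|e| + 1 by rewrite ltr_wpDl.
have tp : 0 < t by rewrite lt_min t00 divr_gt0.
have tt0 : 0 < t <= t0 by rewrite tp ge_min lexx.
have te : `|- (t *: e)| <= r.
  rewrite normrN normrZ gtr0_norm//; apply: (@le_trans _ _ (r / (`|e| + 1) * `|e|)).
    by rewrite ler_wpM2r// ge_min lexx orbT.
  by rewrite mulrAC ler_pdivrMr// ler_wpM2l ?(ltW r0)// lerDl.
have ct0 : 0 < c * t by rewrite mulr_gt0.
have hct : small_moll (fun u => test_fun Omega
    (fun x => chi (x + t *: e) * smoothing v u (x + t *: e))).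
  by exists (c * t) => // u um; exact: (pushed_test um sc cB B0 tt0 (lexx _) push).
have [rho rho0 h] := small_moll_and hct hC.
exists rho => // u um; have [tphi [b0 b2]] := h u um.
pose f x := chi x * smoothing v u x.
have sf : smooth f by apply: smoothM => //; exact: smoothing_smooth um.
have bf : bsupp f by exact: bsuppMl.
have fL := smooth_bsupp_L2 sf bf; have hL i j := hess_entry_L2 i j sf bf.
pose s g x := g (x + - (t *: e)) - g x.
have shL g : g \in L2 -> (fun x => g (x + - (t *: e))) \in L2 by exact: Lfun2_shift.
have sL g : g \in L2 -> s g \in L2 by move=> gL; apply: Lfun2B => //; exact: shL.
have back g a : g \in L2 -> a \in L2 ->
    dot g (fun x => a (x + t *: e)) = dot g a + dot (s g) a.
  move=> gL aL; rewrite /s dotBl//; last exact: shL.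
  rewrite addrC subrK -(dot_shift (t *: e) (shL _ gL) aL).
  by congr L2dot; apply/funext => x; rewrite addrK.
have -> : defect f = - (dot (s v) f - \sum_i \sum_j dot (s (E i j)) (hess_entry i j f)).
  have tphi' : test_fun Omega (fun x => f (x + t *: e)) by [].
  have := vE tphi'; rewrite back//.
  under [X in _ = X -> _]eq_bigr do under eq_bigr do rewrite (hess_entry_shift _ _ f) back//.
  under [X in _ = X -> _]eq_bigr do rewrite big_split/=.
  rewrite big_split/= /defect => hE; lra.
rewrite normrN; apply: le_trans (ler_normB _ _) _.
have one g a : g \in L2 -> a \in L2 -> sqn (s g) < k -> sqn a <= C -> `|dot (s g) a| <= dl / D * (C + 1).
  move=> gL aL gk aC; apply: le_trans (dot_le_norm (sL _ gL) aL) _.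
  have Cp : 0 <= C + 1 by rewrite addr_ge0// ltW.
  rewrite -sk; apply: ler_pM; [exact: sqrtr_ge0|exact: sqrtr_ge0| |].
    by rewrite ler_sqrt ?(ltW k0)//; exact: ltW gk.
  rewrite -[leRHS]ger0_norm// -sqrtr_sqr ler_sqrt ?sqr_ge0//.
  by apply: le_trans aC _; have := sqr_ge0 C; move: C0; nra.
have h1 := one v f vL fL (tv _ (le_trans te rr1)) b0.
have h2 i j : `|dot (s (E i j)) (hess_entry i j f)| <= dl / D * (C + 1).
  exact: (one _ _ (EL i j) (hL i j) ((hr2 (i, j)).2 _ (le_trans te (rr2 _))) (b2 i j)).
apply: (@le_trans _ _ (dl / D * (C + 1) + \sum_(i < d) \sum_(j < d) dl / D * (C + 1))).
  apply: lerD => //; apply: le_trans (ler_norm_sum _ _ _) _; apply: ler_sum => i _.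
  by apply: le_trans (ler_norm_sum _ _ _) _; apply: ler_sum => j _; exact: h2.
rewrite !sumr_const !card_ord -mulrnA -mulr_natr -{1}[dl / D * _]mulr1 -mulrDr /D.
rewrite le_eqVlt; apply/orP; left; apply/eqP.
have n0 : 1 + (d * d)%:R != 0 :> R by rewrite gt_eqF// ltr_wpDr.
have C1 : C + 1 != 0 by rewrite gt_eqF// addr_gt0.
by rewrite -mulrA [(C + 1) * _]mulrC divfK ?mulf_neq0.
Qed.

Lemma defectD phi psi : smooth phi -> bsupp phi -> smooth psi -> bsupp psi ->
  defect (fun x => phi x + psi x) = defect phi + defect psi.
Proof.
move=> sf bf sg bg.
have fL := smooth_bsupp_L2 sf bf; have gL := smooth_bsupp_L2 sg bg.
have -> : defect (fun x => phi x + psi x) = dot v (fun x => phi x + psi x) -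
    (\sum_i \sum_j dot (E i j) (hess_entry i j phi) +
     \sum_i \sum_j dot (E i j) (hess_entry i j psi)).
  rewrite /defect -big_split/=; congr (_ - _); apply: eq_bigr => i _.
  rewrite -big_split/=; apply: eq_bigr => j _.
  rewrite (hess_entryD i j sf sg) dotC.
  rewrite (dotDl (hess_entry_L2 i j sf bf) (hess_entry_L2 i j sg bg) (EL i j)).
  by congr (_ + _); exact: dotC.
rewrite dotC (dotDl fL gL vL) opprD addrACA.
by congr (_ - _ + (_ - _)); exact: dotC.
Qed.

Lemma defect_off phi : smooth phi -> (forall x, Omega x -> phi x = 0) -> defect phi = 0.
Proof.
move=> sf f0.
have z f g : (forall x, ~ Omega x -> f x = 0) -> (forall x, Omega x -> g x = 0) -> dot f g = 0.
  move=> hf hg; rewrite /L2dot (_ : (fun x => _) = cst 0) ?Rintegral_cst ?mul0r//.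
  apply/funext => x; have [Ox|nO] := pselect (Omega x).
    by rewrite hg// mulr0.
  by rewrite hf// mul0r.
rewrite /defect z// big1 ?subrr// => i _; rewrite big1// => j _; apply: z => //.
  exact: E_off.
move=> x Ox; rewrite (hess_entry_local (g := fun=> 0) i j openOmega f0 Ox).
by rewrite /hess_entry !partial_cst addr0 mulr0.
Qed.

(** Peeling off finitely many pushable cutoffs, one factor 1 - chi at a time,
    amounts to a partition of unity. *)
Lemma defect_peel (s : seq (pt -> R)) psi (dl : R) : smooth psi ->
  (forall n, (n < size s)%N -> pushable (nth (cst 0) s n)) -> 0 < dl ->
  small_moll (fun u => `|defect (fun x => psi x * smoothing v u x) -
    defect (fun x => (psi x * \prod_(chi <- s) (1 - chi x)) * smoothing v u x)| <= dl).
Proof.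
move=> sp; elim: s psi sp dl => [|chi s IH] psi sp dl ps dl0.
  apply: small_moll_true => u; under [X in _ - defect X]eq_fun do rewrite big_nil mulr1.
  by rewrite subrr normr0 ltW.
have pchi : pushable chi by exact: (ps 0%N).
have sc := pchi.1.
have dl2 : 0 < dl / 2 by rewrite divr_gt0.
have s1 : smooth (fun x => psi x * (1 - chi x)).
  by apply: smoothM => //; apply: smoothB => //; exact: smooth_cst.
have h1 := IH _ s1 (dl / 2) (fun n h => ps n.+1 h) dl2.
have h2 := defect_pushable (pushableM pchi sp) dl2.
have [rho rho0 h] := small_moll_and h1 h2; exists rho => // u um; have [k1 k2] := h u um.
have sw := smoothing_smooth um; have bw := smoothing_bsupp um.
have -> : defect (fun x => psi x * smoothing v u x) =
    defect (fun x => chi x * psi x * smoothing v u x) +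
    defect (fun x => psi x * (1 - chi x) * smoothing v u x).
  rewrite -defectD; [|by do ?apply: smoothM|exact: bsuppMr|exact: smoothM|exact: bsuppMr].
  by congr defect; apply/funext => x; ring.
under [X in _ - defect X]eq_fun do rewrite big_cons mulrA.
rewrite -addrA; apply: le_trans (ler_normD _ _) _.
by move: k1 k2; lra.
Qed.

(** Each point of the compact closure has a plateau function that is one near it and
    is supported where a single inward direction serves all points. *)
Lemma pushable_cover : exists s : seq (pt -> R),
  (forall n, (n < size s)%N -> pushable (nth (cst 0) s n)) /\
  forall x, Omega x -> \prod_(chi <- s) (1 - chi x) = 0.
Proof.
pose P a (s : R) := exists chi, pushable chi /\ forall x, `|x - a| < s -> chi x = 1.
have loc a : closure Omega a -> exists2 s : R, 0 < s & P a s.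
  move=> ca; have [e [r [c [t0 [r0 c0 t00 push]]]]] := inward_direction openOmega lipOmega ca.
  have [chi [s [s0 schi chi1 chi0]]] := smooth_plateau a r0.
  exists s => //; exists chi; split=> [|x /ltW]; last exact: chi1.
  split=> //; exists [set y | `|y - a| <= r], e, c, t0; split=> //.
    rewrite (_ : mkset _ = (fun y => y + a) @` cball r).
      apply: continuous_compact; last exact: compact_cball.
      by apply: continuous_subspaceT; exact: continuous_addr.
    apply/seteqP; split=> [y ya|_ [y yr <-]]; last by rewrite /= addrK.
    by exists (y - a) => //; rewrite subrK.
  by move=> x /negP; rewrite -ltNge; exact: chi0.
have [s [sP sc]] := finite_ball_cover (compact_closure_bounded bndOmega) loc.
have /choice[X XP] (p : pt * R) : exists chi, p \in s ->
    pushable chi /\ forall x, `|x - p.1| < p.2 -> chi x = 1.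
  have [ps|] := boolP (p \in s); last by exists (cst 0).
  by have [chi hchi] := sP p ps; exists chi.
exists [seq X p | p <- s]; split=> [n|x Ox].
  rewrite size_map => ns; rewrite (nth_map (0, 0))//.
  exact: (XP _ (mem_nth _ ns)).1.
have [p ps xp] := sc x (subset_closure Ox).
rewrite big_map (big_rem p)//= (XP p ps).2// subrr mul0r//.
Qed.

(** The second derivatives of the mollification of v are minus the mollifications of
    E, so its defect tends to the sum of the squared norms. Peeling off a cover of
    Omega by pushable cutoffs shows that the defect tends to zero: what is left
    vanishes on Omega, where v and E live. *)
Lemma biorthogonal_eq0 : sqn v + \sum_i \sum_j sqn (E i j) = 0.
Proof.
set S := LHS.
have S0 : 0 <= S.
  by rewrite addr_ge0 ?dot_ge0// sumr_ge0// => i _; rewrite sumr_ge0// => j _; exact: dot_ge0.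
suff : S <= 0 by move=> h; apply/eqP; rewrite eq_le h S0.
apply/ler_addgt0Pl => dl dl0; rewrite addr0.
have [s [ps s0]] := pushable_cover.
pose N := 1 + Num.sqrt (sqn v) + \sum_i \sum_j Num.sqrt (sqn (E i j)).
have NE : 0 <= \sum_i \sum_j Num.sqrt (sqn (E i j)).
  by apply: sumr_ge0 => i _; apply: sumr_ge0 => j _; exact: sqrtr_ge0.
have N0 : 0 < N by rewrite ltr_wpDr// ltr_wpDr// sqrtr_ge0.
(* sqrt k = dl / (2 N) is the admissible distance from v and E to their
   mollifications, and N bounds the factors in front of it *)
pose k := (dl / (2 * N)) ^+ 2.
have q0 : 0 < dl / (2 * N) by rewrite divr_gt0// mulr_gt0.
have k0 : 0 < k by rewrite exprn_gt0.
have sk : Num.sqrt k = dl / (2 * N) by rewrite sqrtr_sqr gtr0_norm.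
have dl2 : 0 < dl / 2 by rewrite divr_gt0.
have h1 := defect_peel (smooth_cst 1) ps dl2.
have h2 := smoothing_close vL vi k0.
have h3 : small_moll (fun u => forall ij : 'I_d * 'I_d,
    sqn (fun x => smoothing (E ij.1 ij.2) u x - E ij.1 ij.2 x) <= k).
  by apply: small_moll_fin => -[i j] /=; exact: smoothing_close.
have [rho rho0 h] := small_moll_and h1 (small_moll_and h2 h3).
have [u [su u0 u1]] := mollifier_exists d rho0.
have um : is_moll rho u by [].
have [{}h1 [{}h2 {}h3]] := h u um.
have sw := smoothing_smooth um; have bw := smoothing_bsupp um.
have wL := smooth_bsupp_L2 sw bw.
have EsL i j : smoothing (E i j) u \in L2.
  have := Lfun2N (hess_entry_L2 i j sw bw); rewrite (hess_smoothing i j um).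
  by under eq_fun do rewrite opprK.
have close f g : f \in L2 -> g \in L2 -> sqn (fun x => g x - f x) <= k ->
    sqn f <= dot f g + Num.sqrt (sqn f) * (dl / (2 * N)).
  move=> fL gL gk; have gfL := Lfun2B gL fL.
  have := dot_le_norm fL gfL; rewrite dotBr// ler_norml => /andP[+ _].
  have : Num.sqrt (sqn f) * Num.sqrt (sqn (fun x => g x - f x)) <= Num.sqrt (sqn f) * (dl / (2 * N)).
    by rewrite ler_wpM2l ?sqrtr_ge0// -sk ler_sqrt// ltW.
  by rewrite /L2sqn; lra.
have dw : defect (smoothing v u) = dot v (smoothing v u) +
    \sum_i \sum_j dot (E i j) (smoothing (E i j) u).
  rewrite /defect -sumrN; congr (_ + _); apply: eq_bigr => i _.
  rewrite -sumrN; apply: eq_bigr => j _.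
  by rewrite (hess_smoothing i j um) dotC dotNl// opprK dotC.
have c1 : S <= defect (smoothing v u) + dl / 2.
  have -> : dl / 2 = (1 + Num.sqrt (sqn v) + \sum_i \sum_j Num.sqrt (sqn (E i j))) * (dl / (2 * N)).
    by rewrite -/N; field; rewrite gt_eqF.
  have cE : \sum_i \sum_j sqn (E i j) <= \sum_i \sum_j dot (E i j) (smoothing (E i j) u) +
      (\sum_i \sum_j Num.sqrt (sqn (E i j))) * (dl / (2 * N)).
    rewrite mulr_suml -big_split/=; apply: ler_sum => i _.
    rewrite mulr_suml -big_split/=; apply: ler_sum => j _.
    by apply: close => //; exact: (h3 (i, j)).
  have := close _ _ vL wL h2; move: q0 cE.
  rewrite dw /S; set q := dl / (2 * N); rewrite !(mulrDl _ _ q) mul1r.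
  move: (\sum_i \sum_j sqn (E i j)) (\sum_i \sum_j dot (E i j) _).
  set q1 := Num.sqrt (sqn v) * q; set q2 := (\sum_i _) * q.
  by move: (sqn v) (dot v _) q q1 q2 => a b p p1 p2 c e; lra.
have c2 : `|defect (smoothing v u)| <= dl / 2.
  move: h1; rewrite [X in _ - X]defect_off ?subr0.
  - by under eq_fun do rewrite mul1r.
  - apply: smoothM => //; apply: smoothM; first exact: smooth_cst.
    elim: (s) (ps) => [|chi s' IH] ps'; first by under eq_fun do rewrite big_nil; exact: smooth_cst.
    under eq_fun do rewrite big_cons; apply: smoothM.
      by apply: smoothB; [exact: smooth_cst|exact: (ps' 0%N _).1].
    by apply: IH => n; exact: (ps' n.+1).
  - by move=> x Ox; rewrite s0// mulr0 mul0r.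
by move: c1 c2; rewrite ler_norml => c1 /andP[_ c2]; lra.
Qed.

End biorthogonal.

(** * Green's formula for smooth tensors *)

Section green.
Context (R : realType) (d : nat).
Local Notation pt := 'rV[R]_d.
Local Notation tensor := (pt -> 'M[R]_d).
Local Notation leb := (@lebesgue_rV R d).
Local Notation dot := (L2dot leb).
Implicit Types (f g w z phi theta : pt -> R) (Theta Psi : tensor) (A : set pt) (i j k l : 'I_d).

Definition entry Theta i j : pt -> R := fun x => Theta x i j.

Lemma partial_sum (J : Type) (r : seq J) (F : J -> pt -> R) i : (forall k : J, smooth (F k)) ->
  partial i (fun x => \sum_(k <- r) F k x) = fun x => \sum_(k <- r) partial i (F k) x.
Proof.
move=> sF; elim: r => [|k r IH].
  under eq_fun do rewrite big_nil; rewrite partial_cst.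
  by apply/funext => x; rewrite big_nil.
under eq_fun do rewrite big_cons; rewrite partialD.
- by apply/funext => x; rewrite big_cons IH.
- by move=> x; exact: smooth_differentiable.
- by move=> x; apply: smooth_differentiable; apply: smooth_sum.
Qed.

Lemma vdiv_tdivE Psi : (forall i j, smooth (entry Psi i j)) ->
  vdiv (tdiv Psi) = fun x => \sum_i \sum_j partial i (partial j (entry Psi i j)) x.
Proof.
move=> sP; apply/funext => x; rewrite /vdiv; apply: eq_bigr => i _.
rewrite (_ : (fun y => _) = fun y => \sum_j partial j (entry Psi i j) y).
  by rewrite partial_sum// => j; exact: smooth_partial.
apply/funext => y; rewrite /tdiv mxE /vdiv; apply: eq_bigr => j _.
by congr (partial _ _ _); apply/funext => t; rewrite mxE.
Qed.

Lemma smooth_vdiv_tdiv Psi : (forall i j, smooth (entry Psi i j)) -> smooth (vdiv (tdiv Psi)).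
Proof.
move=> sP; rewrite vdiv_tdivE//; apply: smooth_sum => i _; apply: smooth_sum => j _.
by do 2 apply: smooth_partial.
Qed.

Lemma green_entry f phi i j : smooth f -> smooth phi -> bsupp phi ->
  dot f (partial j (partial i phi)) = dot (partial i (partial j f)) phi.
Proof.
move=> sf sp bp.
have h1 := integral_by_parts j sf (smooth_partial i sp) (bsupp_partial i bp).
have h2 := integral_by_parts i (smooth_partial j sf) sp bp.
by rewrite /L2dot h2 h1 opprK.
Qed.

Lemma ip_restrict A f g : ip A f g = dot (f \_ A) (g \_ A).
Proof.
rewrite /ip Rintegral_mkcond; apply: eq_Rintegral => x _; rewrite !patchE.
by case: ifP; rewrite ?mulr0.
Qed.

Lemma ip_off A f g : (forall x, ~ A x -> g x = 0) -> ip A f g = dot f g.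
Proof.
move=> g0; rewrite ip_restrict; apply: eq_Rintegral => x _; rewrite !patchE.
by case: ifPn => [//|/negP nA]; rewrite mulr0 g0 ?mulr0// => /mem_set.
Qed.

Lemma ipM_sum A Theta Psi : (forall i j, L2 A (entry Theta i j)) ->
  (forall i j, L2 A (entry Psi i j)) ->
  ipM A Theta Psi = \sum_i \sum_j ip A (entry Theta i j) (entry Psi i j).
Proof.
move=> TL PL; rewrite /ipM Rintegral_mkcond.
have iTP i j := dot_integrable (TL i j) (PL i j).
under [RHS]eq_bigr do under eq_bigr do rewrite ip_restrict.
under [RHS]eq_bigr do rewrite -Rintegral_sum//.
rewrite -Rintegral_sum => [|i].
  apply: eq_Rintegral => x _; rewrite patchE; case: ifPn => xA.
    by apply: eq_bigr => i _; apply: eq_bigr => j _; rewrite !patchE xA.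
  by rewrite big1// => i _; rewrite big1// => j _; rewrite !patchE (negbTE xA) mulr0.
rewrite (_ : _ \o _ = (fun x => \sum_j ((entry Theta i j \_ A) x * (entry Psi i j \_ A) x)%:E)%E).
  by apply: integrable_sum => // j _; exact: iTP.
by apply/funext => x /=; rewrite sumEFin.
Qed.

Lemma L2_smooth A f : bounded_set A -> open A -> smooth f -> L2 A f.
Proof.
move=> bA oA sf; apply: continuous_L2_on => //; last exact: measurable_open.
exact: smooth_continuous.
Qed.

Lemma test_off A phi : test_fun A phi -> forall x, ~ A x -> phi x = 0.
Proof. by move=> [_ [K [_ KA K0]]] x nA; apply: K0 => /KA. Qed.

Lemma hess_test_off A phi i j : test_fun A phi -> forall x, ~ A x -> hess_entry i j phi x = 0.
Proof.
move=> [_ [K [cK KA K0]]] x nA; apply: (hess_entry_off i j (compact_closed _ cK) K0).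
  exact: norm_hausdorff.
by move=> /KA.
Qed.

Lemma smooth_entry Psi i j : smooth_sym Psi -> smooth (entry Psi i j).
Proof. by move=> [sP _]; exact: sP. Qed.

Lemma smooth_sym_tr Psi i j : smooth_sym Psi -> entry Psi j i = entry Psi i j.
Proof. by move=> [_ sP]; apply/funext => x; rewrite /entry -{1}(sP x) mxE. Qed.

Lemma dotr_half f g h : leb.-integrable setT (EFin \o (fun x => f x * g x)) ->
  leb.-integrable setT (EFin \o (fun x => f x * h x)) ->
  dot f (fun x => 2^-1 * (g x + h x)) = 2^-1 * (dot f g + dot f h).
Proof.
move=> i1 i2; rewrite /L2dot -RintegralD// -RintegralZl//.
  by apply: eq_Rintegral => x _; ring.
exact: (integrableD measurableT i1 i2).
Qed.

Lemma entry_hess phi i j : entry (symgrad (grad phi)) i j = hess_entry i j phi.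
Proof. by apply/funext => x; exact: symgrad_grad. Qed.

(** Two integrations by parts per entry produce the mixed derivatives in the opposite
    order, and the symmetry of the tensor averages both orders. *)
Lemma green phi Psi : smooth phi -> bsupp phi -> smooth_sym Psi ->
  \sum_i \sum_j dot (entry Psi i j) (hess_entry i j phi) = dot (vdiv (tdiv Psi)) phi.
Proof.
move=> sp bp sP; have se i j := smooth_entry i j sP.
have int f g : smooth f -> smooth g -> bsupp g -> leb.-integrable setT (EFin \o (fun x => f x * g x)).
  move=> sf sg bg; apply: bsupp_integrable; last exact: bsuppMr.
  by apply: smooth_continuous; exact: smoothM.
pose a i j := dot (partial i (partial j (entry Psi i j))) phi.
have s2 f i j : smooth f -> smooth (partial i (partial j f)) by move=> sf; do 2 apply: smooth_partial.
have b2 i j : bsupp (partial i (partial j phi)) by do 2 apply: bsupp_partial.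
have one i j : dot (entry Psi i j) (hess_entry i j phi) = 2^-1 * (a i j + a j i).
  have i1 := int _ _ (se i j) (s2 _ j i sp) (b2 j i).
  have i2 := int _ _ (se i j) (s2 _ i j sp) (b2 i j).
  apply: etrans (@dotr_half (entry Psi i j) (partial j (partial i phi)) (partial i (partial j phi)) i1 i2) _.
  congr (_ * (_ + _)); first exact: green_entry (se i j) sp bp.
  rewrite /a (smooth_sym_tr i j sP); exact: green_entry (se i j) sp bp.
under eq_bigr do under eq_bigr do rewrite one mulrDr.
under eq_bigr do rewrite big_split/=.
rewrite big_split/= [X in _ + X]exchange_big/= -big_split/=.
rewrite /L2dot vdiv_tdivE//; under [RHS]eq_Rintegral do rewrite mulr_suml.
rewrite Rintegral_sum => [|i]; last first.
  have := int (fun x => \sum_j partial i (partial j (entry Psi i j)) x) phi _ sp bp.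
  by apply; apply: smooth_sum => j _; exact: s2.
apply: eq_bigr => i _; rewrite -big_split/=; under [RHS]eq_Rintegral do rewrite mulr_suml.
rewrite Rintegral_sum => [|j]; last exact: int (s2 _ i j (se i j)) sp bp.
have half (p : R) : 2^-1 * p + 2^-1 * p = p by lra.
by apply: eq_bigr => j _; rewrite half.
Qed.

Lemma is_divdiv_smooth A Psi : open A -> bounded_set A -> smooth_sym Psi ->
  is_divdiv A Psi (vdiv (tdiv Psi)).
Proof.
move=> oA bA sP; have se i j := smooth_entry i j sP; split.
  by apply: L2_smooth => //; exact: smooth_vdiv_tdiv.
move=> phi tphi; have [sp bp] := (tphi.1, test_fun_bsupp tphi).
rewrite (ip_off _ (test_off tphi)) -(green sp bp sP) ipM_sum.
- apply: eq_bigr => i _; apply: eq_bigr => j _.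
  by rewrite entry_hess (ip_off _ (hess_test_off i j tphi)).
- by move=> i j; exact: L2_smooth.
- move=> i j; rewrite entry_hess.
  by apply: L2_smooth => //; exact: smooth_hess_entry.
Qed.

Lemma is_hess_test A phi : open A -> bounded_set A -> test_fun A phi ->
  is_hess A phi (symgrad (grad phi)).
Proof.
move=> oA bA tphi; have [sp bp] := (tphi.1, test_fun_bsupp tphi).
have hL i j : L2 A (entry (symgrad (grad phi)) i j).
  by rewrite entry_hess; apply: L2_smooth => //; exact: smooth_hess_entry.
split.
  split=> // x _; apply/matrixP => i j; rewrite mxE !symgrad_grad /hess_entry.
  by move: (partial j _ x) (partial i _ x) => p q; rewrite addrC.
move=> Psi [sP _]; have se i j := smooth_entry i j sP.
rewrite ipM_sum// => [|i j]; last exact: L2_smooth.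
have -> : ip A phi (vdiv (tdiv Psi)) = ip A (vdiv (tdiv Psi)) phi.
  by rewrite !ip_restrict dotC.
rewrite (ip_off _ (test_off tphi)) -(green sp bp sP).
apply: eq_bigr => i _; apply: eq_bigr => j _; rewrite entry_hess.
by rewrite ip_restrict dotC -ip_restrict (ip_off _ (hess_test_off i j tphi)).
Qed.

End green.

(** * Density of the smooth symmetric tensors *)

Section restriction_algebra.
Context (R : realType) (d : nat).
Local Notation pt := 'rV[R]_d.
Implicit Types (f g : pt -> R) (A : set pt).

Lemma restrictDE A f g : (fun x => f x + g x) \_ A = fun x => (f \_ A) x + (g \_ A) x.
Proof. by apply/funext => x; rewrite !patchE; case: ifP => //; rewrite addr0. Qed.

Lemma restrictZE A (a : R) f : (fun x => a * f x) \_ A = fun x => a * (f \_ A) x.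
Proof. by apply/funext => x; rewrite !patchE; case: ifP => //; rewrite mulr0. Qed.

Lemma restrictNE A f : (fun x => - f x) \_ A = fun x => - (f \_ A) x.
Proof. by apply/funext => x; rewrite !patchE; case: ifP => //; rewrite oppr0. Qed.

Lemma restrictBE A f g : (fun x => f x - g x) \_ A = fun x => (f \_ A) x - (g \_ A) x.
Proof. by rewrite restrictDE restrictNE. Qed.

End restriction_algebra.

Section product_space.
Context (R : realType) (d : nat).
Local Notation pt := 'rV[R]_d.
Local Notation tensor := (pt -> 'M[R]_d).
Local Notation leb := (@lebesgue_rV R d).
Local Notation dot := (L2dot leb).
Local Notation sqn := (L2sqn leb).
Local Notation Lf := (Lfun leb 2%:E).
Local Notation V := ((pt -> R) * ('I_d -> 'I_d -> pt -> R))%type.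
Implicit Types (f g w z phi theta : pt -> R) (Theta Psi : tensor) (A : set pt)
  (i j k l : 'I_d) (F G : V).

Definition square_pair F := F.1 \in Lf /\ forall i j, F.2 i j \in Lf.

Definition pair_dot F G : R := dot F.1 G.1 + \sum_i \sum_j dot (F.2 i j) (G.2 i j).

Lemma square_pair_lin (a : R) F G : square_pair F -> square_pair G -> square_pair (a *: F + G).
Proof.
move=> [F1 F2] [G1 G2]; split=> [|i j]; first exact: Lfun2D (Lfun2Z a F1) G1.
exact: Lfun2D (Lfun2Z a (F2 i j)) (G2 i j).
Qed.

Lemma pair_dot_lin (a : R) F G H : square_pair F -> square_pair G -> square_pair H ->
  pair_dot (a *: F + G) H = a * pair_dot F H + pair_dot G H.
Proof.
move=> [F1 F2] [G1 G2] [H1 H2].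
have one f g h : f \in Lf -> g \in Lf -> h \in Lf ->
    dot (fun x => a * f x + g x) h = a * dot f h + dot g h.
  by move=> fL gL hL; rewrite dotDl ?dotZl//; exact: Lfun2Z.
rewrite /pair_dot mulrDr addrACA; congr (_ + _); first exact: one.
rewrite mulr_sumr -big_split/=; apply: eq_bigr => i _.
rewrite mulr_sumr -big_split/=; apply: eq_bigr => j _; exact: one.
Qed.

Lemma pair_dotC F G : pair_dot F G = pair_dot G F.
Proof.
rewrite /pair_dot; congr (_ + _); first exact: dotC.
by apply: eq_bigr => i _; apply: eq_bigr => j _; exact: dotC.
Qed.

Lemma pair_dotNN F : pair_dot (- F) (- F) = pair_dot F F.
Proof.
rewrite /pair_dot; congr (_ + _).
  by apply: eq_Rintegral => x _; exact: mulrNN.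
by apply: eq_bigr => i _; apply: eq_bigr => j _; apply: eq_Rintegral => x _; exact: mulrNN.
Qed.

Lemma pair_dot_sqD_le F G : square_pair F -> square_pair G ->
  pair_dot (F + G) (F + G) <= 2 * pair_dot F F + 2 * pair_dot G G.
Proof.
move=> [F1 F2] [G1 G2]; rewrite /pair_dot !mulrDr addrACA lerD//; first exact: dot_sqD_le.
rewrite !mulr_sumr -big_split/=; apply: ler_sum => i _.
by rewrite !mulr_sumr -big_split/=; apply: ler_sum => j _; exact: dot_sqD_le.
Qed.

Lemma pair_dot_ge1 F : sqn F.1 <= pair_dot F F.
Proof. by rewrite lerDl sumr_ge0// => i _; rewrite sumr_ge0// => j _; exact: dot_ge0. Qed.

Lemma pair_dot_ge2 F i j : sqn (F.2 i j) <= pair_dot F F.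
Proof.
rewrite /pair_dot (bigD1 i)//= (bigD1 j)//= addrCA -!addrA lerDl !addr_ge0 ?dot_ge0//.
  by rewrite sumr_ge0// => l _; exact: dot_ge0.
by rewrite sumr_ge0// => k _; rewrite sumr_ge0// => l _; exact: dot_ge0.
Qed.

Lemma pair_dot_ge0 F : 0 <= pair_dot F F.
Proof. by apply: le_trans (pair_dot_ge1 F); exact: dot_ge0. Qed.

Lemma square_pair_complete (u : nat -> V) : (forall n, square_pair (u n)) ->
  (forall e : R, 0 < e -> exists N, forall m n, (N <= m)%N -> (N <= n)%N ->
     pair_dot (u m - u n) (u m - u n) < e) ->
  exists2 l, square_pair l & forall e : R, 0 < e -> exists N, forall n, (N <= n)%N ->
     pair_dot (u n - l) (u n - l) < e.
Proof.
move=> uL uC.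
have [|l1 l1L cv1] := @Lfun2_complete _ _ _ leb (fun n => (u n).1) (fun n => (uL n).1).
  move=> e e0; have [N hN] := uC e e0; exists N => m n mN nN.
  exact: le_lt_trans (pair_dot_ge1 (u m - u n)) (hN m n mN nN).
have /choice[l2 l2P] (ij : 'I_d * 'I_d) : exists g, g \in Lf /\ forall e : R, 0 < e ->
    exists N, forall n, (N <= n)%N -> sqn (fun x => (u n).2 ij.1 ij.2 x - g x) < e.
  have [|l lL cv] := @Lfun2_complete _ _ _ leb (fun n => (u n).2 ij.1 ij.2) (fun n => (uL n).2 _ _).
    move=> e e0; have [N hN] := uC e e0; exists N => m n mN nN.
    exact: le_lt_trans (pair_dot_ge2 (u m - u n) ij.1 ij.2) (hN m n mN nN).
  by exists l.
exists (l1, fun i j => l2 (i, j)); first by split=> // i j; exact: (l2P (i, j)).1.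
move=> e e0; pose k : R := e / (1 + (d * d)%:R).
have D0 : 0 < 1 + (d * d)%:R :> R by rewrite ltr_wpDr.
have k0 : 0 < k by rewrite divr_gt0.
have [N1 hN1] := cv1 k k0.
have /choice[N2 hN2] ij := (l2P ij).2 k k0.
exists (maxn N1 (\max_ij N2 ij)) => n; rewrite geq_max => /andP[nN1 nN2].
apply: (@lt_le_trans _ _ (k + \sum_(i < d) \sum_(j < d) k)).
  apply: ltr_leD; first exact: hN1.
  apply: ler_sum => i _; apply: ler_sum => j _; apply: ltW; apply: (hN2 (i, j)).
  by apply: leq_trans nN2; exact: (leq_bigmax (i, j)).
by rewrite !sumr_const !card_ord -mulrnA -mulr_natr -{1}[k]mulr1 -mulrDr /k divfK// gt_eqF.
Qed.

(** The pairing with G is continuous by the Cauchy-Schwarz inequality. *)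
Lemma pair_dot_limit (S : set V) p G : S `<=` square_pair -> square_pair p -> square_pair G ->
  (forall e : R, 0 < e -> exists2 s, S s & pair_dot (s - p) (s - p) < e) ->
  (forall s, S s -> pair_dot s G = 0) -> pair_dot p G = 0.
Proof.
move=> SX pX GX pS SG; apply/eqP; rewrite -sqrf_eq0 eq_le sqr_ge0 andbT.
apply/ler_addgt0Pl => e e0; rewrite addr0.
pose B := 1 + pair_dot G G.
have B0 : 0 < B by rewrite ltr_wpDr ?pair_dot_ge0.
have [s Ss se] := pS (e / B) (divr_gt0 e0 B0).
have spX : square_pair (s - p).
  by rewrite addrC -scaleN1r; exact: square_pair_lin pX (SX _ Ss).
have -> : pair_dot p G ^+ 2 = pair_dot (s - p) G ^+ 2.
  have -> : s - p = -1 *: p + s by rewrite addrC scaleN1r.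
  by rewrite (pair_dot_lin _ pX (SX _ Ss) GX) (SG _ Ss) addr0 mulN1r sqrrN.
have CS := @b_CauchySchwarz R V square_pair pair_dot square_pair_lin pair_dot_lin
  (fun _ _ _ _ => pair_dotC _ _) (fun _ _ => pair_dot_ge0 _) _ _ spX GX.
apply: le_trans CS _; apply: (@le_trans _ _ (e / B * B)); last by rewrite divfK// gt_eqF.
by apply: ler_pM; rewrite ?pair_dot_ge0// ?(ltW se)// /B; lra.
Qed.

End product_space.

Section density.
Context (R : realType) (d : nat).
Local Notation pt := 'rV[R]_d.
Local Notation tensor := (pt -> 'M[R]_d).
Local Notation leb := (@lebesgue_rV R d).
Local Notation dot := (L2dot leb).
Local Notation sqn := (L2sqn leb).
Local Notation Lf := (Lfun leb 2%:E).
Local Notation V := ((pt -> R) * ('I_d -> 'I_d -> pt -> R))%type.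
Implicit Types (f g w z phi theta : pt -> R) (Theta Psi : tensor) (A : set pt)
  (i j k l : 'I_d) (F G : V).

Definition sym_coef i j k l : R :=
  2^-1 * (((k == i) && (l == j))%:R + ((k == j) && (l == i))%:R).

(** The tensors that detect a single entry of a symmetric tensor. *)
Definition sym_tensor theta i j : tensor :=
  fun x => \matrix_(k, l) (sym_coef i j k l * theta x).

Lemma sym_coefC i j k l : sym_coef i j k l = sym_coef i j l k.
Proof. by rewrite /sym_coef addrC (andbC (k == j)) (andbC (k == i)). Qed.

Lemma sum_delta (a : 'I_d -> 'I_d -> R) i j :
  \sum_k \sum_l ((k == i) && (l == j))%:R * a k l = a i j.
Proof.
rewrite (bigD1 i)//= (bigD1 j)//= !eqxx mul1r !big1 ?addr0// => k ki.
  by rewrite big1// => l _; rewrite (negbTE ki) mul0r.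
by rewrite (negbTE ki) mul0r.
Qed.

Lemma sum_sym_coef (a : 'I_d -> 'I_d -> R) i j :
  \sum_k \sum_l sym_coef i j k l * a k l = 2^-1 * (a i j + a j i).
Proof.
rewrite -(sum_delta a i j) -(sum_delta a j i) mulrDr !mulr_sumr -big_split/=.
apply: eq_bigr => k _; rewrite !mulr_sumr -big_split/=.
by apply: eq_bigr => l _; rewrite /sym_coef; ring.
Qed.

Lemma entry_sym_tensor theta i j k l :
  entry (sym_tensor theta i j) k l = fun x => sym_coef i j k l * theta x.
Proof. by apply/funext => x; rewrite /entry mxE. Qed.

Lemma smooth_sym_tensor theta i j : smooth theta -> smooth_sym (sym_tensor theta i j).
Proof.
move=> st; split=> [k l|x].
  have := smoothZ (sym_coef i j k l) st.
  by congr smooth; apply/funext => x; rewrite mxE.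
by apply/matrixP => k l; rewrite !mxE sym_coefC.
Qed.

Lemma vdiv_tdiv_sym_tensor theta i j : smooth theta ->
  vdiv (tdiv (sym_tensor theta i j)) = hess_entry i j theta.
Proof.
move=> st; rewrite vdiv_tdivE; last by move=> k l; rewrite entry_sym_tensor; exact: smoothZ.
apply/funext => x; rewrite /hess_entry addrC.
rewrite -(sum_sym_coef (fun k l => partial k (partial l theta) x)).
apply: eq_bigr => k _; apply: eq_bigr => l _; rewrite entry_sym_tensor.
rewrite partialZ; last by move=> y; exact: smooth_differentiable.
by rewrite partialZ// => y; apply: smooth_differentiable; exact: smooth_partial.
Qed.

Lemma entry_lin (a : R) Theta Psi i j :
  entry (fun x => a *: Theta x + Psi x) i j = fun x => a * entry Theta i j x + entry Psi i j x.
Proof. by apply/funext => x; rewrite /entry !mxE. Qed.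

Lemma smooth_sym_lin (a : R) Theta Psi : smooth_sym Theta -> smooth_sym Psi ->
  smooth_sym (fun x => a *: Theta x + Psi x).
Proof.
move=> sP sQ; split=> [i j|x]; last by rewrite linearD linearZ/= sP.2 sQ.2.
rewrite -[fun x => _]/(entry (fun x => a *: Theta x + Psi x) i j) entry_lin.
by apply: smoothD; [apply: smoothZ|]; exact: smooth_entry.
Qed.

Lemma vdiv_tdiv_lin (a : R) Theta Psi : smooth_sym Theta -> smooth_sym Psi ->
  vdiv (tdiv (fun x => a *: Theta x + Psi x)) =
  fun x => a * vdiv (tdiv Theta) x + vdiv (tdiv Psi) x.
Proof.
move=> sP sQ; have sP' i j := smooth_entry i j sP; have sQ' i j := smooth_entry i j sQ.
rewrite !vdiv_tdivE//; last by move=> i j; apply: smooth_entry; exact: smooth_sym_lin.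
apply/funext => x; rewrite mulr_sumr -big_split/=; apply: eq_bigr => i _.
rewrite mulr_sumr -big_split/=; apply: eq_bigr => j _.
have dP k y := smooth_differentiable y (smooth_partial k (sP' i j)).
have dQ k y := smooth_differentiable y (smooth_partial k (sQ' i j)).
have dP0 y := smooth_differentiable y (sP' i j).
have dQ0 y := smooth_differentiable y (sQ' i j).
have daP y := smooth_differentiable y (smoothZ a (sP' i j)).
have daP1 y := smooth_differentiable y (smoothZ a (smooth_partial j (sP' i j))).
by rewrite entry_lin (partialD _ daP dQ0) (partialZ a _ dP0) (partialD _ daP1 (dQ j)) (partialZ a _ (dP j)).
Qed.

(** The pair of w and Theta is projected onto the closure of the pairs of the double
    divergence of Psi and Psi itself. The residual (v, E) is orthogonal to these
    pairs; this makes E minus the weak Hessian of v on the whole space, after extension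
    by zero. As a limit of pairs that satisfy the test identity, it satisfies the
    identity itself: v is the weak double divergence of E in A. Such a pair
    vanishes. *)
Lemma smooth_sym_dense A Theta w : open A -> bounded_set A -> lipschitz_boundary A ->
  L2s A Theta -> is_divdiv A Theta w -> forall e : R, 0 < e ->
  exists2 Psi, smooth_sym Psi &
    ipM A (fun x => Theta x - Psi x) (fun x => Theta x - Psi x) +
    ip A (fun x => w x - vdiv (tdiv Psi) x) (fun x => w x - vdiv (tdiv Psi) x) < e.
Proof.
move=> oA bA lA [TL Tsym] [wL wT]; have mA := measurable_open oA.
pose pack Th v : V := (v \_ A, fun i j => entry Th i j \_ A).
pose S : set V := [set pack Psi (vdiv (tdiv Psi)) | Psi in smooth_sym].
have packX Psi : smooth_sym Psi -> square_pair (pack Psi (vdiv (tdiv Psi))).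
  move=> sP; split=> [|i j]; apply: L2_smooth => //; last exact: smooth_entry.
  by apply: smooth_vdiv_tdiv => i j; exact: smooth_entry.
have SX : S `<=` @square_pair R d by move=> _ [Psi sP <-]; exact: packX.
pose F := pack Theta w.
have FX : square_pair F by split.
have S0 : S 0.
  have s0 : @smooth_sym R d (fun=> 0).
    split=> [i j|x]; last by rewrite trmx0.
    by under eq_fun do rewrite mxE; exact: smooth_cst.
  exists (fun=> 0) => //; rewrite /pack vdiv_tdivE; last by move=> i j; exact: smooth_entry.
  have z i j : entry (fun=> 0) i j = fun _ : pt => 0 :> R by apply/funext => x; rewrite /entry mxE.
  congr pair; first apply/funext => x.
    rewrite patchE; case: ifP => // _; rewrite big1// => i _; rewrite big1// => j _.
    by rewrite z !partial_cst.
  apply/funext => i; apply/funext => j; apply/funext => x.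
  by rewrite z patchE; case: ifP.
have Slin (a : R) u v : S u -> S v -> S (a *: u + v).
  move=> [P sP <-] [Q sQ <-]; exists (fun x => a *: P x + Q x); first exact: smooth_sym_lin.
  rewrite /pack vdiv_tdiv_lin//; congr pair; first by rewrite restrictDE restrictZE.
  by apply/funext => i; apply/funext => j; rewrite entry_lin restrictDE restrictZE.
have [p [pX pS orth]] := @orthogonal_projection R V (@square_pair R d) S (@pair_dot R d)
  (@square_pair_lin R d) (@pair_dot_lin R d) (fun F G _ _ => pair_dotC F G)
  (fun F _ => pair_dot_ge0 F) (@square_pair_complete R d) SX S0 Slin F FX.
pose r : V := F - p.
have rX : square_pair r.
  by rewrite /r addrC -scaleN1r; exact: square_pair_lin pX FX.
(* linear relations that hold for the smooth pairs and for the given pair pass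
   to the residual *)
have limit G : square_pair G -> (forall Th v, square_pair (pack Th v) ->
    (smooth_sym Th /\ v = vdiv (tdiv Th)) \/ (Th = Theta /\ v = w) -> pair_dot (pack Th v) G = 0) ->
    pair_dot r G = 0.
  move=> GX h; rewrite /r addrC -scaleN1r (pair_dot_lin _ pX FX GX).
  rewrite (h Theta w FX (or_intror (conj erefl erefl))) addr0.
  rewrite (pair_dot_limit SX pX GX pS) ?mulr0// => _ [Psi sP <-].
  by apply: h; [exact: packX|left].
(* the projection is determined on A only; the residual is extended by zero *)
pose v := r.1 \_ A; pose E i j := r.2 i j \_ A.
have vL : v \in Lf := Lfun2_restrict mA rX.1.
have EL i j : E i j \in Lf := Lfun2_restrict mA (rX.2 i j).
have off f x : ~ A x -> (f \_ A) x = 0 :> R.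
  by move=> nA; rewrite patchE; case: ifPn => // /set_mem.
have restr f g : dot (f \_ A) g = dot f (g \_ A).
  by apply: eq_Rintegral => x _; rewrite !patchE; case: ifP; rewrite ?mul0r ?mulr0.
have roff f g : (forall x, ~ A x -> g x = 0) -> dot (f \_ A) g = dot f g.
  move=> g0; rewrite restr; congr (L2dot _ _ _); apply/funext => x; rewrite patchE.
  by case: ifPn => // /negP nA; rewrite g0// => /mem_set.
have vE phi : test_fun A phi -> dot v phi = \sum_i \sum_j dot (E i j) (hess_entry i j phi).
  move=> tphi; have [sp bp] := (tphi.1, test_fun_bsupp tphi).
  have hL i j := hess_entry_L2 i j sp bp.
  pose G : V := (phi, fun i j x => - hess_entry i j phi x).
  have GX : square_pair G by split=> [|i j]; [exact: smooth_bsupp_L2|exact: Lfun2N].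
  have pG H : square_pair H -> pair_dot H G = dot H.1 phi - \sum_i \sum_j dot (H.2 i j) (hess_entry i j phi).
    move=> [H1 H2]; rewrite /pair_dot -sumrN; congr (_ + _); apply: eq_bigr => i _.
    rewrite -sumrN; apply: eq_bigr => j _.
    by rewrite dotC (dotNl (hL i j) (H2 i j)) dotC.
  suff /eqP : pair_dot r G = 0.
    rewrite pG// subr_eq0 => /eqP h; rewrite /v roff; last exact: test_off tphi.
    rewrite h; apply: eq_bigr => i _; apply: eq_bigr => j _.
    by rewrite /E roff//; exact: hess_test_off tphi.
  apply: limit => // Th u PX hTh; rewrite pG//; apply/eqP; rewrite subr_eq0; apply/eqP.
  have iT : is_divdiv A Th u.
    by case: hTh => [[sT ->]|[-> ->]]; [exact: is_divdiv_smooth|split].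
  have := iT.2 phi tphi; rewrite ip_restrict -restr (roff (u \_ A)); last exact: test_off tphi.
  move=> ->; rewrite ipM_sum.
  - apply: eq_bigr => i _; apply: eq_bigr => j _; rewrite entry_hess ip_restrict -restr.
    by rewrite (roff (_ \_ A))//; exact: hess_test_off tphi.
  - exact: PX.2.
  - by move=> i j; rewrite entry_hess; apply: L2_smooth => //; exact: smooth_hess_entry.
(* symmetry passes to the limit in the weak sense *)
have Esym i j theta : smooth theta -> bsupp theta -> dot (r.2 i j) (theta \_ A) = dot (r.2 j i) (theta \_ A).
  move=> st bt; have tL : theta \_ A \in Lf := Lfun2_restrict mA (smooth_bsupp_L2 st bt).
  pose c k l : R := ((k == i) && (l == j))%:R - ((k == j) && (l == i))%:R.
  pose G : V := (fun=> 0, fun k l x => c k l * (theta \_ A) x).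
  have GX : square_pair G by split=> [|k l]; [exact: Lfun2_0|exact: Lfun2Z].
  have pG H : square_pair H -> pair_dot H G = dot (H.2 i j) (theta \_ A) - dot (H.2 j i) (theta \_ A).
    move=> [H1 H2]; rewrite /pair_dot dotC dot0l add0r.
    rewrite -(sum_delta (fun k l => dot (H.2 k l) (theta \_ A)) i j).
    rewrite -(sum_delta (fun k l => dot (H.2 k l) (theta \_ A)) j i).
    rewrite -sumrB; apply: eq_bigr => k _; rewrite -sumrB; apply: eq_bigr => l _.
    by rewrite dotC (dotZl _ tL (H2 k l)) dotC /c mulrBl.
  suff /eqP : pair_dot r G = 0 by rewrite pG// subr_eq0 => /eqP.
  apply: limit => // Th u PX hTh; rewrite pG//; apply/eqP; rewrite subr_eq0; apply/eqP.
  congr (L2dot _ _ _); apply/funext => x; rewrite /pack/= !patchE; case: ifPn => // /set_mem Ax.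
  case: hTh => [[sT _]|[-> _]]; first by rewrite (smooth_sym_tr _ _ sT).
  by rewrite /entry -{1}(Tsym x Ax) mxE.
have Ev i j theta : smooth theta -> bsupp theta ->
    dot (E i j) theta = - dot v (hess_entry i j theta).
  move=> st bt; have sT := smooth_sym_tensor i j st.
  have tL : theta \_ A \in Lf := Lfun2_restrict mA (smooth_bsupp_L2 st bt).
  have := orth _ (ex_intro2 _ _ (sym_tensor theta i j) sT erefl).
  rewrite -/r /pair_dot/= vdiv_tdiv_sym_tensor// /v /E !restr addrC => /eqP.
  rewrite addr_eq0 => /eqP <-.
  transitivity (2^-1 * (dot (r.2 i j) (theta \_ A) + dot (r.2 j i) (theta \_ A))).
    by rewrite -(Esym i j)//; lra.
  rewrite -(sum_sym_coef (fun k l => dot (r.2 k l) (theta \_ A))).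
  apply: eq_bigr => k _; apply: eq_bigr => l _.
  by rewrite entry_sym_tensor restrictZE [RHS]dotC (dotZl _ tL (rX.2 k l)) dotC.
have r0 := biorthogonal_eq0 oA bA lA vL EL (off _) (fun i j => off _) vE Ev.
move=> e e0; have e2 : 0 < e / 2 by rewrite divr_gt0.
have [_ [Psi sP <-] se] := pS (e / 2) e2; exists Psi => //.
pose t : V := F - pack Psi (vdiv (tdiv Psi)).
have ipt : ip A (fun x => w x - vdiv (tdiv Psi) x) (fun x => w x - vdiv (tdiv Psi) x) = sqn t.1.
  by rewrite ip_restrict restrictBE.
have tX : square_pair t.
  by rewrite /t addrC -scaleN1r; exact: square_pair_lin (packX _ sP) FX.
have eE i j : entry (fun x => Theta x - Psi x) i j = fun x => entry Theta i j x - entry Psi i j x.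
  by apply/funext => x; rewrite /entry !mxE.
have ipMt : ipM A (fun x => Theta x - Psi x) (fun x => Theta x - Psi x) = \sum_i \sum_j sqn (t.2 i j).
  have L i j : L2 A (entry (fun x => Theta x - Psi x) i j).
    have := tX.2 i j; rewrite eE /L2/= restrictBE; exact.
  rewrite ipM_sum//; apply: eq_bigr => i _; apply: eq_bigr => j _.
  by rewrite ip_restrict eE restrictBE.
rewrite ipt ipMt addrC -/(pair_dot t t).
(* as the residual vanishes on A, the error is the distance q from the projection
   to the smooth pair *)
pose q : V := p - pack Psi (vdiv (tdiv Psi)).
have qX : square_pair q.
  by rewrite /q addrC -scaleN1r; exact: square_pair_lin (packX _ sP) pX.
pose restrict H : V := (H.1 \_ A, fun i j => H.2 i j \_ A).
have restrictX H : square_pair H -> square_pair (restrict H).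
  by move=> [H1 H2]; split=> [|i j]; exact: Lfun2_restrict.
have idem f : (f \_ A) \_ A = f \_ A by apply/funext => x; rewrite !patchE; case: (x \in A).
have -> : t = restrict r + restrict q.
  have -> : t = restrict t.
    have t1 : t.1 \_ A = t.1.
      by rewrite -[t.1]/(fun x => (w \_ A) x - (vdiv (tdiv Psi) \_ A) x) -restrictBE idem.
    have t2 i j : t.2 i j \_ A = t.2 i j.
      by rewrite -[t.2 i j]/(fun x => (entry Theta i j \_ A) x - (entry Psi i j \_ A) x) -restrictBE idem.
    apply: injective_projections; first by rewrite /= t1.
    by apply/funext => i; apply/funext => j; rewrite /= t2.
  have -> : t = r + q by rewrite /t /r /q addrA subrK.
  congr pair; first exact: restrictDE.
  by apply/funext => i; apply/funext => j; exact: restrictDE.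
apply: le_lt_trans (pair_dot_sqD_le (restrictX _ rX) (restrictX _ qX)) _.
rewrite -[pair_dot (restrict r) _]/(sqn v + \sum_i \sum_j sqn (E i j)) r0 mulr0 add0r.
have shrink f : f \in Lf -> sqn (f \_ A) <= sqn f.
  move=> fL; apply: dot_le => //; first exact: Lfun2_measurable (Lfun2_restrict mA fL).
  by move=> x; rewrite patchE; case: ifP => // _; rewrite normr0.
have : pair_dot (restrict q) (restrict q) <= pair_dot q q.
  apply: lerD; first exact: shrink qX.1.
  by apply: ler_sum => i _; apply: ler_sum => j _; exact: shrink (qX.2 i j).
by move: se; rewrite -(pair_dotNN q) opprB; lra.
Qed.

End density.

(** * Weak double divergences and Hessians *)

Section weak_operators.
Context (R : realType) (d : nat).
Local Notation pt := 'rV[R]_d.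
Local Notation tensor := (pt -> 'M[R]_d).
Local Notation leb := (@lebesgue_rV R d).
Local Notation dot := (L2dot leb).
Local Notation V := ((pt -> R) * ('I_d -> 'I_d -> pt -> R))%type.
Implicit Types (f g w z phi theta : pt -> R) (Theta Psi H : tensor) (A : set pt)
  (i j k l : 'I_d).

Definition ae_on A f g := \forall x \ae leb, A x -> f x = g x.

Lemma ip_C A f g : ip A f g = ip A g f.
Proof. by rewrite !ip_restrict dotC. Qed.

Lemma ipM_C A Theta Psi : ipM A Theta Psi = ipM A Psi Theta.
Proof.
apply: eq_Rintegral => x _; apply: eq_bigr => i _; apply: eq_bigr => j _; exact: mulrC.
Qed.

Lemma ip_ge0 A f : 0 <= ip A f f.
Proof. by rewrite ip_restrict dot_ge0. Qed.

Lemma L2B A f g : L2 A f -> L2 A g -> L2 A (fun x => f x - g x).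
Proof. by move=> fL gL; rewrite /L2/= restrictBE; exact: Lfun2B. Qed.

Lemma L2Z A (a : R) f : L2 A f -> L2 A (fun x => a * f x).
Proof. by move=> fL; rewrite /L2/= restrictZE; exact: Lfun2Z. Qed.

Lemma L2_sub A B f : measurable A -> A `<=` B -> L2 B f -> L2 A f.
Proof.
move=> mA AB fL; rewrite /L2/= (_ : f \_ A = (f \_ B) \_ A); first exact: Lfun2_restrict.
apply/funext => x; rewrite !patchE; case: ifPn => // /set_mem/AB Bx.
by rewrite mem_set.
Qed.

Lemma ipBl A f g h : L2 A f -> L2 A g -> L2 A h ->
  ip A (fun x => f x - g x) h = ip A f h - ip A g h.
Proof. by move=> fL gL hL; rewrite !ip_restrict restrictBE dotBl. Qed.

Lemma ip_ae A f f' g : L2 A f -> L2 A f' -> L2 A g -> ae_on A f f' -> ip A f g = ip A f' g.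
Proof.
move=> fL f'L gL ff'; rewrite !ip_restrict; apply: dot_ae.
- exact: Lfun2_measurable fL.
- exact: Lfun2_measurable f'L.
- exact: Lfun2_measurable gL.
by apply: filterS ff' => x fx; rewrite !patchE; case: ifPn => // /set_mem.
Qed.

Lemma ip_ae_sq A f f' : L2 A f -> L2 A f' -> ae_on A f f' -> ip A f f = ip A f' f'.
Proof. by move=> fL f'L ff'; rewrite (ip_ae fL f'L)// ip_C (ip_ae fL f'L). Qed.

Lemma ipM_off A Theta Psi : (forall x, ~ A x -> Psi x = 0) ->
  ipM A Theta Psi = \int[leb]_x (\sum_i \sum_j Theta x i j * Psi x i j).
Proof.
move=> P0; rewrite /ipM Rintegral_mkcond; apply: eq_Rintegral => x _; rewrite patchE.
case: ifPn => // /negP nA; rewrite big1// => i _; rewrite big1// => j _.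
by rewrite P0 ?mxE ?mulr0// => /mem_set.
Qed.

Lemma is_divdivB A Theta Theta' w w' : open A -> bounded_set A -> L2s A Theta -> L2s A Theta' ->
  is_divdiv A Theta w -> is_divdiv A Theta' w' ->
  is_divdiv A (fun x => Theta x - Theta' x) (fun x => w x - w' x).
Proof.
move=> oA bA [TL _] [TL' _] [wL wT] [wL' wT']; split; first exact: L2B.
move=> phi tphi; have sp := tphi.1.
have hL i j : L2 A (entry (symgrad (grad phi)) i j).
  by rewrite entry_hess; apply: L2_smooth => //; exact: smooth_hess_entry.
have eE i j : entry (fun x => Theta x - Theta' x) i j = fun x => entry Theta i j x - entry Theta' i j x.
  by apply/funext => x; rewrite /entry !mxE.
rewrite ipBl//; last exact: L2_smooth.
rewrite wT// wT'// !ipM_sum// => [|i j]; last by rewrite eE; apply: L2B; [exact: TL|exact: TL'].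
rewrite -sumrB; apply: eq_bigr => i _; rewrite -sumrB; apply: eq_bigr => j _.
by rewrite eE ipBl//; [exact: TL|exact: TL'].
Qed.

Lemma vdiv_tdiv_off A Phi : test_sym A Phi -> forall x, ~ A x -> vdiv (tdiv Phi) x = 0.
Proof.
move=> tP x nA; have [sP [K [cK KA K0]]] := tP.
rewrite vdiv_tdivE; last by move=> i j; exact: smooth_entry.
have clK : closed K by apply: compact_closed => //; exact: norm_hausdorff.
rewrite big1// => i _; rewrite big1// => j _.
have e0 y : ~ K y -> entry Phi i j y = 0 by move=> /K0 Py; rewrite /entry Py mxE.
by apply: (partial_off i clK (partial_off j clK e0)) => /KA.
Qed.

Lemma test_sym_tensor A phi i j : test_fun A phi -> test_sym A (sym_tensor phi i j).
Proof.
move=> [sp [K [cK KA K0]]]; split; first exact: smooth_sym_tensor.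
by exists K; split=> // x nK; apply/matrixP => k l; rewrite !mxE K0// mulr0.
Qed.

Lemma divdiv_unique A Theta w w' : open A -> is_divdiv A Theta w -> is_divdiv A Theta w' ->
  ae_on A w w'.
Proof.
move=> oA [wL wT] [wL' wT'].
have h := @fundamental_lemma _ _ A (fun x => w x - w' x) oA (L2B wL wL').
apply: filterS (h _) => [x xe Ax|phi tphi].
  by have /eqP := xe Ax; rewrite subr_eq0 => /eqP.
have pL : (phi \_ A) \in Lfun leb 2%:E.
  rewrite (_ : phi \_ A = phi); first by apply: smooth_bsupp_L2; [exact: tphi.1|exact: test_fun_bsupp tphi].
  apply/funext => x; rewrite patchE; case: ifPn => // /negP nA.
  by rewrite (test_off tphi)// => /mem_set.
by rewrite ipBl// wT// wT'// subrr.
Qed.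

(** A symmetrized test tensor isolates a single entry, since H and its rival are both
    symmetric. *)
Lemma hess_unique A z H H' i j : open A -> is_hess A z H -> is_hess A z H' ->
  ae_on A (entry H i j) (entry H' i j).
Proof.
move=> oA [[HL Hs] HT] [[HL' Hs'] HT'].
have h := @fundamental_lemma _ _ A (fun x => entry H i j x - entry H' i j x) oA (L2B (HL i j) (HL' i j)).
apply: filterS (h _) => [x xe Ax|phi tphi].
  by have /eqP := xe Ax; rewrite subr_eq0 => /eqP.
have pL : L2 A phi.
  rewrite /L2/= (_ : phi \_ A = phi); first by apply: smooth_bsupp_L2; [exact: tphi.1|exact: test_fun_bsupp tphi].
  apply/funext => x; rewrite patchE; case: ifPn => // /negP nA.
  by rewrite (test_off tphi)// => /mem_set.
have key G : (forall k l, L2 A (entry G k l)) -> (forall x, A x -> (G x)^T = G x) ->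
    ipM A G (sym_tensor phi i j) = ip A (entry G i j) phi.
  move=> GL Gs; rewrite ipM_sum// => [|k l]; last by rewrite entry_sym_tensor; exact: L2Z.
  transitivity (\sum_k \sum_l sym_coef R i j k l * ip A (entry G k l) phi).
    apply: eq_bigr => k _; apply: eq_bigr => l _; rewrite entry_sym_tensor !ip_restrict restrictZE.
    by rewrite dotC (dotZl _ pL (GL k l)) dotC.
  rewrite sum_sym_coef (_ : ip A (entry G j i) phi = ip A (entry G i j) phi); first by lra.
  apply: eq_Rintegral => x /set_mem Ax; congr (_ * _).
  by rewrite /entry -{1}(Gs x Ax) mxE.
have tP := test_sym_tensor i j tphi.
by rewrite ipBl//; [rewrite -(key H)// -(key H')// HT// HT'// subrr|exact: HL|exact: HL'].
Qed.

Lemma is_hess_get A z H : is_hess A z H -> is_hess A z (hess A z).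
Proof. by move=> h; exact: (@getPex _ [set H | is_hess A z H] (ex_intro _ H h)). Qed.

Lemma is_divdiv_get A Theta w : is_divdiv A Theta w -> is_divdiv A Theta (divdiv A Theta).
Proof. by move=> h; exact: (@getPex _ [set w | is_divdiv A Theta w] (ex_intro _ w h)). Qed.

(** The chosen double divergence agrees with any other one almost everywhere. *)
Lemma norm_divdivE A Theta w : open A -> is_divdiv A Theta w ->
  norm_divdiv A Theta = Num.sqrt (ipM A Theta Theta + ip A w w).
Proof.
move=> oA wT; have dT := is_divdiv_get wT; congr (Num.sqrt (_ + _)).
exact: ip_ae_sq dT.1 wT.1 (divdiv_unique oA dT wT).
Qed.

Lemma norm_H2E A z H : open A -> is_hess A z H ->
  norm_H2 A z = Num.sqrt (ip A z z + ipM A H H).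
Proof.
move=> oA zH; have dH := is_hess_get zH; congr (Num.sqrt (_ + _)).
rewrite !ipM_sum; try exact: dH.1.1; try exact: zH.1.1.
apply: eq_bigr => i _; apply: eq_bigr => j _.
exact: ip_ae_sq (dH.1.1 i j) (zH.1.1 i j) (hess_unique i j oA dH zH).
Qed.

Lemma bracketE A Theta z w H : open A -> L2s A Theta -> L2 A z -> is_divdiv A Theta w ->
  is_hess A z H -> bracket A Theta z = ip A w z - ipM A Theta H.
Proof.
move=> oA [TL _] zL wT zH; have dT := is_divdiv_get wT; have dH := is_hess_get zH.
rewrite /bracket (ip_ae dT.1 wT.1 zL (divdiv_unique oA dT wT)); congr (_ - _).
rewrite !ipM_sum; try exact: dH.1.1; try exact: zH.1.1; try exact: TL.
apply: eq_bigr => i _; apply: eq_bigr => j _; rewrite ip_C [RHS]ip_C.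
exact: ip_ae (dH.1.1 i j) (zH.1.1 i j) (TL i j) (hess_unique i j oA dH zH).
Qed.

(** Test functions on A are test functions on B, and the integrals only see their
    supports. *)
Lemma is_divdiv_sub A B Theta w : measurable A -> A `<=` B -> is_divdiv B Theta w ->
  is_divdiv A Theta w.
Proof.
move=> mA AB [wL wT]; split; first exact: L2_sub wL.
move=> phi tphi; have [sp [K [cK KA K0]]] := tphi.
have tB : test_fun B phi by split=> //; exists K; split=> // x /KA/AB.
have off C : test_fun C phi -> forall x, ~ C x -> symgrad (grad phi) x = 0.
  move=> tC x nC; apply/matrixP => i j; rewrite symgrad_grad mxE.
  exact: hess_test_off tC x nC.
have := wT phi tB; rewrite !ip_off; try exact: test_off.
by rewrite !ipM_off//; exact: off.
Qed.

Lemma L2s_sub A B Theta : measurable A -> A `<=` B -> L2s B Theta -> L2s A Theta.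
Proof. by move=> mA AB [TL Ts]; split=> [i j|x /AB/Ts//]; exact: L2_sub (TL i j). Qed.

Lemma is_hess_sub A B z H : measurable A -> A `<=` B -> is_hess B z H -> is_hess A z H.
Proof.
move=> mA AB [HL HT]; split; first exact: L2s_sub HL.
move=> Phi tP; have [sP [K [cK KA K0]]] := tP.
have tB : test_sym B Phi by split=> //; exists K; split=> // x /KA/AB.
have off C : test_sym C Phi -> forall x, ~ C x -> Phi x = 0.
  by move=> [_ [L [_ LC L0]]] x nC; apply: L0 => /LC.
have := HT Phi tB; rewrite !ipM_off; try exact: off.
by rewrite !ip_off//; exact: vdiv_tdiv_off.
Qed.

Lemma is_hessB A z z' H H' : open A -> bounded_set A -> L2 A z -> L2 A z' ->
  is_hess A z H -> is_hess A z' H' ->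
  is_hess A (fun x => z x - z' x) (fun x => H x - H' x).
Proof.
move=> oA bA zL zL' [[HL Hs] HT] [[HL' Hs'] HT'].
have eE i j : entry (fun x => H x - H' x) i j = fun x => entry H i j x - entry H' i j x.
  by apply/funext => x; rewrite /entry !mxE.
have BL i j : L2 A (entry (fun x => H x - H' x) i j).
  by rewrite eE; apply: L2B; [exact: HL|exact: HL'].
split; first by split=> // x Ax; rewrite linearB/= Hs// Hs'.
move=> Phi tP; have sP := tP.1.
have PL i j : L2 A (entry Phi i j) by apply: L2_smooth => //; exact: smooth_entry.
have vL : L2 A (vdiv (tdiv Phi)).
  by apply: L2_smooth => //; apply: smooth_vdiv_tdiv => i j; exact: smooth_entry.
rewrite ipBl// -HT// -HT'// !ipM_sum//.
rewrite -sumrB; apply: eq_bigr => i _; rewrite -sumrB; apply: eq_bigr => j _.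
by rewrite eE ipBl//; [exact: HL|exact: HL'].
Qed.

End weak_operators.

(** * Restriction to a mesh and gluing *)

Section mesh_pieces.
Context (R : realType) (d : nat).
Local Notation pt := 'rV[R]_d.
Local Notation tensor := (pt -> 'M[R]_d).
Local Notation leb := (@lebesgue_rV R d).
Local Notation dot := (L2dot leb).
Local Notation V := ((pt -> R) * ('I_d -> 'I_d -> pt -> R))%type.
Implicit Types (f g w z phi theta : pt -> R) (Theta Psi H : tensor) (A B : set pt)
  (k l : 'I_d).

Lemma bounded_subset A B : A `<=` B -> bounded_set B -> bounded_set A.
Proof. by move=> AB [M [Mr h]]; exists M; split=> // N MN x /AB; exact: h. Qed.

Lemma L2s_smooth A Psi : open A -> bounded_set A -> smooth_sym Psi -> L2s A Psi.
Proof.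
move=> oA bA sP; split=> [k l|x _]; last exact: sP.2.
by apply: L2_smooth => //; exact: sP.1.
Qed.

(** On a Lipschitz domain the closure of the smooth tensors is the whole ambient
    space, by density. *)
Lemma ambient_Hdivdiv A Theta : open A -> bounded_set A -> lipschitz_boundary A ->
  Hdivdiv_ambient A Theta -> Hdivdiv A Theta.
Proof.
move=> oA bA lA aT; split=> // e e0; have [TL [w wT]] := aT.
have [Psi sP Pe] := smooth_sym_dense oA bA lA TL wT (exprn_gt0 2 e0).
exists Psi => //.
have dT := is_divdivB oA bA TL (L2s_smooth oA bA sP) wT (is_divdiv_smooth oA bA sP).
rewrite (norm_divdivE oA dT).
by rewrite -[ltRHS]gtr0_norm// -sqrtr_sqr ltr_sqrt ?exprn_gt0.
Qed.

Lemma L2_test A phi : open A -> bounded_set A -> test_fun A phi -> L2 A phi.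
Proof. by move=> oA bA tphi; apply: L2_smooth => //; exact: tphi.1. Qed.

Lemma ip0l A f : ip A (fun=> 0) f = 0.
Proof.
rewrite ip_restrict -[RHS](dot0l leb (f \_ A)); congr (L2dot _ _ _).
by apply/funext => x; rewrite patchE; case: ifP.
Qed.

Lemma ipM0l A Theta : ipM A (fun=> 0) Theta = 0.
Proof.
rewrite -(ip0l A (fun=> 0)); apply: eq_Rintegral => x _; rewrite mul0r big1// => k _.
by rewrite big1// => l _; rewrite mxE mul0r.
Qed.

Lemma H20_test A phi : open A -> bounded_set A -> test_fun A phi -> H20 A phi.
Proof.
move=> oA bA tphi; have hT := is_hess_test oA bA tphi; have pL := L2_test oA bA tphi.
split; first by split=> //; exists (symgrad (grad phi)).
move=> e e0; exists phi => //.
rewrite (norm_H2E oA (is_hessB oA bA pL pL hT hT)).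
have -> : (fun x => phi x - phi x) = fun=> 0 by apply/funext => x; rewrite subrr.
have -> : (fun x => symgrad (grad phi) x - symgrad (grad phi) x) = fun=> 0.
  by apply/funext => x; rewrite subrr.
by rewrite ip0l ipM0l addr0 sqrtr0.
Qed.

Definition pack A w Theta : V := (w \_ A, fun k l => entry Theta k l \_ A).

Lemma pair_dot_pack A w w' Theta Theta' : L2s A Theta -> L2s A Theta' ->
  pair_dot (pack A w Theta) (pack A w' Theta') = ip A w w' + ipM A Theta Theta'.
Proof.
move=> [TL _] [TL' _]; rewrite ipM_sum//; congr (_ + _); first by rewrite ip_restrict.
by apply: eq_bigr => k _; apply: eq_bigr => l _; rewrite ip_restrict.
Qed.

Lemma packB A w w' Theta Theta' : pack A w Theta - pack A w' Theta' =
  pack A (fun x => w x - w' x) (fun x => Theta x - Theta' x).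
Proof.
congr pair; first by rewrite restrictBE.
apply/funext => k; apply/funext => l.
rewrite (_ : entry _ k l = fun x => entry Theta k l x - entry Theta' k l x) ?restrictBE//.
by apply/funext => x; rewrite /entry !mxE.
Qed.

(** The bracket is continuous in its second argument and vanishes on the test
    functions. *)
Lemma bracket_H20 A Theta z : open A -> bounded_set A -> Hdivdiv_ambient A Theta ->
  H20 A z -> bracket A Theta z = 0.
Proof.
move=> oA bA [TL [w wT]] [[zL [H zH]] zapprox].
rewrite (bracketE oA TL zL wT zH).
pose N H' := fun x => - H' x : 'M[R]_d.
have NE H' k l : entry (N H') k l = fun x => - entry H' k l x.
  by apply/funext => x; rewrite /entry !mxE.
have NL H' : L2s A H' -> L2s A (N H').
  move=> [hL hs]; split=> [k l|x Ax]; last by rewrite /N linearN/= hs.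
  rewrite -[fun x => _]/(entry (N H') k l) NE /L2/= restrictNE; exact: Lfun2N (hL k l).
have ipN H' H'' : L2s A H' -> L2s A H'' -> ipM A (N H') H'' = - ipM A H' H''.
  move=> hL hL'; rewrite !ipM_sum; try exact: (NL _ hL).1; try exact: hL.1; try exact: hL'.1.
  rewrite -sumrN; apply: eq_bigr => k _; rewrite -sumrN; apply: eq_bigr => l _.
  rewrite NE !ip_restrict restrictNE dotNl//; [exact: hL.1|exact: hL'.1].
suff : pair_dot (pack A z (N H)) (pack A w Theta) = 0.
  rewrite pair_dot_pack//; last exact: NL zH.1.
  by rewrite (ipN _ _ zH.1 TL) ip_C ipM_C.
pose S : set V := [set pack A phi (N (symgrad (grad phi))) | phi in test_fun A].
have sqp f Psi : L2 A f -> L2s A Psi -> square_pair (pack A f Psi).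
  by move=> fL [PL _]; split.
have hT phi (t : test_fun A phi) := is_hess_test oA bA t.
apply: (@pair_dot_limit _ _ S).
- by move=> _ [phi tphi <-]; apply: sqp; [exact: L2_test|exact: NL (hT _ tphi).1].
- by apply: sqp => //; exact: NL zH.1.
- by apply: sqp => //; exact: wT.1.
- move=> e e0; have se : 0 < Num.sqrt e by rewrite sqrtr_gt0.
  have [phi tphi phie] := zapprox _ se.
  exists (pack A phi (N (symgrad (grad phi)))); first by exists phi.
  have hB := is_hessB oA bA zL (L2_test oA bA tphi) zH (hT _ tphi).
  move: phie; rewrite (norm_H2E oA hB) ltr_sqrt//; apply: le_lt_trans.
  rewrite -opprB pair_dotNN packB.
  have NB : (fun x => N H x - N (symgrad (grad phi)) x) = N (fun x => H x - symgrad (grad phi) x).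
    by apply/funext => x; rewrite /N opprB opprK addrC.
  rewrite NB pair_dot_pack; try exact: NL hB.1.
  rewrite ipN; [|exact: hB.1|exact: NL hB.1].
  by rewrite ipM_C ipN ?opprK//; exact: hB.1.
- move=> _ [phi tphi <-]; rewrite pair_dot_pack//; last exact: NL (hT _ tphi).1.
  by rewrite (ipN _ _ (hT _ tphi).1 TL) ip_C wT.2// ipM_C subrr.
Qed.

End mesh_pieces.

Section mesh_pieces_sum.
Context (R : realType) (d : nat).
Local Notation pt := 'rV[R]_d.
Local Notation tensor := (pt -> 'M[R]_d).
Local Notation leb := (@lebesgue_rV R d).
Local Notation dot := (L2dot leb).
Context (Omega : set pt) (I : finType) (T : I -> set pt).
Hypothesis openOmega : open Omega.
Hypothesis bndOmega : bounded_set Omega.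
Hypothesis lipOmega : lipschitz_boundary Omega.
Hypothesis meshT : mesh Omega T.
Implicit Types (f g w z phi theta : pt -> R) (Theta Psi H : tensor) (k l : 'I_d) (i j : I).

Let oT : forall i, open (T i). Proof. by case: meshT. Qed.
Let mT i : measurable (T i) := measurable_open (@oT i).
Let mO : measurable Omega := measurable_open openOmega.
Let sT : forall i, T i `<=` Omega. Proof. by case: meshT. Qed.
Let bT i : bounded_set (T i) := bounded_subset (@sT i) bndOmega.
Let lT : forall i, lipschitz_boundary (T i). Proof. by case: meshT. Qed.

Lemma mesh_inj i j x : T i x -> T j x -> i = j.
Proof.
by move=> Tx Tx'; have := mesh_disjoint meshT; apply => //; exists x.
Qed.

(** A point of Omega outside of all elements lies on the boundary of one of them, and
    these boundaries are null sets. *)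
Lemma mesh_ae : \forall x \ae leb, Omega x -> exists i, T i x.
Proof.
have h i : \forall x \ae leb, ~ (closure (T i) `\` T i) x.
  exists (closure (T i) `\` T i); split.
  - apply: measurableD => //; apply: measurable_closed; exact: closed_closure.
  - exact: boundary_null.
  - by move=> x /contrapT.
have : \forall x \ae leb, forall i, ~ (closure (T i) `\` T i) x by exact: filter_forall.
apply: filterS => x hx Ox.
have : (\bigcup_(i in [set: I]) closure (T i)) x.
  by rewrite (mesh_cover meshT); exact: subset_closure.
by move=> [i _ cTx]; exists i; apply: contrapT => nT; exact: (hx i).
Qed.

Lemma restrict_mesh f : \forall x \ae leb, (f \_ Omega) x = \sum_i (f \_ (T i)) x.
Proof.
apply: filterS mesh_ae => x hx; rewrite patchE; case: ifPn => [/set_mem/hx[i Tx]|nO].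
  rewrite (bigD1 i)//= big1 ?addr0; first by rewrite patchE mem_set.
  move=> j ji; rewrite patchE memNset// => Tjx.
  by move: ji; rewrite (mesh_inj Tjx Tx) eqxx.
rewrite big1// => i _; rewrite patchE memNset// => /sT Ox.
by move/negP: nO; apply; exact: mem_set.
Qed.

Lemma L2_piece i f : L2 Omega f -> L2 (T i) f.
Proof. exact: L2_sub. Qed.

Lemma ip_mesh f g : L2 Omega f -> L2 Omega g -> ip Omega f g = \sum_i ip (T i) f g.
Proof.
move=> fL gL; have fTL i : f \_ (T i) \in Lfun leb 2%:E := L2_piece i fL.
have sL : (fun x => \sum_i (f \_ (T i)) x) \in Lfun leb 2%:E.
  by apply: Lfun2_sum => i _; exact: fTL.
rewrite ip_restrict (dot_ae (Lfun2_measurable fL) (Lfun2_measurable sL) (Lfun2_measurable gL) (restrict_mesh f)).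
rewrite dot_suml//; apply: eq_bigr => i _; rewrite ip_restrict.
apply: eq_Rintegral => x _; rewrite !patchE; case: ifPn; rewrite ?mul0r// => /set_mem/sT Ox.
by rewrite mem_set.
Qed.

Lemma ipM_mesh Theta Psi : L2s Omega Theta -> L2s Omega Psi ->
  ipM Omega Theta Psi = \sum_i ipM (T i) Theta Psi.
Proof.
move=> [TL _] [PL _].
have -> : \sum_i ipM (T i) Theta Psi =
    \sum_i \sum_k \sum_l ip (T i) (entry Theta k l) (entry Psi k l).
  apply: eq_bigr => i _; apply: ipM_sum => k l; apply: L2_piece; [exact: TL|exact: PL].
rewrite ipM_sum// [RHS]exchange_big/=; apply: eq_bigr => k _.
rewrite [RHS]exchange_big/=; apply: eq_bigr => l _; apply: ip_mesh; [exact: TL|exact: PL].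
Qed.

Definition piecewise (W : nmodType) (f : I -> pt -> W) : pt -> W :=
  fun x => \sum_i (if x \in T i then f i x else 0).

Lemma piecewiseE (W : nmodType) (f : I -> pt -> W) i x : T i x -> piecewise f x = f i x.
Proof.
move=> Tx; rewrite /piecewise (bigD1 i)//= mem_set// big1 ?addr0// => j ji.
by rewrite memNset// => Tjx; move: ji; rewrite (mesh_inj Tjx Tx) eqxx.
Qed.

Lemma piecewise_off (W : nmodType) (f : I -> pt -> W) x : (forall i, ~ T i x) -> piecewise f x = 0.
Proof. by move=> nT; rewrite /piecewise big1// => i _; rewrite memNset. Qed.

Lemma L2_piecewise (f : I -> pt -> R) : (forall i, L2 (T i) (f i)) -> L2 Omega (piecewise f).
Proof.
move=> fL; apply: Lfun2_restrict => //.
rewrite (_ : piecewise f = fun x => \sum_i (f i \_ (T i)) x).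
  by apply: Lfun2_sum => i _; exact: fL.
by apply/funext => x; apply: eq_bigr => i _; rewrite patchE.
Qed.

Lemma L2s_piecewise (F : I -> tensor) : (forall i, L2s (T i) (F i)) -> L2s Omega (piecewise F).
Proof.
move=> FL; split=> [k l|x _].
  rewrite (_ : (fun x => _) = piecewise (fun i => entry (F i) k l)).
    by apply: L2_piecewise => i; exact: (FL i).1.
  apply/funext => x; rewrite /piecewise summxE; apply: eq_bigr => i _.
  by case: ifP => //; rewrite mxE.
have [[i Tx]|nT] := pselect (exists i, T i x); first by rewrite (piecewiseE _ Tx) (FL i).2.
by rewrite piecewise_off ?trmx0// => i Tx; apply: nT; exists i.
Qed.

Lemma L2s_piece i Theta : L2s Omega Theta -> L2s (T i) Theta.
Proof. exact: L2s_sub. Qed.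

Lemma Hdivdiv_ambient_piece i Theta : Hdivdiv_ambient Omega Theta ->
  Hdivdiv_ambient (T i) Theta.
Proof.
move=> [TL [w wT]]; split; first exact: L2s_piece.
by exists w; exact: is_divdiv_sub wT.
Qed.

Lemma norm_divdiv_mesh Theta : Hdivdiv_ambient Omega Theta ->
  norm_divdiv Omega Theta ^+ 2 = \sum_i norm_divdiv (T i) Theta ^+ 2.
Proof.
move=> [TL [w wT]]; have ge0 A w' : 0 <= ipM A Theta Theta + ip A w' w'.
  rewrite addr_ge0 ?ip_ge0//; apply: Rintegral_ge0 => x _.
  by apply: sumr_ge0 => k _; apply: sumr_ge0 => l _; rewrite -expr2 sqr_ge0.
rewrite (norm_divdivE openOmega wT) sqr_sqrtr// ip_mesh ?ipM_mesh//; try exact: wT.1.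
rewrite -big_split/=; apply: eq_bigr => i _.
by rewrite (norm_divdivE (@oT i) (is_divdiv_sub (mT i) (@sT i) wT)) sqr_sqrtr.
Qed.

Lemma bracket_mesh Theta z w H : L2s Omega Theta -> L2 Omega z -> L2 Omega w ->
  (forall i, is_divdiv (T i) Theta w) -> is_hess Omega z H ->
  \sum_i bracket (T i) Theta z = ip Omega w z - ipM Omega Theta H.
Proof.
move=> TL zL wL wT zH.
rewrite (ip_mesh wL zL) (ipM_mesh TL zH.1) -sumrB; apply: eq_bigr => i _.
apply: bracketE => //; [exact: L2s_piece|exact: L2_piece|exact: is_hess_sub zH].
Qed.

(** Restricting to an element does not increase the norm, and the approximating test
    functions are smooth on it. *)
Lemma H2_piece i z : H20 Omega z -> H2 (T i) z.
Proof.
move=> [[zL [H zH]] zapprox]; split.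
  by split; [exact: L2_piece|exists H; exact: is_hess_sub zH].
move=> e e0; have [phi tphi phie] := zapprox e e0; exists phi; first exact: tphi.1.
apply: le_lt_trans phie.
have hB := is_hessB openOmega bndOmega zL (L2_test openOmega bndOmega tphi) zH
  (is_hess_test openOmega bndOmega tphi).
have zpL : L2 Omega (fun x => z x - phi x) by apply: L2B => //; exact: L2_test.
rewrite (norm_H2E openOmega hB) (norm_H2E (@oT i) (is_hess_sub (mT i) (@sT i) hB)).
have mono f : L2 Omega f -> ip (T i) f f <= ip Omega f f.
  by move=> fL; rewrite ip_mesh// (bigD1 i)//= lerDl sumr_ge0// => j _; exact: ip_ge0.
have [BL _] := hB.1.
apply: ler_wsqrtr; apply: lerD; first exact: mono.
rewrite !ipM_sum// => [|k l|k l]; try exact: L2_piece (BL k l).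
by apply: ler_sum => k _; apply: ler_sum => l _; apply: mono; exact: BL.
Qed.

(** The sum of the brackets is the bracket over Omega of the glued double divergence.
    Its vanishing on test functions says that this is the weak double divergence of
    Theta on Omega, and density does the rest. *)
Lemma Hdivdiv_mesh_iff Theta : L2s Omega Theta -> (forall i, Hdivdiv (T i) Theta) ->
  Hdivdiv Omega Theta <-> forall z, H20 Omega z -> \sum_i bracket (T i) Theta z = 0.
Proof.
move=> TL HT; split.
  move=> [aT _] z Hz; have [_ [w wT]] := aT.
  have [[zL [H zH]] _] := Hz.
  rewrite (bracket_mesh TL zL wT.1 _ zH) => [|i]; last exact: is_divdiv_sub wT.
  by rewrite -(bracketE openOmega TL zL wT zH); exact: bracket_H20.
move=> h; have /choice[w wT] i : exists w, is_divdiv (T i) Theta w by have [[_ ]] := HT i.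
apply: ambient_Hdivdiv => //; split=> //; exists (piecewise w).
have gL : L2 Omega (piecewise w) by apply: L2_piecewise => i; exact: (wT i).1.
split=> // phi tphi.
have gT i : is_divdiv (T i) Theta (piecewise w).
  split; first exact: L2_piece.
  move=> psi tpsi; rewrite -((wT i).2 psi tpsi); apply: eq_Rintegral => x /set_mem Tx.
  by rewrite (piecewiseE _ Tx).
have := h phi (H20_test openOmega bndOmega tphi).
rewrite (bracket_mesh TL _ gL gT (is_hess_test openOmega bndOmega tphi)).
  by move=> /eqP; rewrite subr_eq0 => /eqP.
exact: L2_test.
Qed.

End mesh_pieces_sum.

(** * Minimum energy norms *)

Section trace_norms.
Context (R : realType) (d : nat).
Local Notation pt := 'rV[R]_d.
Local Notation tensor := (pt -> 'M[R]_d).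
Implicit Types (Theta Psi : tensor) (A : set pt) (z w : pt -> R).

(** Only integrals over A enter the definitions, so a tensor that is glued from pieces
    inherits all the data of the pieces. *)
Lemma is_divdiv_congr A Theta Psi : (forall x, A x -> Theta x = Psi x) ->
  is_divdiv A Theta = is_divdiv A Psi.
Proof.
move=> TP; apply/funext => w; rewrite /is_divdiv; congr (_ /\ _); apply: eq_forall => phi.
congr (_ -> _ = _); apply: eq_Rintegral => x /set_mem Ax.
by apply: eq_bigr => i _; apply: eq_bigr => j _; rewrite TP.
Qed.

Lemma divdiv_congr A Theta Psi : (forall x, A x -> Theta x = Psi x) ->
  divdiv A Theta = divdiv A Psi.
Proof. by move=> TP; rewrite /divdiv (is_divdiv_congr TP). Qed.

Lemma ipM_congr A Theta Theta' Psi Psi' : (forall x, A x -> Theta x = Theta' x) ->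
  (forall x, A x -> Psi x = Psi' x) -> ipM A Theta Psi = ipM A Theta' Psi'.
Proof.
move=> TT PP; apply: eq_Rintegral => x /set_mem Ax.
by apply: eq_bigr => i _; apply: eq_bigr => j _; rewrite TT ?PP.
Qed.

Lemma norm_divdiv_congr A Theta Psi : (forall x, A x -> Theta x = Psi x) ->
  norm_divdiv A Theta = norm_divdiv A Psi.
Proof. by move=> TP; rewrite /norm_divdiv (divdiv_congr TP) (ipM_congr TP TP). Qed.

Lemma bracket_congr A Theta Psi z : (forall x, A x -> Theta x = Psi x) ->
  bracket A Theta z = bracket A Psi z.
Proof. by move=> TP; rewrite /bracket (divdiv_congr TP) (@ipM_congr A Theta Psi (hess A z) (hess A z)). Qed.

Lemma L2s_congr A Theta Psi : (forall x, A x -> Theta x = Psi x) -> L2s A Theta -> L2s A Psi.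
Proof.
move=> TP [TL Ts]; split=> [i j|x Ax]; last by rewrite -TP// Ts.
rewrite /L2/= (_ : _ \_ A = (fun x => Theta x i j) \_ A); first exact: TL.
by apply/funext => x; rewrite !patchE; case: ifPn => // /set_mem Ax; rewrite TP.
Qed.

Lemma Hdivdiv_congr A Theta Psi : (forall x, A x -> Theta x = Psi x) ->
  Hdivdiv A Theta -> Hdivdiv A Psi.
Proof.
move=> TP [[TL [w wT]] approx]; split.
  by split; [exact: L2s_congr TL|exists w; rewrite -(is_divdiv_congr TP)].
move=> e e0; have [G sG Ge] := approx e e0; exists G; first exact: sG.
have h : norm_divdiv A (Theta - G) = norm_divdiv A (Psi - G).
  by apply: norm_divdiv_congr => x Ax; rewrite !fctE TP.
by rewrite -h.
Qed.

Lemma inf_ge0 (S : set R) : (forall x, S x -> 0 <= x) -> 0 <= inf S.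
Proof.
move=> S0; have [->|/set0P Sn] := eqVneq S set0; first by rewrite inf0.
exact: lb_le_inf.
Qed.

(** Since the pieces of a family can be chosen independently, near-minimizers of the
    summands assemble to a near-minimizer of the whole. *)
Lemma inf_sum_sq (I : finType) (S : set R) (P : I -> set R) :
  (forall x, S x -> 0 <= x) -> (forall i x, P i x -> 0 <= x) -> S !=set0 ->
  (forall x, S x -> exists2 p, (forall i, P i (p i)) & x ^+ 2 = \sum_i p i ^+ 2) ->
  (forall p : I -> R, (forall i, P i (p i)) -> exists2 x, S x & x ^+ 2 = \sum_i p i ^+ 2) ->
  \sum_i inf (P i) ^+ 2 = inf S ^+ 2.
Proof.
move=> S0 P0 Sn split_ join; pose a i := inf (P i); have a0 i : 0 <= a i by exact: inf_ge0 (P0 i).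
have b0 : 0 <= inf S by exact: inf_ge0.
have lbP i x : P i x -> a i <= x by move=> Px; apply: ge_inf => //; exists 0 => y; exact: P0.
have lbS x : S x -> inf S <= x by move=> Sx; apply: ge_inf => //; exists 0 => y; exact: S0.
have sum0 : 0 <= \sum_i a i ^+ 2 by apply: sumr_ge0 => i _; exact: sqr_ge0.
apply/eqP; rewrite eq_le; apply/andP; split.
  rewrite -[leLHS](sqr_sqrtr sum0) lerXn2r ?nnegrE ?sqrtr_ge0//.
  apply: lb_le_inf => // x Sx; have [p Pp xp] := split_ x Sx.
  rewrite -[leRHS]ger0_norm ?S0// -sqrtr_sqr ler_wsqrtr// xp.
  by apply: ler_sum => i _; rewrite lerXn2r ?nnegrE// ?(P0 i)// lbP.
apply/ler_addgt0Pl => e e0.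
(* exceeding the infima by t costs at most t K in the sum of squares *)
pose K := 1 + \sum_i (2 * a i + 1); have K0 : 0 < K.
  by rewrite ltr_wpDr// sumr_ge0// => i _; rewrite addr_ge0// mulr_ge0.
pose t := Num.min 1 (e / K).
have t0 : 0 < t by rewrite lt_min ltr01 divr_gt0.
have [p0 [x0 Sx0]] : exists p : I -> R, exists x, S x /\ forall i, P i (p i).
  by have [x Sx] := Sn; have [p Pp _] := split_ x Sx; exists p, x.
have /choice[p Pp] i : exists x, P i x /\ x < a i + t.
  have hi : has_inf (P i) by split; [exists (p0 i); exact: Sx0.2|exists 0 => y; exact: P0].
  by have [x Px xt] := inf_adherent t0 hi; exists x.
have [x Sx xp] := join p (fun i => (Pp i).1).
apply: (@le_trans _ _ (x ^+ 2)); first by apply: lerXn2r; rewrite ?nnegrE//; [exact: S0|exact: lbS].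
rewrite xp; apply: (@le_trans _ _ (\sum_i (a i ^+ 2 + t * (2 * a i + 1)))).
  apply: ler_sum => i _; have [Pi pt] := Pp i; apply: (@le_trans _ _ ((a i + t) ^+ 2)).
    by apply: lerXn2r; rewrite ?nnegrE; [exact: (P0 i)|rewrite addr_ge0// ltW|exact: ltW].
  have t1 : t <= 1 by rewrite ge_min lexx.
  rewrite sqrrD -addrA lerD2l mulrDr mulr1 (mulrC _ t) -mulrnAr -[a i *+ 2]mulr_natl.
  by rewrite lerD2l expr2 ler_piMl// ltW.
rewrite big_split/= -mulr_sumr addrC lerD2r.
apply: (@le_trans _ _ (t * K)); first by rewrite ler_wpM2l ?(ltW t0)// /K lerDr.
by rewrite -ler_pdivlMr// ge_min lexx orbT.
Qed.

End trace_norms.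

Theorem proposition4 (R : realType) (d : nat) (hd : d = 2%N \/ d = 3%N)
  (Omega : set 'rV[R]_d) (hdom : is_domain Omega) (hbnd : bounded_set Omega)
  (hsc : simply_connected Omega) (hlip : lipschitz_boundary Omega)
  (I : finType) (T : I -> set 'rV[R]_d) (hmesh : mesh Omega T) :
  (forall Theta : Hdivdiv_mesh Omega T,
     Hdivdiv Omega (set_val Theta) <->
     (forall z, H20 Omega z -> pairing_mesh (tr_Ggrad_mesh T z) Theta = 0)) /\
  (forall q : (forall i, H2 (T i) -> R), Htrace_mesh Omega T q ->
     \sum_(i : I) norm_dDiv_loc (q i) ^+ 2 = norm_dDiv_mesh Omega T q ^+ 2).
Proof.
have [_ oO _] := hdom; split.
  move=> Theta; have [TL HT] := set_valP Theta.
  exact: (Hdivdiv_mesh_iff oO hbnd hlip hmesh TL HT).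
move=> q; case=> Theta0 H0 q0.
have oT i : open (T i) by exact: (mesh_open hmesh).
have sT i : T i `<=` Omega by exact: (mesh_sub hmesh).
have bT i : bounded_set (T i) := bounded_subset (sT i) hbnd.
have lT i : lipschitz_boundary (T i) by exact: (mesh_lipschitz hmesh).
have piece Theta i : Hdivdiv Omega Theta -> Hdivdiv (T i) Theta.
  by move=> [aT _]; apply: ambient_Hdivdiv => //; exact: (Hdivdiv_ambient_piece hmesh).
apply: inf_sum_sq.
- by move=> _ [Psi _ <-]; exact: sqrtr_ge0.
- by move=> i _ [Psi _ <-]; exact: sqrtr_ge0.
- by exists (norm_divdiv Omega Theta0), Theta0.
- move=> x [Psi [HPsi qPsi] xPsi].
  have xE : x ^+ 2 = \sum_i norm_divdiv (T i) Psi ^+ 2.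
    by rewrite -xPsi; exact: (norm_divdiv_mesh oO hbnd hmesh HPsi.1).
  apply: (ex_intro2 _ _ (fun i => norm_divdiv (T i) Psi) _ xE) => i.
  apply: (ex_intro2 _ _ Psi _ erefl); split; first exact: piece.
  exact: (congr1 (fun t => t i) qPsi).
move=> p pP.
have /choice[F FP] i : exists Psi, [/\ Hdivdiv (T i) Psi, tr_dDiv (T i) Psi = q i &
    norm_divdiv (T i) Psi = p i].
  by have [Psi [HPsi qPsi] nPsi] := pP i; exists Psi.
pose Theta := piecewise T F.
have TF i x : T i x -> F i x = Theta x by move=> Tx; rewrite /Theta (piecewiseE hmesh F Tx).
have TL : L2s Omega Theta by apply: (L2s_piecewise oO hmesh) => i; have [h _ _] := FP i; exact: h.1.1.
have HT i : Hdivdiv (T i) Theta by apply: Hdivdiv_congr (TF i) _; have [] := FP i.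
have trT i : tr_dDiv (T i) Theta = q i.
  have [_ <- _] := FP i; apply/funext => z; apply: bracket_congr => x Tx.
  by rewrite (TF i).
(* the glued tensor has the same brackets as Theta0, whose sum vanishes *)
have HO : Hdivdiv Omega Theta.
  apply/(Hdivdiv_mesh_iff oO hbnd hlip hmesh TL HT) => z Hz.
  have TL0 := H0.1.1.
  rewrite -[RHS](((Hdivdiv_mesh_iff oO hbnd hlip hmesh TL0 (fun i => piece _ i H0)).1 H0) z Hz).
  apply: eq_bigr => i _.
  have zT : z \in H2 (T i) by apply/mem_set; exact: (H2_piece oO hbnd hmesh).
  have := congr1 (fun h => h (SigSub zT)) (trT i); rewrite -q0.
  exact.
exists (norm_divdiv Omega Theta).
  exists Theta => //; split=> //; apply: functional_extensionality_dep => i; exact: trT.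
rewrite (norm_divdiv_mesh oO hbnd hmesh HO.1); apply: eq_bigr => i _.
by have [_ _ <-] := FP i; rewrite (norm_divdiv_congr (TF i)).
Qed.
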